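(* Let $n\ge 1$, $\mu,\mu_c,\kappa>0$, $\omega=\frac{\mu_c}{\mu}$, and let $A,B\in\mathrm{GL}^+(n)$. Then there exists $M\in\mathbb{R}^{n\times n}$ such that the curve $X\colon[0,1]\to\mathrm{GL}^+(n)$ with $$X(t)=A\,\exp\big(t(\mathrm{sym}\,M-\omega\,\mathrm{skew}\,M)\big)\,\exp\big(t(1+\omega)\,\mathrm{skew}\,M\big)$$ is a shortest curve connecting $A$ and $B$, i.e. $X(0)=A$, $X(1)=B$ and $$\|M\|_{\mu,\mu_c,\kappa}=L(X)=\mathrm{dist}_{\mathrm{geod}}(A,B)=\inf_{Y\in\mathcal{A}_A^B}L(Y).$$
   Context: $\mathrm{GL}(n)$ (resp. $\mathrm{GL}^+(n)$) is the set of real $n\times n$ matrices with nonzero (resp. positive) determinant; $\exp$ is the matrix exponential. For $M\in\mathbb{R}^{n\times n}$: $\mathrm{sym}\,M=\tfrac12(M+M^T)$, $\mathrm{skew}\,M=\tfrac12(M-M^T)$, $\mathrm{dev}\,M=M-\frac{\mathrm{tr}\,M}{n}I$, and $\langle M,N\rangle=\mathrm{tr}(M^TN)$. For $\mu,\mu_c,\kappa>0$ put $$\langle M,N\rangle_{\mu,\mu_c,\kappa}=\mu\langle\mathrm{dev}\,\mathrm{sym}\,M,\mathrm{dev}\,\mathrm{sym}\,N\rangle+\mu_c\langle\mathrm{skew}\,M,\mathrm{skew}\,N\rangle+\tfrac{\kappa}{n}(\mathrm{tr}\,M)(\mathrm{tr}\,N),$$ with induced norm $\|M\|_{\mu,\mu_c,\kappa}$,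 and let $g$ be the Riemannian metric on $\mathrm{GL}(n)$ given by $g_A(M,N)=\langle A^{-1}M,A^{-1}N\rangle_{\mu,\mu_c,\kappa}$. The length of a piecewise continuously differentiable curve $X\colon[a,b]\to\mathrm{GL}(n)$ is $L(X)=\int_a^b\sqrt{g_{X(t)}(\dot X(t),\dot X(t))}\,dt$. $\mathcal{A}_A^B$ is the set of all continuous curves $Y\colon[a,b]\to\mathrm{GL}(n)$ ($a<b$ arbitrary) with $Y(a)=A$, $Y(b)=B$ for which there is a partition $a=a_0<a_1<\dots<a_{m+1}=b$ such that each $Y|_{[a_j,a_{j+1}]}$ is continuously differentiable (one-sided at endpoints) with nowhere vanishing derivative. The geodesic distance is $\mathrm{dist}_{\mathrm{geod}}(A,B)=\inf_{Y\in\mathcal{A}_A^B}L(Y)$. *)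

(* Defs.v *)
From mathcomp Require Import all_boot all_order all_algebra.
From mathcomp Require Import all_classical all_reals all_analysis.
Set Implicit Arguments.
Unset Strict Implicit.
Unset Printing Implicit Defensive.
Import Order.TTheory GRing.Theory Num.Theory.
Import numFieldNormedType.Exports.
Local Open Scope classical_set_scope.
Local Open Scope ring_scope.

Definition GL (R : realType) (n : nat) : set 'M[R]_n :=
  [set A | \det A != 0].

Definition GLplus (R : realType) (n : nat) : set 'M[R]_n :=
  [set A | 0 < \det A].

Definition expmx (R : realType) (n : nat) (M : 'M[R]_n) : 'M[R]_n :=
  limn (series (fun k => (k`!%:R)^-1 *: (M ^+ k))).

Definition sym_part (R : realType) (n : nat) (M : 'M[R]_n) : 'M[R]_n :=
  2^-1 *: (M + M^T).

Definition skew_part (R : realType) (n : nat) (M : 'M[R]_n) : 'M[R]_n :=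
  2^-1 *: (M - M^T).

Definition dev_part (R : realType) (n : nat) (M : 'M[R]_n) : 'M[R]_n :=
  M - (\tr M / n%:R)%:M.

Definition frob_inner (R : realType) (n : nat) (M N : 'M[R]_n) : R :=
  \tr (M^T *m N).

Definition iso_inner (R : realType) (n : nat) (mu muc kappa : R)
    (M N : 'M[R]_n) : R :=
  mu * frob_inner (dev_part (sym_part M)) (dev_part (sym_part N))
  + muc * frob_inner (skew_part M) (skew_part N)
  + kappa / n%:R * (\tr M * \tr N).

Definition iso_norm (R : realType) (n : nat) (mu muc kappa : R)
    (M : 'M[R]_n) : R :=
  Num.sqrt (iso_inner mu muc kappa M M).

Definition riem_metric (R : realType) (n : nat) (mu muc kappa : R)
    (A M N : 'M[R]_n) : R :=
  iso_inner mu muc kappa (invmx A *m M) (invmx A *m N).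

(* [derive1] is the two-sided derivative. For a piecewise C^1 curve on [a, b]
   it can only differ from the one-sided derivatives of the pieces at the
   finitely many partition points, which are negligible for the integral. *)
Definition curve_length (R : realType) (n : nat) (mu muc kappa a b : R)
    (Y : R -> 'M[R]_n) : \bar R :=
  (\int[lebesgue_measure]_(t in `[a, b])
     (Num.sqrt (riem_metric mu muc kappa (Y t) (derive1 Y t) (derive1 Y t)))%:E)%E.

(* The restriction of Y to [c, d] is C^1 with derivative dY. The increments are
   taken inside [c, d], so that the derivatives at c and d are one-sided and
   the values of Y outside [c, d] are irrelevant. *)
Definition C1_on (R : realType) (n : nat) (c d : R) (Y dY : R -> 'M[R]_n)
    : Prop :=
  {within `[c, d], continuous dY} /\
  forall t : R, c <= t <= d ->
    (s - t)^-1 *: (Y s - Y t) @[s --> within `[c, d] t^'] --> dY t.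

(* Y is continuous on [a, b] with values in GL(n) and piecewise C^1, all the
   derivatives of the pieces (one-sided ones included) having values in P. *)
Definition piecewise_C1 (R : realType) (n : nat) (P : set 'M[R]_n) (a b : R)
    (Y : R -> 'M[R]_n) : Prop :=
  [/\ forall t : R, a <= t <= b -> GL (Y t),
      {within `[a, b], continuous Y} &
      exists s : seq R, itv_partition a b s /\
        forall i, (i < size s)%N ->
          let c := nth a (a :: s) i in
          let d := nth a (a :: s) i.+1 in
          exists dY : R -> 'M[R]_n,
            C1_on c d Y dY /\ forall t : R, c <= t <= d -> P (dY t)].

Definition admissible (R : realType) (n : nat) (A B : 'M[R]_n) (a b : R)
    (Y : R -> 'M[R]_n) : Prop :=
  [/\ a < b, Y a = A, Y b = B & piecewise_C1 [set D | D != 0] a b Y].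

(* The infimum is taken in the extended reals: it is +oo when no admissible
   curve connects A and B. *)
Definition dist_geod (R : realType) (n : nat) (mu muc kappa : R)
    (A B : 'M[R]_n) : \bar R :=
  ereal_inf [set l | exists a b Y,
    admissible A B a b Y /\ l = curve_length mu muc kappa a b Y].

(* Main.v *)
(* Discretize.  Among the chains 1 + o(1) = g_0, ..., g_(N-1) of matrices whose
   product is A^-1 B, one of minimal energy N * sum_i |g_i - 1|^2 exists.  It is
   stationary under g_i -> g_i exp(eH), g_(i+1) -> exp(-eH) g_(i+1), which is a
   discrete Euler-Arnold equation for the velocities U_i = N (g_i - 1): the skew
   part of U_i is constant up to O(1/N), and so is U_i itself after conjugation
   by the rotations exp(i/N L), where L = (1 + omega) skew U_0.  Summing the
   errors, A^-1 B is exp(M - L) exp(L) up to O(1/N) with M = U_0, and |M|^2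
   exceeds the energy by O(1/N) at most.  Conversely, an admissible curve of
   length l is cut at points equidistant for its arclength into chains of energy
   at most l^2 + o(1).  A cluster point of the initial velocities M, as N tends
   to infinity, is the required matrix. *)

(* The form of the answer reflects a symmetry: the metric is invariant under left translations and,
   its inner product being built from traces, under right multiplication by rotations. The second
   invariance conserves the skew part of the velocity U = X^-1 X' (Noether), so that the quadratic
   Euler-Arnold equation becomes the linear equation U' = U L - L U with constant L. Its solution
   U(t) = exp(-tL) M exp(tL) integrates to X(t) = A exp(t(M - L)) exp(tL), and M - L is sym M -
   omega skew M. Discretization replaces the existence theory of geodesics by compactness in finite
   dimension, and no differential equation has to be solved. The price is that every estimate must
   be uniform in N and in the chain. Uniformity starts from a bound on N times the minimal cost that
   does not depend on N; it comes from a Lipschitz path of invertible matrices from the identity to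
   A^-1 B, and this is where the positive determinant enters. Energy is preferred to length because
   it depends smoothly on the chain and its minimizers have nearly constant speed. *)
Require Import Defs.
From mathcomp Require Import all_boot all_order all_algebra.
From mathcomp Require Import all_classical all_reals all_analysis.
From mathcomp Require Import measurable_realfun.
From mathcomp Require Import ring lra.
Set Implicit Arguments.
Unset Strict Implicit.
Unset Printing Implicit Defensive.
Import Order.TTheory GRing.Theory Num.Theory.
Import numFieldNormedType.Exports.
Local Open Scope classical_set_scope.
Local Open Scope ring_scope.


(** * Limits and derivatives of matrix functions *)

Section MatrixLimits.
Context {R : realType}.

Lemma cvg_mxP (T : Type) (F : set_system T) {FF : Filter F} (m n : nat)
    (f : T -> 'M[R]_(m, n)) (A : 'M[R]_(m, n)) :
  (f x @[x --> F] --> A) <-> (forall i j, f x i j @[x --> F] --> A i j).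
Proof.
split=> [fA i j|fA].
  by apply: (cvg_comp f (fun M : 'M[R]_(m, n) => M i j) fA);
    exact: coord_continuous.
apply/cvgrPdist_le => e e0; near=> x.
rewrite /Num.Def.normr/= mx_normrE (bigmax_le _ (ltW e0))//= => i _.
rewrite !mxE/=; move: i; near: x; apply: filter_forall => /= i.
exact: ((cvgrPdist_le _ _).1 (fA i.1 i.2)).
Unshelve. all: by end_near. Qed.

Lemma cvg_sumr (T : Type) (F : set_system T) {FF : Filter F} (I : Type)
    (r : seq I) (f : I -> T -> R) (a : I -> R) :
  (forall i, f i x @[x --> F] --> a i) ->
  \sum_(i <- r) f i x @[x --> F] --> \sum_(i <- r) a i.
Proof. by move=> fa; apply: cvg_big => // x; exact: add_continuous. Qed.

Lemma cvg_prodr (T : Type) (F : set_system T) {FF : Filter F} (I : Type)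
    (r : seq I) (f : I -> T -> R) (a : I -> R) :
  (forall i, f i x @[x --> F] --> a i) ->
  \prod_(i <- r) f i x @[x --> F] --> \prod_(i <- r) a i.
Proof. by move=> fa; apply: cvg_big => // x; exact: mul_continuous. Qed.

Lemma cvg_mulmx (T : Type) (F : set_system T) {FF : Filter F} (m n p : nat)
    (f : T -> 'M[R]_(m, n)) (g : T -> 'M[R]_(n, p)) (A : 'M[R]_(m, n))
    (B : 'M[R]_(n, p)) :
  f x @[x --> F] --> A -> g x @[x --> F] --> B ->
  f x *m g x @[x --> F] --> A *m B.
Proof.
move=> /cvg_mxP fA /cvg_mxP gB; apply/cvg_mxP => i j.
rewrite mxE; under eq_fun do rewrite mxE.
by apply: cvg_sumr => k; apply: cvgM; [exact: fA|exact: gB].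
Qed.

Lemma cvg_trmx (T : Type) (F : set_system T) {FF : Filter F} (m n : nat)
    (f : T -> 'M[R]_(m, n)) (A : 'M[R]_(m, n)) :
  f x @[x --> F] --> A -> (f x)^T @[x --> F] --> A^T.
Proof.
move=> /cvg_mxP fA; apply/cvg_mxP => i j.
by rewrite mxE; under eq_fun do rewrite mxE; exact: fA.
Qed.

Lemma cvg_mxtrace (T : Type) (F : set_system T) {FF : Filter F} (n : nat)
    (f : T -> 'M[R]_n) (A : 'M[R]_n) :
  f x @[x --> F] --> A -> \tr (f x) @[x --> F] --> \tr A.
Proof. by move=> /cvg_mxP fA; apply: cvg_sumr => i; exact: fA. Qed.

Lemma cvg_det (T : Type) (F : set_system T) {FF : Filter F} (n : nat)
    (f : T -> 'M[R]_n) (A : 'M[R]_n) :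
  f x @[x --> F] --> A -> \det (f x) @[x --> F] --> \det A.
Proof.
move=> /cvg_mxP fA; apply: cvg_sumr => s; apply: cvgM; first exact: cvg_cst.
by apply: cvg_prodr => i; exact: fA.
Qed.

Lemma cvg_adj (T : Type) (F : set_system T) {FF : Filter F} (n : nat)
    (f : T -> 'M[R]_n) (A : 'M[R]_n) :
  f x @[x --> F] --> A -> \adj (f x) @[x --> F] --> \adj A.
Proof.
move=> /cvg_mxP fA; apply/cvg_mxP => i j.
rewrite mxE; under eq_fun do rewrite mxE.
apply: cvgM; first exact: cvg_cst.
apply: cvg_det; apply/cvg_mxP => k l.
by rewrite !mxE; under eq_fun do rewrite !mxE; exact: fA.
Qed.

(** Near A the determinant stays nonzero and [invmx] is given by Cramer's formula; on singular
    matrices [invmx] is the identity map, so the formula is available only eventually along the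
    filter. *)
Lemma cvg_invmx (T : Type) (F : set_system T) {FF : Filter F} (n : nat)
    (f : T -> 'M[R]_n) (A : 'M[R]_n) :
  \det A != 0 -> f x @[x --> F] --> A -> invmx (f x) @[x --> F] --> invmx A.
Proof.
move=> A0 fA.
have invE (B : 'M[R]_n) : \det B != 0 -> invmx B = (\det B)^-1 *: \adj B.
  by move=> B0; rewrite /invmx ifT// unitmxE unitfE.
have detA : \det (f x) @[x --> F] --> \det A by exact: cvg_det.
rewrite invE//.
suff : (\det (f x))^-1 *: \adj (f x) @[x --> F] --> (\det A)^-1 *: \adj A.
  apply: cvg_trans; apply: near_eq_cvg; near=> x.
  rewrite invE//; near: x.
  exact: cvgr_neq0 detA A0.
by apply: cvgZ; [apply: cvgV => //; exact: cvg_det|exact: cvg_adj].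
Unshelve. all: by end_near. Qed.

End MatrixLimits.

Section MatrixDerivatives.
Context {R : realType}.

Lemma is_derive_mxP (m n : nat) (F : R -> 'M[R]_(m, n)) (t : R)
    (D : 'M[R]_(m, n)) :
  is_derive t 1 F D <-> forall i j, is_derive t 1 (fun s => F s i j) (D i j).
Proof.
split=> [FD i j|FD].
  have dF : derivable F t 1 by [].
  have DE : 'D_1 F t = D by exact: derive_val.
  apply: DeriveDef; first exact: (derivable_mxP F t 1).1.
  by rewrite -DE derive_mx// mxE.
have dF : derivable F t 1 by apply/derivable_mxP => i j; have := FD i j.
apply: DeriveDef => //; rewrite derive_mx//; apply/matrixP => i j.
by rewrite mxE; have := FD i j => ?; rewrite derive_val.
Qed.

Lemma is_derive_mulmx (m n p : nat) (F : R -> 'M[R]_(m, n))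
    (G : R -> 'M[R]_(n, p)) (t : R) dF dG :
  is_derive t 1 F dF -> is_derive t 1 G dG ->
  is_derive t 1 (fun s => F s *m G s) (dF *m G t + F t *m dG).
Proof.
move=> /is_derive_mxP FD /is_derive_mxP GD; apply/is_derive_mxP => i j.
have -> : (fun s => (F s *m G s) i j) =
    \sum_k (fun s => F s i k * G s k j).
  by apply/funext => s; rewrite mxE fct_sumE.
have -> : (dF *m G t + F t *m dG) i j =
    \sum_k (F t i k * dG k j + G t k j * dF i k).
  rewrite !mxE -big_split/=; apply: eq_bigr => k _.
  by rewrite addrC (mulrC (dF _ _)).
apply: is_derive_sum => k.
exact: (@is_deriveM _ _ (fun s => F s i k) (fun s => G s k j) t 1 _ _
  (FD i k) (GD k j)).
Qed.

Lemma is_derive_mulmxl (m n p : nat) (A : 'M[R]_(m, n))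
    (G : R -> 'M[R]_(n, p)) (t : R) dG :
  is_derive t 1 G dG -> is_derive t 1 (fun s => A *m G s) (A *m dG).
Proof.
move=> GD; have := is_derive_mulmx (is_derive_cst A t 1) GD.
by rewrite mul0mx add0r.
Qed.

Lemma is_derive_mulmxr (m n p : nat) (A : 'M[R]_(n, p))
    (F : R -> 'M[R]_(m, n)) (t : R) dF :
  is_derive t 1 F dF -> is_derive t 1 (fun s => F s *m A) (dF *m A).
Proof.
move=> FD; have := is_derive_mulmx FD (is_derive_cst A t 1).
by rewrite mulmx0 addr0.
Qed.

Lemma is_derive_trmx (m n : nat) (F : R -> 'M[R]_(m, n)) (t : R) dF :
  is_derive t 1 F dF -> is_derive t 1 (fun s => (F s)^T) dF^T.
Proof.
move=> /is_derive_mxP FD; apply/is_derive_mxP => i j.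
rewrite mxE; have -> : (fun s => (F s)^T i j) = (fun s => F s j i).
  by apply/funext => s; rewrite mxE.
exact: FD.
Qed.

Lemma is_derive_mxtrace (n : nat) (F : R -> 'M[R]_n) (t : R) dF :
  is_derive t 1 F dF -> is_derive t 1 (fun s => \tr (F s)) (\tr dF).
Proof.
move=> /is_derive_mxP FD.
have -> : (fun s => \tr (F s)) = \sum_i (fun s => F s i i).
  by apply/funext => s; rewrite fct_sumE.
by apply: is_derive_sum => i; exact: FD.
Qed.

Lemma is_derive_continuous (V : normedModType R) (F : R -> V) (t : R) dF :
  is_derive t 1 F dF -> F s @[s --> t] --> F t.
Proof.
by move=> [dF' _]; apply/differentiable_continuous/derivable1_diffP.
Qed.

Lemma mxentry_le_norm (m n : nat) (A : 'M[R]_(m, n)) i j : `|A i j| <= `|A|.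
Proof.
rewrite [leRHS]/Num.Def.normr/= mx_normrE.
exact: (le_bigmax _ (fun ij : 'I_m * 'I_n => `|A ij.1 ij.2|) (i, j)).
Qed.

Lemma mx_norm_leP (m n : nat) (A : 'M[R]_(m, n)) (x : R) : 0 <= x ->
  (forall i j, `|A i j| <= x) -> `|A| <= x.
Proof.
by move=> x0 Ax; rewrite /Num.Def.normr/= mx_normrE bigmax_le// => i _;
  exact: Ax.
Qed.

(** The intermediate point depends on the entry, which is harmless for the maximum norm: each entry
    is bounded separately. *)
Lemma mx_mean_value_oo (m n : nat) (F D : R -> 'M[R]_(m, n)) (a b K : R) :
  a <= b -> 0 <= K -> (forall t, t \in `]a, b[ -> is_derive t 1 F (D t)) ->
  {within `[a, b], continuous F} ->
  (forall t, t \in `]a, b[ -> `|D t| <= K) -> `|F b - F a| <= K * (b - a).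
Proof.
rewrite le_eqVlt => /predU1P[<- K0 _ _ _|ab K0 FD cF DK].
  by rewrite !subrr normr0 mulr0.
apply: mx_norm_leP => [|i j]; first by rewrite mulr_ge0// subr_ge0 ltW.
have cFij : {within `[a, b], continuous (fun s => F s i j)}.
  move=> s; apply: (cvg_comp F (fun M : 'M[R]_(m, n) => M i j) (cF s)).
  exact: coord_continuous.
have FDoo t : t \in `]a, b[ -> is_derive t 1 (fun s => F s i j) (D t i j).
  by move=> tab; exact: (is_derive_mxP _ _ _).1 (FD _ tab) i j.
have [c cab FE] := MVT ab FDoo cFij.
have ba0 : 0 <= b - a by rewrite subr_ge0 ltW.
rewrite !mxE FE normrM (ger0_norm ba0).
by rewrite ler_wpM2r// (le_trans (mxentry_le_norm _ _ _))// DK.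
Qed.

Lemma mx_mean_value (m n : nat) (F D : R -> 'M[R]_(m, n)) (a b K : R) :
  a <= b -> (forall t, t \in `[a, b] -> is_derive t 1 F (D t)) ->
  (forall t, t \in `[a, b] -> `|D t| <= K) -> `|F b - F a| <= K * (b - a).
Proof.
move=> ab FD DK.
have ooW t : t \in `]a, b[ -> t \in `[a, b].
  by rewrite !in_itv/= => /andP[/ltW-> /ltW->].
have K0 : 0 <= K by apply: le_trans (DK a _); rewrite ?in_itv/= ?lexx.
have cF : {within `[a, b], continuous F}.
  by apply: derivable_within_continuous => s sab; have := FD s sab.
exact: (mx_mean_value_oo ab K0 (fun t tab => FD t (ooW t tab)) cF
  (fun t tab => DK t (ooW t tab))).
Qed.

(** Uniqueness principle behind the identities of the exponential: its functional equation and the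
    orthogonality of rotations are proved by differentiating a candidate constant rather than by
    multiplying series. *)
Lemma mx_derive0_cst (m n : nat) (F : R -> 'M[R]_(m, n)) :
  (forall t : R, is_derive t 1 F 0) -> forall t, F t = F 0.
Proof.
move=> F0.
have cst (a b : R) : a <= b -> F b = F a.
  move=> ab; apply/eqP; rewrite -subr_eq0 -normr_le0 -(mul0r (b - a)).
  by apply: (@mx_mean_value _ _ F (fun=> 0)) => // t _; rewrite normr0.
by move=> t; have [t0|t0] := leP 0 t; [|symmetry]; apply: cst => //; exact: ltW.
Qed.

End MatrixDerivatives.

(** * The inner product *)

Fact snorm_key : unit. Proof. exact: tt. Qed.

Section ScaledNorm.
Context {R : realType} {n : nat}.
Implicit Types A B : 'M[R]_n.

(* The factor n makes the max norm submultiplicative. *)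
Definition snorm A : R := locked_with snorm_key (n%:R * `|A|).

Lemma snormE A : snorm A = n%:R * `|A|.
Proof. by rewrite /snorm unlock. Qed.

Lemma snorm_ge0 A : 0 <= snorm A.
Proof. by rewrite snormE mulr_ge0. Qed.

Lemma snorm0 : snorm 0 = 0.
Proof. by rewrite !snormE normr0 mulr0. Qed.

Lemma snormN A : snorm (- A) = snorm A.
Proof. by rewrite !snormE normrN. Qed.

Lemma snormD A B : snorm (A + B) <= snorm A + snorm B.
Proof. by rewrite !snormE -mulrDr ler_wpM2l// ler_normD. Qed.

Lemma snormB A B : snorm (A - B) <= snorm A + snorm B.
Proof. by rewrite (le_trans (snormD _ _))// snormN. Qed.

Lemma snormZ (k : R) A : snorm (k *: A) = `|k| * snorm A.
Proof. by rewrite !snormE mx_normZ mulrCA. Qed.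

Lemma norm_mulmx_le (m p : nat) (A : 'M[R]_(m, n)) (B : 'M[R]_(n, p)) :
  `|A *m B| <= n%:R * `|A| * `|B|.
Proof.
apply: mx_norm_leP => [|i j]; first by rewrite !mulr_ge0.
rewrite mxE (le_trans (ler_norm_sum _ _ _))//.
apply: (@le_trans _ _ (\sum_(k < n) `|A| * `|B|)).
  by apply: ler_sum => k _; rewrite normrM ler_pM// mxentry_le_norm.
by rewrite sumr_const card_ord -mulrA mulr_natl.
Qed.

Lemma snormM A B : snorm (A *m B) <= snorm A * snorm B.
Proof.
by rewrite !snormE mulrACA -mulrA ler_wpM2l// mulrA norm_mulmx_le.
Qed.

Lemma snorm_trmx A : snorm A^T = snorm A.
Proof.
rewrite !snormE; congr (_ * _); apply/eqP; rewrite eq_le.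
by apply/andP; split; apply: mx_norm_leP => // i j;
  [rewrite mxE|have := mxentry_le_norm A^T j i; rewrite mxE => /le_trans ->];
  rewrite ?mxentry_le_norm.
Qed.

Lemma norm_mxtrace_le A : `|\tr A| <= snorm A.
Proof.
rewrite (le_trans (ler_norm_sum _ _ _))//.
apply: (@le_trans _ _ (\sum_(k < n) `|A|)).
  by apply: ler_sum => k _; exact: mxentry_le_norm.
by rewrite sumr_const card_ord snormE mulr_natl.
Qed.

Lemma norm_le_snorm A : (0 < n)%N -> `|A| <= snorm A.
Proof. by move=> n0; rewrite !snormE ler_peMl// ler1n. Qed.

Lemma snorm_skew_part A : snorm (skew_part A) <= snorm A.
Proof.
rewrite /skew_part snormZ gtr0_norm ?invr_gt0// ler_pdivrMl//.
by rewrite (le_trans (snormB _ _))// snorm_trmx mulr_natl mulr2n.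
Qed.

Lemma snorm_mean_value (F D : R -> 'M[R]_n) (K : R) : 0 <= K ->
  (forall t : R, t \in `[0, 1] -> is_derive t 1 F (D t)) ->
  (forall t : R, t \in `[0, 1] -> snorm (D t) <= K) -> snorm (F 1 - F 0) <= K.
Proof.
move=> K0 FD DK; rewrite !snormE.
have [n0|n0] := posnP n.
  by rewrite (_ : n%:R = 0 :> R) ?mul0r// n0.
rewrite mulrC -ler_pdivlMr ?ltr0n//.
have := @mx_mean_value R n n F D 0 1 (K / n%:R) ler01 FD.
rewrite subr0 mulr1; apply=> t /DK.
by rewrite !snormE mulrC -ler_pdivlMr ?ltr0n.
Qed.

End ScaledNorm.

Section SymSkew.
Context {R : realType} {n : nat}.
Implicit Types M : 'M[R]_n.

Lemma sym_add_skew M : sym_part M + skew_part M = M.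
Proof.
rewrite /sym_part /skew_part -scalerDr addrACA subrr addr0 -mulr2n.
by rewrite -[M *+ 2]scaler_nat scalerA mulVf ?scale1r ?pnatr_eq0.
Qed.

Lemma trmx_skew_part M : (skew_part M)^T = - skew_part M.
Proof. by rewrite /skew_part linearZ/= linearB/= trmxK -scalerN opprB. Qed.

Lemma trmx_sym_part M : (sym_part M)^T = sym_part M.
Proof. by rewrite /sym_part linearZ/= linearD/= trmxK addrC. Qed.

Lemma skew_partB M N : skew_part (M - N) = skew_part M - skew_part N :> 'M[R]_n.
Proof. by apply/matrixP => i j; rewrite !mxE; ring. Qed.

End SymSkew.

Section IsoInner.
Context {R : realType} {n : nat} (mu muc kappa : R).
Hypothesis n_gt0 : (0 < n)%N.
Implicit Types M N P : 'M[R]_n.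

Local Notation iso := (iso_inner mu muc kappa).
Local Notation ca := ((mu + muc) / 2).
Local Notation cb := ((mu - muc) / 2).
Local Notation cc := ((kappa - mu) / n%:R).

Lemma mxtrace_mul_tr M N : \tr (M *m N^T) = \tr (M^T *m N).
Proof. by rewrite -mxtrace_tr trmx_mul trmxK mxtrace_mulC. Qed.

(** In terms of these three traces, bilinearity, continuity, differentiability and invariance under
    orthogonal conjugation are inherited from products and traces. *)
Lemma iso_innerE M N :
  iso M N = ca * \tr (M^T *m N) + cb * \tr (M *m N) + cc * (\tr M * \tr N).
Proof.
have trS P : \tr (sym_part P) = \tr P.
  by rewrite /sym_part mxtraceZ mxtraceD mxtrace_tr; field.
have trSZ (k : R) P : \tr (k *: sym_part P) = k * \tr P.
  by rewrite mxtraceZ trS.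
have trTT : \tr (M^T *m N^T) = \tr (M *m N).
  by rewrite -trmx_mul mxtrace_tr mxtrace_mulC.
have symE : \tr ((sym_part M)^T *m sym_part N) =
    2^-1 * (\tr (M^T *m N) + \tr (M *m N)).
  rewrite trmx_sym_part /sym_part -scalemxAl -scalemxAr !mxtraceZ.
  rewrite mulmxDl !mulmxDr !mxtraceD trTT mxtrace_mul_tr; by field.
have skewE : \tr ((skew_part M)^T *m skew_part N) =
    2^-1 * (\tr (M^T *m N) - \tr (M *m N)).
  rewrite trmx_skew_part mulNmx linearN/= /skew_part -scalemxAl -scalemxAr.
  rewrite !mxtraceZ.
  rewrite mulmxBl !mulmxBr !linearB/= trTT mxtrace_mul_tr; by field.
have n0 : n%:R != 0 :> R by rewrite pnatr_eq0 -lt0n.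
have devE : \tr ((dev_part (sym_part M))^T *m dev_part (sym_part N)) =
    2^-1 * (\tr (M^T *m N) + \tr (M *m N)) - \tr M * \tr N / n%:R.
  rewrite /dev_part !trS [(_ - _)^T]linearB/= tr_scalar_mx mulmxBl !mulmxBr.
  rewrite !linearB/= symE mul_mx_scalar mul_scalar_mx -scalar_mxM.
  rewrite mxtrace_scalar trmx_sym_part !trSZ -[_ *+ n]mulr_natr.
  by field.
rewrite /iso_inner /frob_inner devE skewE.
by field.
Qed.

Lemma iso_innerC M N : iso M N = iso N M.
Proof.
rewrite !iso_innerE (mxtrace_mulC M N) (mulrC (\tr M)); congr (_ * _ + _ + _).
by rewrite mxtrace_mulC mxtrace_mul_tr.
Qed.

Lemma iso_innerDl M N P : iso (M + N) P = iso M P + iso N P.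
Proof. rewrite !iso_innerE linearD/= !mulmxDl !mxtraceD; ring. Qed.

Lemma iso_innerZl (k : R) M P : iso (k *: M) P = k * iso M P.
Proof. rewrite !iso_innerE linearZ/= -!scalemxAl !mxtraceZ; ring. Qed.

Lemma iso_innerNl M P : iso (- M) P = - iso M P.
Proof. by rewrite -scaleN1r iso_innerZl mulN1r. Qed.

Lemma iso_innerBl M N P : iso (M - N) P = iso M P - iso N P.
Proof. by rewrite iso_innerDl iso_innerNl. Qed.

Lemma iso_innerDr M N P : iso P (M + N) = iso P M + iso P N.
Proof. by rewrite !(iso_innerC P) iso_innerDl. Qed.

Lemma iso_innerZr (k : R) M P : iso P (k *: M) = k * iso P M.
Proof. by rewrite !(iso_innerC P) iso_innerZl. Qed.

Lemma iso_innerNr M P : iso P (- M) = - iso P M.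
Proof. by rewrite !(iso_innerC P) iso_innerNl. Qed.

Lemma iso_innerBr M N P : iso P (M - N) = iso P M - iso P N.
Proof. by rewrite !(iso_innerC P) iso_innerBl. Qed.

Lemma iso_inner0l P : iso 0 P = 0.
Proof. by rewrite -(subrr 0) iso_innerBl subrr. Qed.

Lemma is_derive_iso_inner (F G : R -> 'M[R]_n) (t : R) dF dG :
  is_derive t 1 F dF -> is_derive t 1 G dG ->
  is_derive t 1 (fun s => iso (F s) (G s)) (iso dF (G t) + iso (F t) dG).
Proof.
move=> FD GD.
have D1 := is_derive_mxtrace (is_derive_mulmx (is_derive_trmx FD) GD).
have D2 := is_derive_mxtrace (is_derive_mulmx FD GD).
have D3 := is_derive_mxtrace FD; have D4 := is_derive_mxtrace GD.
have -> : (fun s => iso (F s) (G s)) =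
    (ca *: (fun s => \tr ((F s)^T *m G s)) + cb *: (fun s => \tr (F s *m G s)))
    + cc *: ((fun s => \tr (F s)) * (fun s => \tr (G s))).
  by apply/funext => s; rewrite iso_innerE.
apply: (is_derive_eq (is_deriveD
  (is_deriveD (is_deriveZ ca D1) (is_deriveZ cb D2))
  (is_deriveZ cc (is_deriveM D3 D4)))).
rewrite !iso_innerE !mxtraceD/= /GRing.scale/=.
ring.
Qed.

Lemma cvg_iso_inner (T : Type) (F : set_system T) {FF : Filter F}
    (f g : T -> 'M[R]_n) M N :
  f x @[x --> F] --> M -> g x @[x --> F] --> N ->
  iso (f x) (g x) @[x --> F] --> iso M N.
Proof.
move=> fM gN; rewrite iso_innerE; under eq_fun do rewrite iso_innerE.
apply: cvgD; [apply: cvgD|].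
- apply: cvgM; first exact: cvg_cst.
  by apply: cvg_mxtrace; apply: cvg_mulmx => //; exact: cvg_trmx.
- apply: cvgM; first exact: cvg_cst.
  by apply: cvg_mxtrace; apply: cvg_mulmx.
- apply: cvgM; first exact: cvg_cst.
  by apply: cvgM; apply: cvg_mxtrace.
Qed.

Lemma iso_inner_le : exists2 C, 0 <= C & forall M N,
  `|iso M N| <= C * (snorm M * snorm N).
Proof.
exists (`|ca| + `|cb| + `|cc|); first by rewrite !addr_ge0.
move=> M N; rewrite iso_innerE [leRHS]mulrDl [X in _ <= X + _]mulrDl.
have trM P Q : `|\tr (P *m Q)| <= snorm P * snorm Q.
  exact: le_trans (norm_mxtrace_le _) (snormM _ _).
apply: le_trans (ler_normD _ _) _; apply: lerD.
  apply: le_trans (ler_normD _ _) _.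
  apply: lerD; rewrite normrM ler_wpM2l ?trM//.
  by rewrite -(snorm_trmx M) trM.
by rewrite !normrM ler_wpM2l// ler_pM// norm_mxtrace_le.
Qed.

Lemma mxtrace_trmx_mulE M : \tr (M^T *m M) = \sum_i \sum_j M j i ^+ 2.
Proof.
by apply: eq_bigr => i _; rewrite mxE; apply: eq_bigr => j _; rewrite mxE.
Qed.

Lemma mxtrace_trmx_mul_ge0 M : 0 <= \tr (M^T *m M).
Proof.
by rewrite mxtrace_trmx_mulE !sumr_ge0// => i _; rewrite sumr_ge0// => j _;
  rewrite sqr_ge0.
Qed.

Lemma norm_sqr_le_mxtrace M : `|M| ^+ 2 <= \tr (M^T *m M).
Proof.
rewrite -(@ler_sqrt _ (`|M| ^+ 2)) ?mxtrace_trmx_mul_ge0// sqrtr_sqr.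
rewrite ger0_norm//; apply: mx_norm_leP => [|i j]; first exact: sqrtr_ge0.
rewrite -sqrtr_sqr ler_sqrt ?mxtrace_trmx_mul_ge0// mxtrace_trmx_mulE.
rewrite (bigD1 j)//= (bigD1 i)//= -addrA lerDl addr_ge0//.
  by rewrite sumr_ge0// => k _; rewrite sqr_ge0.
by rewrite sumr_ge0// => k _; rewrite sumr_ge0// => l _; rewrite sqr_ge0.
Qed.

End IsoInner.

Section IsoInnerPos.
Context {R : realType} {n : nat} (mu muc kappa : R).
Hypothesis n_gt0 : (0 < n)%N.
Hypotheses (mu_gt0 : 0 < mu) (muc_gt0 : 0 < muc) (kappa_gt0 : 0 < kappa).
Implicit Types M N P : 'M[R]_n.
Local Notation iso := (iso_inner mu muc kappa).

(** With three equal weights c, the deviatoric, skew and spherical parts reassemble by orthogonality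
    into c times the Frobenius product. Taking c as the smallest weight, the comparison is then made
    term by term. *)
Lemma frob_le_iso : exists2 c, 0 < c & forall M,
  c * \tr (M^T *m M) <= iso M M.
Proof.
pose c := Num.min mu (Num.min muc kappa).
have cmu : c <= mu by rewrite ge_min lexx.
have cmuc : c <= muc by rewrite !ge_min lexx orbT.
have ckappa : c <= kappa by rewrite !ge_min lexx !orbT.
have n0 : n%:R != 0 :> R by rewrite pnatr_eq0 -lt0n.
exists c => [|M]; first by rewrite !lt_min mu_gt0 muc_gt0.
have H : c * \tr (M^T *m M) = iso_inner c c c M M.
  by rewrite iso_innerE//; field.
rewrite H /iso_inner; apply: lerD; first apply: lerD.
- by rewrite ler_wpM2r// /frob_inner mxtrace_trmx_mul_ge0.
- by rewrite ler_wpM2r// /frob_inner mxtrace_trmx_mul_ge0.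
- by rewrite ler_wpM2r ?ler_wpM2r ?invr_ge0// -expr2 sqr_ge0.
Qed.

Lemma iso_inner_ge0 M : 0 <= iso M M.
Proof.
have [c c0 cM] := frob_le_iso.
by rewrite (le_trans _ (cM M))// mulr_ge0 ?mxtrace_trmx_mul_ge0// ltW.
Qed.

Lemma snorm_sqr_le_iso : exists2 C, 0 < C & forall M,
  snorm M ^+ 2 <= C * iso M M.
Proof.
have [c c0 cM] := frob_le_iso.
exists (n%:R ^+ 2 / c) => [|M]; first by rewrite divr_gt0// exprn_gt0// ltr0n.
rewrite !snormE exprMn -[leRHS]mulrA ler_wpM2l ?sqr_ge0// ler_pdivlMl//.
by rewrite (le_trans _ (cM M))// ler_wpM2l ?norm_sqr_le_mxtrace// ltW.
Qed.

Lemma iso_inner_eq0 M : iso M M = 0 -> M = 0.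
Proof.
have [C C0 CM] := snorm_sqr_le_iso => M0.
have := CM M; rewrite M0 mulr0 => h.
have : snorm M = 0 by apply/eqP; rewrite -sqrf_eq0 eq_le h sqr_ge0.
move/eqP; rewrite snormE mulf_eq0 pnatr_eq0 -leqn0 leqNgt n_gt0/= normr_eq0.
by move/eqP.
Qed.

Lemma iso_norm_sqr M : iso_norm mu muc kappa M ^+ 2 = iso M M.
Proof. by rewrite /iso_norm sqr_sqrtr// iso_inner_ge0. Qed.

Lemma iso_norm_ge0 M : 0 <= iso_norm mu muc kappa M.
Proof. exact: sqrtr_ge0. Qed.

Lemma iso_inner_CS M N :
  iso M N <= iso_norm mu muc kappa M * iso_norm mu muc kappa N.
Proof.
have [N0|N0] := eqVneq (iso N N) 0.
  by rewrite (iso_inner_eq0 N0) iso_innerC// iso_inner0l// mulr_ge0//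
    iso_norm_ge0.
have NN : 0 < iso N N by rewrite lt_def N0 iso_inner_ge0.
rewrite (le_trans (ler_norm _))// -sqrtr_sqr /iso_norm -sqrtrM ?iso_inner_ge0//.
rewrite ler_sqrt ?mulr_ge0 ?iso_inner_ge0//.
(* Up to the factor [iso N N], this vector is the component of M orthogonal to N; its square is
   [iso N N] times the Cauchy-Schwarz defect. *)
have := iso_inner_ge0 (iso N N *: M - iso M N *: N).
rewrite iso_innerBl// !iso_innerBr// !iso_innerZl// !iso_innerZr//
  (iso_innerC _ _ _ _ N M)//.
rewrite (_ : _ - _ = iso N N * (iso M M * iso N N - iso M N ^+ 2));
  last by ring.
by rewrite pmulr_rge0// subr_ge0.
Qed.

Lemma iso_normD M N :
  iso_norm mu muc kappa (M + N) <=
    iso_norm mu muc kappa M + iso_norm mu muc kappa N.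
Proof.
rewrite -(@ler_pXn2r _ 2)// ?nnegrE ?addr_ge0 ?iso_norm_ge0//.
rewrite sqrrD !iso_norm_sqr iso_innerDl// !iso_innerDr//
  (iso_innerC _ _ _ _ N M)//.
have := iso_inner_CS M N; lra.
Qed.

End IsoInnerPos.

(** * The matrix exponential *)

Section MatrixExponential.
Context {R : realType} {n : nat}.
Implicit Types A B M N : 'M[R]_n.

Local Notation expmx_series M :=
  (series (fun k => (k`!%:R)^-1 *: (M ^+ k))).

Lemma norm_mx1_le1 : `|1%:M : 'M[R]_n| <= 1.
Proof.
by apply: mx_norm_leP => // i j; rewrite mxE; case: eqP;
  rewrite ?normr1 ?normr0.
Qed.

Lemma norm_expr_mx_le M k : `|M ^+ k| <= snorm M ^+ k.
Proof.
elim: k => [|k IH]; first by rewrite !expr0 norm_mx1_le1.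
rewrite exprS exprS (le_trans (norm_mulmx_le _ _))// -snormE ler_wpM2l//.
exact: snorm_ge0.
Qed.

(** The left factor A is carried along because formal differentiation of the power series of A
    exp(tM) replaces A by A M; a single convergence result then covers the series and all its
    derivatives. *)
Lemma norm_expmx_coeff_le A M k i j :
  `|(k`!%:R)^-1 * (A *m M ^+ k) i j| <= snorm A * exp_coeff (snorm M) k.
Proof.
rewrite /exp_coeff normrM ger0_norm ?invr_ge0//
  mulrA [leRHS]mulrC ler_wpM2l ?invr_ge0//.
rewrite (le_trans (mxentry_le_norm _ _ _))// (le_trans (norm_mulmx_le _ _))//.
by rewrite -snormE ler_wpM2l ?norm_expr_mx_le// snorm_ge0.
Qed.

Lemma is_cvg_expmx_coeff A M i j :
  cvgn (series (fun k => (k`!%:R)^-1 * (A *m M ^+ k) i j)).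
Proof.
apply: normed_cvg.
apply: (@series_le_cvg _ _ (fun k => snorm A * exp_coeff (snorm M) k))
  => [k|k|k|].
- exact: normr_ge0.
- by rewrite mulr_ge0 ?exp_coeff_ge0// snorm_ge0.
- exact: norm_expmx_coeff_le.
- exact: (@is_cvg_seriesZ _ _ (snorm A) (is_cvg_series_exp_coeff (snorm M))).
Qed.

Lemma expmx_series_entry M k i j :
  expmx_series M k i j = series (fun k => (k`!%:R)^-1 * (M ^+ k) i j) k.
Proof. by rewrite /series/= summxE; apply: eq_bigr => l _; rewrite mxE. Qed.

Lemma cvg_expmx M : expmx_series M k @[k --> \oo] --> expmx M.
Proof.
suff H : expmx_series M k @[k --> \oo] -->
    \matrix_(i, j) limn (series (fun k => (k`!%:R)^-1 * (M ^+ k) i j)).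
  by rewrite /expmx (cvg_lim _ H).
apply/cvg_mxP => i j; rewrite mxE.
under eq_fun do rewrite expmx_series_entry.
have := @is_cvg_expmx_coeff 1%:M M i j.
by under eq_fun do rewrite mul1mx.
Qed.

Lemma exprZ_mx (t : R) M k : (t *: M) ^+ k = t ^+ k *: M ^+ k.
Proof.
elim: k => [|k IH]; first by rewrite !expr0 scale1r.
rewrite !exprS IH; have := scalemxAl t M (t ^+ k *: M ^+ k).
by rewrite -(scalemxAr _ M) scalerA => H; exact: esym H.
Qed.

Lemma pseries_expmx_coeff A M (t : R) i j :
  pseries (fun k => (k`!%:R)^-1 * (A *m M ^+ k) i j) t =
  series (fun k => (k`!%:R)^-1 * (A *m (t *: M) ^+ k) i j).
Proof.
rewrite /pseries; congr series; apply/funext => k.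
by rewrite exprZ_mx -scalemxAr [in RHS]mxE /= mulrAC -mulrA.
Qed.

Lemma pseries_diffs_expmx_coeff A M i j :
  pseries_diffs (fun k => (k`!%:R)^-1 * (A *m M ^+ k) i j) =
  (fun k => (k`!%:R)^-1 * (A *m M *m M ^+ k) i j).
Proof.
apply/funext => k; rewrite /pseries_diffs factS natrM invfM !mulrA mulfV//.
by rewrite mul1r exprS -mulmxA.
Qed.

Lemma limn_mul_expmx A M i j :
  limn (series (fun k => (k`!%:R)^-1 * (A *m M ^+ k) i j)) = (A *m expmx M) i j.
Proof.
apply: cvg_lim => //.
have /cvg_mxP/(_ i j) : A *m expmx_series M k @[k --> \oo] --> A *m expmx M.
  by apply: cvg_mulmx; [exact: cvg_cst|exact: cvg_expmx].
apply: cvg_trans; apply: near_eq_cvg; apply: nearW => k /=.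
rewrite /series/= mulmx_sumr summxE; apply: eq_bigr => l _.
by rewrite -scalemxAr mxE.
Qed.

(** Each entry is a power series in t, differentiated term by term. This asks for convergence of the
    series and of its first two formal derivatives at some point of modulus larger than that of t,
    here |t| + 1. *)
Lemma is_derive_expmx M (t : R) :
  is_derive t 1 (fun s => expmx (s *: M)) (M *m expmx (t *: M)).
Proof.
apply/is_derive_mxP => i j.
have cv A (s : R) : cvgn (pseries (fun k => (k`!%:R)^-1 * (A *m M ^+ k) i j) s).
  by rewrite pseries_expmx_coeff; exact: is_cvg_expmx_coeff.
have -> : (fun s => expmx (s *: M) i j) =
    (fun s => limn (pseries (fun k => (k`!%:R)^-1 * (1%:M *m M ^+ k) i j) s)).
  by apply/funext => s; rewrite pseries_expmx_coeff limn_mul_expmx mul1mx.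
have -> : (M *m expmx (t *: M)) i j =
    limn (pseries (pseries_diffs (fun k => (k`!%:R)^-1 * (1%:M *m M ^+ k) i j))
      t).
  rewrite pseries_diffs_expmx_coeff pseries_expmx_coeff limn_mul_expmx.
  by rewrite mul1mx.
apply: (@pseries_snd_diffs _ _ (`|t| + 1)).
- exact: cv.
- by rewrite pseries_diffs_expmx_coeff; exact: cv.
- by rewrite !pseries_diffs_expmx_coeff; exact: cv.
- by rewrite [ltRHS]ger0_norm ?addr_ge0// ltrDl.
Qed.

Lemma expmx0 : expmx 0 = 1%:M :> 'M[R]_n.
Proof.
apply: cvg_lim => //; apply: cvg_near_cst; exists 1%N => //= -[//|k] _.
rewrite /series/= big_nat_recl//= big1 ?addr0 => [|l _].
  by rewrite fact0 invr1 expr0 scale1r.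
by rewrite exprS -[0 * _]/(0 *m _) mul0mx scaler0.
Qed.

Lemma comm_expmx A M : A *m M = M *m A -> A *m expmx M = expmx M *m A.
Proof.
move=> AM.
have H1 : A *m expmx_series M k @[k --> \oo] --> A *m expmx M.
  by apply: cvg_mulmx; [exact: cvg_cst|exact: cvg_expmx].
have H2 : expmx_series M k *m A @[k --> \oo] --> expmx M *m A.
  by apply: cvg_mulmx; [exact: cvg_expmx|exact: cvg_cst].
apply: (@cvg_unique _ (@norm_hausdorff _ _) _ _ _ _ H1).
rewrite (_ : (fun k => A *m _) = (fun k => expmx_series M k *m A))//.
apply/funext => k; rewrite /series/= mulmx_sumr mulmx_suml.
apply: eq_bigr => l _; rewrite -scalemxAl -scalemxAr; congr (_ *: _).
elim: l => [|l IH]; first by rewrite !expr0 mulmx1 mul1mx.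
by rewrite exprS -[M * _]/(M *m _) mulmxA AM -mulmxA IH mulmxA.
Qed.

Lemma expmxZ_comm M (t : R) : M *m expmx (t *: M) = expmx (t *: M) *m M.
Proof. by apply: comm_expmx; rewrite -scalemxAr -scalemxAl. Qed.

Lemma is_derive_expmx_r M (t : R) :
  is_derive t 1 (fun s => expmx (s *: M)) (expmx (t *: M) *m M).
Proof. by rewrite -expmxZ_comm; exact: is_derive_expmx. Qed.

Lemma is_derive_expmx_comp M (f : R -> R) (t df : R) :
  is_derive t 1 f df ->
  is_derive t 1 (fun s => expmx (f s *: M)) (df *: (M *m expmx (f t *: M))).
Proof.
move=> fD; apply/is_derive_mxP => i j.
have /is_derive_mxP/(_ i j) ED := is_derive_expmx M (f t).
rewrite mxE.
by rewrite mulrC; exact: (is_derive1_comp ED fD).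
Qed.

(** Since M commutes with its exponentials, exp(-rM) exp(rM) and exp((s + r)M) exp(-rM) have zero
    derivative in r; their values at r = 0 give the inverse and then the addition formula. *)
Lemma expmx_add M (s t : R) :
  expmx ((s + t) *: M) = expmx (s *: M) *m expmx (t *: M).
Proof.
have inv (r : R) : expmx (- r *: M) *m expmx (r *: M) = 1%:M.
  have := @mx_derive0_cst R n n (fun r => expmx (- r *: M) *m expmx (r *: M)).
  rewrite oppr0 !scale0r expmx0 mulmx1; apply => {}r.
  have DN := is_derive_expmx_comp M (is_deriveNid r 1).
  apply: (is_derive_eq (is_derive_mulmx DN (is_derive_expmx M r))).
  rewrite (expmxZ_comm M (- r)) scaleN1r mulNmx -mulmxA.
  by rewrite addNr.
have invr (r : R) : expmx (r *: M) *m expmx (- r *: M) = 1%:M.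
  exact: mulmx1C.
have cst r : expmx ((s + r) *: M) *m expmx (- r *: M) = expmx (s *: M).
  have := @mx_derive0_cst R n n
    (fun r => expmx ((s + r) *: M) *m expmx (- r *: M)).
  rewrite oppr0 addr0 !scale0r expmx0 mulmx1; apply => {}r.
  have DN := is_derive_expmx_comp M (is_deriveNid r 1).
  have Df : is_derive r 1 (fun r : R => s + r) 1.
    by apply: (is_derive_eq
      (is_deriveD (is_derive_cst s r 1) (is_derive_id r 1))); rewrite add0r.
  have DD := is_derive_expmx_comp M Df.
  apply: (is_derive_eq (is_derive_mulmx DD DN)).
  by rewrite scale1r scaleN1r mulmxN expmxZ_comm -mulmxA addrN.
by rewrite -(cst t) -mulmxA inv mulmx1.
Qed.

End MatrixExponential.

Section MatrixExponentialBounds.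
Context {R : realType} {n : nat}.
Implicit Types A B M N K : 'M[R]_n.

Lemma expmxNl M : expmx (- M) *m expmx M = 1%:M.
Proof.
have := expmx_add M (- 1) 1.
by rewrite addrC addrN scale0r expmx0 scale1r scaleN1r => <-.
Qed.

Lemma expmxNr M : expmx M *m expmx (- M) = 1%:M.
Proof. by rewrite mulmx1C// expmxNl. Qed.

(** The exponential is the square of exp(M / 2), so its determinant is a square, nonzero because
    exp(-M) is an inverse. *)
Lemma det_expmx_gt0 M : 0 < \det (expmx M).
Proof.
have E2 : expmx M = expmx (2^-1 *: M) *m expmx (2^-1 *: M).
  by rewrite -expmx_add (_ : 2^-1 + 2^-1 = 1) ?scale1r//; field.
have D0 : \det (expmx M) != 0.
  apply/eqP => D0; have := congr1 determinant (expmxNl M).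
  by rewrite det_mulmx D0 mulr0 det1 => /eqP; rewrite eq_sym oner_eq0.
by rewrite lt_def D0/= E2 det_mulmx -expr2 sqr_ge0.
Qed.

(* The crude constant n^2 comes from bounding the exponential entrywise. *)
Definition expmx_bound (x : R) : R := n%:R ^+ 2 * expR x.

Lemma expmx_bound_ge0 x : 0 <= expmx_bound x.
Proof. by rewrite mulr_ge0 ?sqr_ge0// expR_ge0. Qed.

Lemma le_expmx_bound x y : x <= y -> expmx_bound x <= expmx_bound y.
Proof. by move=> xy; rewrite ler_wpM2l ?sqr_ge0// ler_expR. Qed.

Lemma snorm1_le : snorm (1%:M : 'M[R]_n) <= n%:R.
Proof. by rewrite !snormE ler_piMr// norm_mx1_le1. Qed.

Lemma snorm_expmx_le M : snorm (expmx M) <= expmx_bound (snorm M).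
Proof.
rewrite [leLHS]snormE /expmx_bound expr2 -[leRHS]mulrA ler_wpM2l//.
apply: mx_norm_leP => [|i j]; first by rewrite mulr_ge0 ?expR_ge0.
rewrite -[expmx M]mul1mx -limn_mul_expmx.
have cN : cvgn [normed series (fun k => (k`!%:R)^-1 * (1%:M *m M ^+ k) i j)].
  apply: (@series_le_cvg _ _ (fun k => n%:R * exp_coeff (snorm M) k))
    => [k|k|k|].
  - exact: normr_ge0.
  - by rewrite mulr_ge0 ?exp_coeff_ge0// snorm_ge0.
  - rewrite /= (le_trans (norm_expmx_coeff_le _ _ _ _ _))//
    ler_wpM2r ?snorm1_le//.
    by rewrite exp_coeff_ge0 ?snorm_ge0.
  - exact: (@is_cvg_seriesZ _ _ n%:R (is_cvg_series_exp_coeff (snorm M))).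
apply: le_trans (lim_series_norm cN) _.
have -> : n%:R * expR (snorm M) = limn (series (n%:R *: exp_coeff (snorm M))).
  by rewrite lim_seriesZ// ; exact: is_cvg_series_exp_coeff.
apply: lim_series_le => // [|k].
  exact: (@is_cvg_seriesZ _ _ n%:R (is_cvg_series_exp_coeff (snorm M))).
rewrite /= (le_trans (norm_expmx_coeff_le _ _ _ _ _))// ler_wpM2r ?snorm1_le//.
by rewrite exp_coeff_ge0 ?snorm_ge0.
Qed.

Lemma snorm_scale_le (s : R) M : s \in `[0, 1] -> snorm (s *: M) <= snorm M.
Proof.
rewrite in_itv/= => /andP[s0 s1]; rewrite snormZ ger0_norm// ler_piMl//.
exact: snorm_ge0.
Qed.

Lemma snorm_expmxB1_le M :
  snorm (expmx M - 1%:M) <= snorm M * expmx_bound (snorm M).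
Proof.
have b0 := expmx_bound_ge0 (snorm M); have s0 := snorm_ge0 M.
have := @snorm_mean_value R n (fun s => expmx (s *: M))
  (fun s => M *m expmx (s *: M)) (snorm M * expmx_bound (snorm M)).
rewrite scale1r scale0r expmx0; apply => [|t _|t t01].
- exact: mulr_ge0.
- exact: is_derive_expmx.
- rewrite (le_trans (snormM _ _))// ler_wpM2l//.
  rewrite (le_trans (snorm_expmx_le _))// le_expmx_bound//.
  exact: snorm_scale_le.
Qed.

(** The mean value inequality is applied to exp(sM) - sM, whose derivative M (exp(sM) - 1) is
    already quadratic in M. *)
Lemma snorm_expmx_taylor1_le M :
  snorm (expmx M - 1%:M - M) <= snorm M ^+ 2 * expmx_bound (snorm M).
Proof.
have b0 := expmx_bound_ge0 (snorm M); have s0 := snorm_ge0 M.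
have := @snorm_mean_value R n (fun s => expmx (s *: M) - s *: M)
  (fun s => M *m (expmx (s *: M) - 1%:M))
    (snorm M ^+ 2 * expmx_bound (snorm M)).
rewrite scale1r scale0r expmx0 subr0 addrAC; apply => [|t _|t t01].
- by rewrite mulr_ge0 ?sqr_ge0.
- rewrite mulmxBr mulmx1.
  have D2 : is_derive t 1 (fun s : R => s *: M) M.
    apply/is_derive_mxP => i j.
    have -> : (fun s : R => (s *: M) i j) = (fun s => s * M i j).
      by apply/funext => s; rewrite mxE.
    have := is_deriveM (is_derive_id t 1) (is_derive_cst (M i j) t 1).
    by rewrite scaler0 add0r /GRing.scale/= mulr1.
  exact: (is_deriveB (is_derive_expmx M t) D2).
- rewrite (le_trans (snormM _ _))// expr2 -mulrA ler_wpM2l//.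
  rewrite (le_trans (snorm_expmxB1_le _))//
    ler_pM ?snorm_ge0 ?expmx_bound_ge0//.
    exact: snorm_scale_le.
  by rewrite le_expmx_bound// snorm_scale_le.
Qed.

(** Duhamel's interpolation: exp(sA) exp((1 - s)B) runs from exp(B) to exp(A) with derivative
    exp(sA) (A - B) exp((1 - s)B). *)
Lemma snorm_expmx_lipschitz A B :
  snorm (expmx A - expmx B) <=
  expmx_bound (snorm A) * expmx_bound (snorm B) * snorm (A - B).
Proof.
have := @snorm_mean_value R n (fun s => expmx (s *: A) *m expmx ((1 - s) *: B))
  (fun s => expmx (s *: A) *m (A - B) *m expmx ((1 - s) *: B))
  (expmx_bound (snorm A) * expmx_bound (snorm B) * snorm (A - B)).
rewrite subrr subr0 !scale1r !scale0r !expmx0 mulmx1 mul1mx.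
apply => [|t _|t t01].
- by rewrite !mulr_ge0 ?expmx_bound_ge0 ?snorm_ge0.
- have D1 : is_derive t 1 (fun s : R => 1 - s) (-1).
    apply: (is_derive_eq
      (is_deriveB (is_derive_cst (1 : R) t 1) (is_derive_id t 1))).
    by rewrite sub0r.
  apply: (is_derive_eq (is_derive_mulmx (is_derive_expmx A t)
    (is_derive_expmx_comp B D1))).
  rewrite scaleN1r mulmxN mulmxBr mulmxBl expmxZ_comm.
  by rewrite [in LHS]mulmxA.
- rewrite (le_trans (snormM _ _))// [leRHS]mulrAC.
  apply: ler_pM; rewrite ?snorm_ge0//.
    rewrite (le_trans (snormM _ _))// ler_wpM2r ?snorm_ge0//.
    by rewrite (le_trans (snorm_expmx_le _))// le_expmx_bound// snorm_scale_le.
  rewrite (le_trans (snorm_expmx_le _))// le_expmx_bound// snorm_scale_le//.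
  by move: t01; rewrite !in_itv/=; lra.
Qed.

Lemma trmx_expmx_skew K : K^T = - K -> (expmx K)^T *m expmx K = 1%:M.
Proof.
move=> KT.
have := @mx_derive0_cst R n n
  (fun s => (expmx (s *: K))^T *m expmx (s *: K)).
rewrite scale0r expmx0 trmx1 mulmx1 => /(_ _ 1); rewrite scale1r; apply => t.
apply: (is_derive_eq (is_derive_mulmx (is_derive_trmx (is_derive_expmx K t))
  (is_derive_expmx K t))).
by rewrite trmx_mul KT mulmxN mulNmx mulmxA addNr.
Qed.

Lemma trmx_expmx K : K^T = - K -> (expmx K)^T = expmx (- K).
Proof.
move=> /trmx_expmx_skew KT.
by rewrite -[LHS]mulmx1 -(expmxNr K) mulmxA KT mul1mx.
Qed.

(** The exponential of a skew matrix is orthogonal, and the three traces of [iso_innerE] do not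
    change under orthogonal conjugation. This is the invariance of the metric under right
    multiplication by rotations. *)
Lemma iso_inner_conj (mu muc kappa : R) (n_gt0 : (0 < n)%N) K M N : K^T = - K ->
  iso_inner mu muc kappa (expmx K *m M *m expmx (- K))
    (expmx K *m N *m expmx (- K)) = iso_inner mu muc kappa M N.
Proof.
move=> KT; have QT := trmx_expmx KT.
have QNT : (expmx (- K))^T = expmx K
  by rewrite trmx_expmx ?opprK// linearN/= KT opprK.
have trc P : \tr (expmx K *m P *m expmx (- K)) = \tr P.
  by rewrite mxtrace_mulC mulmxA expmxNl mul1mx.
have mulc P Q : expmx K *m P *m expmx (- K) *m (expmx K *m Q *m expmx (- K)) =
    expmx K *m (P *m Q) *m expmx (- K).
  by rewrite !mulmxA -(mulmxA (expmx K *m P)) expmxNl mulmx1.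
rewrite !iso_innerE// !trmx_mul QNT QT (mulmxA (expmx K)) !mulc.
by rewrite !trc.
Qed.

End MatrixExponentialBounds.

(** * Discrete Euler-Arnold equation *)

Section UniformBounds.
Context {R : realType} {n : nat} {I : Type} (h : I -> R).
Hypothesis h01 : forall p, 0 <= h p <= 1.
Implicit Types (P : I -> Prop) (X Y : I -> 'M[R]_n).

(** The Landau symbol O(h^k), uniform over the indices in P. The constant stays existential, so that
    estimates combine like orders of magnitude without bookkeeping. *)
Definition unifO P (k : nat) X :=
  exists2 C, 0 <= C & forall p, P p -> snorm (X p) <= C * h p ^+ k.

Let h0 p : 0 <= h p. Proof. by have /andP[] := h01 p. Qed.

Lemma unifO_ext P k X Y : (forall p, P p -> X p = Y p) ->
  unifO P k X -> unifO P k Y.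
Proof. by move=> XY [C C0 XC]; exists C => // p Pp; rewrite -XY// XC. Qed.

Lemma unifO_sub P P' k X : (forall p, P p -> P' p) ->
  unifO P' k X -> unifO P k X.
Proof. by move=> PP' [C C0 XC]; exists C => // p Pp; exact/XC/PP'. Qed.

Lemma unifO_le P k l X : (l <= k)%N -> unifO P k X -> unifO P l X.
Proof.
move=> lk [C C0 XC]; exists C => // p Pp;
  rewrite (le_trans (XC _ Pp))// ler_wpM2l//.
have /andP[? ?] := h01 p.
exact: ler_wiXn2l.
Qed.

Lemma unifOD P k X Y : unifO P k X -> unifO P k Y ->
  unifO P k (fun p => X p + Y p).
Proof.
move=> [C C0 XC] [D D0 YD]; exists (C + D) => [|p Pp]; first exact: addr_ge0.
by rewrite (le_trans (snormD _ _))// mulrDl lerD// ?XC// YD.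
Qed.

Lemma unifON P k X : unifO P k X -> unifO P k (fun p => - X p).
Proof. by move=> [C C0 XC]; exists C => // p Pp; rewrite snormN XC. Qed.

Lemma unifOB P k X Y : unifO P k X -> unifO P k Y ->
  unifO P k (fun p => X p - Y p).
Proof. by move=> XO YO; apply: unifOD => //; exact: unifON. Qed.

Lemma unifOM P k l X Y : unifO P k X -> unifO P l Y ->
  unifO P (k + l) (fun p => X p *m Y p).
Proof.
move=> [C C0 XC] [D D0 YD]; exists (C * D) => [|p Pp]; first exact: mulr_ge0.
rewrite (le_trans (snormM _ _))// exprD [leRHS]mulrACA.
by apply: ler_pM; rewrite ?snorm_ge0// ?XC// YD.
Qed.

Lemma unifOZh P k X : unifO P k X -> unifO P k.+1 (fun p => h p *: X p).
Proof.
move=> [C C0 XC]; exists C => // p Pp.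
by rewrite snormZ ger0_norm// exprS [leRHS]mulrCA ler_wpM2l// XC.
Qed.

Lemma unifOZ P k X (c : I -> R) (d : R) : (forall p, P p -> `|c p| <= d) ->
  unifO P k X -> unifO P k (fun p => c p *: X p).
Proof.
move=> cd [C C0 XC]; exists (`|d| * C) => [|p Pp]; first by rewrite mulr_ge0.
rewrite snormZ -[leRHS]mulrA; apply: ler_pM; rewrite ?snorm_ge0// ?XC//.
by rewrite (le_trans (cd _ Pp))// ler_norm.
Qed.

Lemma unifO_skew P k X : unifO P k X -> unifO P k (fun p => skew_part (X p)).
Proof.
move=> [C C0 XC]; exists C => // p Pp.
by rewrite (le_trans (snorm_skew_part _))// XC.
Qed.

Lemma unifO_expmx P X : unifO P 0 X -> unifO P 0 (fun p => expmx (X p)).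
Proof.
move=> [C C0 XC]; exists (@expmx_bound R n C) => [|p Pp].
  exact: expmx_bound_ge0.
rewrite expr0 mulr1 (le_trans (snorm_expmx_le _))// le_expmx_bound//.
by have := XC _ Pp; rewrite expr0 mulr1.
Qed.

Lemma unifO_expmxB1 P X : unifO P 1 X ->
  unifO P 1 (fun p => expmx (X p) - 1%:M).
Proof.
move=> [C C0 XC]; exists (C * @expmx_bound R n C) => [|p Pp].
  by rewrite mulr_ge0// expmx_bound_ge0.
have Xh := XC _ Pp; rewrite expr1 in Xh *.
rewrite (le_trans (snorm_expmxB1_le _))// [leRHS]mulrAC.
apply: ler_pM; rewrite ?snorm_ge0 ?expmx_bound_ge0// le_expmx_bound//.
by rewrite (le_trans Xh)// ler_piMr//; have /andP[] := h01 p.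
Qed.

Lemma unifO_expmx_taylor1 P X : unifO P 1 X ->
  unifO P 2 (fun p => expmx (X p) - 1%:M - X p).
Proof.
move=> [C C0 XC]; exists (C ^+ 2 * @expmx_bound R n C) => [|p Pp].
  by rewrite mulr_ge0 ?sqr_ge0// expmx_bound_ge0.
have Xh := XC _ Pp; rewrite expr1 in Xh.
rewrite (le_trans (snorm_expmx_taylor1_le _))// [leRHS]mulrAC -exprMn.
apply: ler_pM; rewrite ?sqr_ge0 ?expmx_bound_ge0//.
  by rewrite ler_pXn2r// ?nnegrE ?snorm_ge0// mulr_ge0.
rewrite le_expmx_bound//.
by rewrite (le_trans Xh)// ler_piMr//; have /andP[] := h01 p.
Qed.

End UniformBounds.

Lemma snorm_telescope {R : realType} {n : nat} (X : nat -> 'M[R]_n) (c : R)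
  (i : nat) :
  (forall j, (j < i)%N -> snorm (X j.+1 - X j) <= c) ->
  snorm (X i - X 0) <= i%:R * c.
Proof.
elim: i => [|i IH] Xc; first by rewrite subrr snorm0 mul0r.
rewrite -(subrKA (X i)) (le_trans (snormD _ _))// addrC -natr1 mulrDl mul1r.
rewrite [leRHS]addrC [leRHS]addrC lerD//.
  by apply: IH => j ji; apply: Xc; rewrite ltnW.
exact: Xc.
Qed.

Section Chains.
Context {R : realType} {n : nat}.
Implicit Types g : nat -> 'M[R]_n.

Fixpoint chain_prod g k : 'M[R]_n :=
  if k is k'.+1 then chain_prod g k' *m g k' else 1%:M.

Definition chain_cost (mu muc kappa : R) g (N : nat) : R :=
  \sum_(0 <= i < N) iso_inner mu muc kappa (g i - 1%:M) (g i - 1%:M).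

(* The Euler-Lagrange equation of chain_cost under the variations
   (g i, g i.+1) |-> (g i (1 + eps H), (1 + eps H)^-1 g i.+1), which preserve
   the product of the chain. *)
Definition chain_stationary (mu muc kappa : R) g (N : nat) :=
  forall i H, (i.+1 < N)%N ->
    iso_inner mu muc kappa (g i - 1%:M) (g i *m H) =
    iso_inner mu muc kappa (g i.+1 - 1%:M) (H *m g i.+1).

End Chains.

Section EulerArnold.
Context {R : realType} {n : nat} (mu muc kappa : R).
Hypothesis n_gt0 : (0 < n)%N.
Hypothesis mu_gt0 : 0 < mu.
Implicit Types U H : 'M[R]_n.
Local Notation iso := (iso_inner mu muc kappa).

(* Right-hand side of the Euler-Arnold equation U' = Phi(U) satisfied by the
   left logarithmic derivative U of a geodesic. *)
Definition arnold_field U : 'M[R]_n :=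
  (1 + muc / mu) *: (U *m skew_part U - skew_part U *m U).

Lemma comm_skew_partE U : U *m skew_part U - skew_part U *m U =
  2^-1 *: (U^T *m U - U *m U^T).
Proof.
rewrite /skew_part -scalemxAr -scalemxAl -scalerBr mulmxBr mulmxBl.
by rewrite opprB addrC addrA subrK.
Qed.

Lemma trmx_arnold_field U : (arnold_field U)^T = arnold_field U.
Proof.
rewrite /arnold_field comm_skew_partE [LHS]linearZ/=; congr (_ *: _).
rewrite [LHS]linearZ/=; congr (_ *: _).
by rewrite linearB/= !trmx_mul !trmxK.
Qed.

Lemma skew_arnold_field U : skew_part (arnold_field U) = 0.
Proof. by rewrite /skew_part trmx_arnold_field subrr scaler0. Qed.

(** Thus [arnold_field U] represents H |-> <U, UH - HU>. On the right the trace terms cancel,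
    leaving (mu + muc)/2 times the trace of (U^T U - U U^T) H; on the left the field is symmetric
    and traceless, so the product acts as mu times the Frobenius one. The quotient of the weights
    yields the factor 1 + muc / mu. *)
Lemma iso_arnold_field U H :
  iso (arnold_field U) H = iso U (U *m H) - iso U (H *m U).
Proof.
have tr0 : \tr (arnold_field U) = 0.
  by rewrite /arnold_field mxtraceZ linearB/= (mxtrace_mulC U) subrr mulr0.
have mu0 : mu != 0 by rewrite gt_eqF.
have n0 : n%:R != 0 :> R by rewrite pnatr_eq0 -lt0n.
rewrite !iso_innerE// trmx_arnold_field tr0 /arnold_field comm_skew_partE.
rewrite -!scalemxAl !mxtraceZ mulmxBl linearB/= !mulmxA.
rewrite (mxtrace_mulC (U^T *m H)) (mxtrace_mulC (U *m H)) (mxtrace_mulC H)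
  !mulmxA.
by field; rewrite mu0 n0.
Qed.

End EulerArnold.

Section ChainBounds.
Context {R : realType} {n : nat} (mu muc kappa C0 : R).
Hypothesis n_gt0 : (0 < n)%N.
Hypotheses (mu_gt0 : 0 < mu) (muc_gt0 : 0 < muc) (kappa_gt0 : 0 < kappa).
Local Notation iso := (iso_inner mu muc kappa).

Definition good_chain (N : nat) (g : nat -> 'M[R]_n) :=
  [/\ (0 < N)%N, N%:R * chain_cost mu muc kappa g N <= C0 &
      chain_stationary mu muc kappa g N].

Definition velocity (N : nat) (g : nat -> 'M[R]_n) (i : nat) : 'M[R]_n :=
  N%:R *: (g i - 1%:M).

Lemma velocityE N g i : (0 < N)%N -> g i = 1%:M + N%:R^-1 *: velocity N g i.
Proof.
move=> N0; rewrite /velocity scalerA mulVf ?scale1r ?pnatr_eq0 -?lt0n//.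
by rewrite addrC subrK.
Qed.

(** Substituting g = 1 + U / N into the stationarity condition, the terms of lowest order form the
    increment of the velocity and the remaining ones carry the extra factor 1 / N. *)
Lemma velocity_step N g i (H : 'M[R]_n) : good_chain N g -> (i.+1 < N)%N ->
  iso (velocity N g i.+1 - velocity N g i) H =
  N%:R^-1 * (iso (velocity N g i) (velocity N g i *m H) -
             iso (velocity N g i.+1) (H *m velocity N g i.+1)).
Proof.
move=> [N0 _ st] iN.
have NN : N%:R != 0 :> R by rewrite pnatr_eq0 -lt0n.
have := st i H iN; rewrite [in g i *m H](velocityE g i N0).
rewrite [in H *m g i.+1](velocityE g i.+1 N0).
have gU j : g j - 1%:M = N%:R^-1 *: velocity N g j.
  by rewrite /velocity scalerA mulVf ?scale1r.
rewrite !gU mulmxDl mulmxDr mul1mx mulmx1 -scalemxAl -scalemxAr {gU}.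
move: (velocity N g i) (velocity N g i.+1) => U V.
rewrite !iso_innerZl// !iso_innerDr// !iso_innerZr// iso_innerBl// => E.
have hNZ : N%:R^-1 != 0 :> R by rewrite invr_eq0.
by move/(mulfI hNZ) : E; lra.
Qed.

Lemma velocity_energy N g : (0 < N)%N ->
  \sum_(0 <= i < N) iso (velocity N g i) (velocity N g i) =
  N%:R * (N%:R * chain_cost mu muc kappa g N).
Proof.
move=> N0; rewrite mulrA /chain_cost mulr_sumr; apply: eq_bigr => i _.
by rewrite /velocity iso_innerZl// iso_innerZr// mulrA.
Qed.

(* By stationarity the total variation of the velocities is controlled by their
   energy, so that the velocities, being bounded on average, are bounded. *)
Lemma velocity_bounded : exists2 C, 0 <= C & forall N g i,
  good_chain N g -> (i < N)%N -> snorm (velocity N g i) <= C.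
Proof.
have [K K0 isoK] := @iso_inner_le R n mu muc kappa n_gt0.
have [K' K'0 isoK'] := snorm_sqr_le_iso n_gt0 mu_gt0 muc_gt0 kappa_gt0.
have [c c0 cE] : exists2 c, 0 <= c & c = K' * K.
  by exists (K' * K); rewrite // mulr_ge0// ltW.
have [E E0 EE] : exists2 E, 0 <= E & E = K' * `|C0|.
  by exists (K' * `|C0|); rewrite // mulr_ge0// ltW.
exists (1 + E + 2 * (2 * c * E)) => [|N g i gN iN].
  by have := mulr_ge0 c0 E0; lra.
have [N0 gC _] := gN.
have N0' : 0 < N%:R :> R by rewrite ltr0n.
pose U := velocity N g; pose u j := snorm (U j).
have u0 j : 0 <= u j by exact: snorm_ge0.
have energy : \sum_(0 <= j < N) u j ^+ 2 <= N%:R * E.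
  apply: (@le_trans _ _ (\sum_(0 <= j < N) K' * iso (U j) (U j))).
    by apply: ler_sum => j _; exact: isoK'.
  rewrite -mulr_sumr velocity_energy// [leLHS]mulrCA EE.
  apply: ler_wpM2l; first exact: ltW.
  apply: ler_wpM2l; first exact: ltW.
  exact: le_trans gC (ler_norm _).
have step j : (j.+1 < N)%N ->
    snorm (U j.+1 - U j) <= c * N%:R^-1 * (u j ^+ 2 + u j.+1 ^+ 2).
  move=> jN; set D := U j.+1 - U j.
  have [->|D0] := eqVneq (snorm D) 0.
    by rewrite !mulr_ge0 ?invr_ge0 ?addr_ge0 ?sqr_ge0.
  have Dp : 0 < snorm D by rewrite lt_def D0 snorm_ge0.
  (* The step equation is tested against H = D, the increment itself; one factor [snorm D] is then
     divided out. *)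
  rewrite -(ler_pM2r Dp) -expr2 (le_trans (isoK' D))//.
  rewrite [in leLHS]velocity_step// -/U -/D.
  rewrite [leRHS](_ : _ = K' * (N%:R^-1 * (K * (u j * (u j * snorm D) +
    u j.+1 * (snorm D * u j.+1))))); last by rewrite cE; ring.
  rewrite ler_wpM2l ?(ltW K'0)// ler_wpM2l ?invr_ge0// mulrDr.
  apply: lerD.
    apply: le_trans (ler_norm _) _; apply: le_trans (isoK _ _) _.
    by apply: ler_wpM2l => //; apply: ler_wpM2l;
      [exact: snorm_ge0|exact: snormM].
  rewrite -iso_innerNl//; apply: le_trans (ler_norm _) _.
  apply: le_trans (isoK _ _) _; rewrite snormN.
  by apply: ler_wpM2l => //; apply: ler_wpM2l; [exact: snorm_ge0|exact: snormM].
have var j : (j < N)%N -> snorm (U j - U 0) <= 2 * c * E.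
  move=> jN.
  (* Each increment is charged to the squares at both its ends, so interior squares are counted
     twice; subtracting [u j ^+ 2] leaves the last one counted once and lets the induction close. *)
  have : snorm (U j - U 0) <=
      c * N%:R^-1 * (2 * \sum_(0 <= k < j.+1) u k ^+ 2 - u j ^+ 2).
    elim: j jN => [|j IH] jN.
      rewrite subrr snorm0 big_nat1 !mulr_ge0 ?invr_ge0//.
      by have := sqr_ge0 (u 0); lra.
    rewrite -(subrKA (U j)) (le_trans (snormD _ _))//.
    have := step _ jN; have := IH (ltnW jN).
    rewrite (big_nat_recr j.+1)//=; set S := \sum_(0 <= k < j.+1) _.
    set a := c * _; nra.
  move=> /le_trans; apply.
  have S0 : \sum_(0 <= k < j.+1) u k ^+ 2 <= N%:R * E.
    apply: le_trans energy.
    rewrite [leRHS](big_cat_nat (n := j.+1))//= lerDl sumr_ge0// => k _.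
    exact: sqr_ge0.
  rewrite [leRHS](_ : _ = c * N%:R^-1 * (2 * (N%:R * E))); last first.
    by field; rewrite gt_eqF.
  rewrite ler_wpM2l ?mulr_ge0 ?invr_ge0//.
  by have := sqr_ge0 (u j); lra.
rewrite -(ler_pM2l N0') -[snorm _]/(u i).
have cst (x : R) : \sum_(0 <= j < N) x = N%:R * x.
  by rewrite sumr_const_nat subn0 mulr_natl.
rewrite -cst.
(* Averaging over j: [u i] is at most [u j] plus two variations from the initial velocity, and u <=
   1 + u^2 brings in the energy. *)
apply: (@le_trans _ _ (\sum_(0 <= j < N) (1 + u j ^+ 2 + 2 * (2 * c * E)))).
  rewrite big_nat_cond [leRHS]big_nat_cond; apply: ler_sum => j.
  rewrite andbT => /andP[_ jN].
  have : u i <= u j + snorm (U i - U j).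
    by rewrite /u -{1}(subrK (U j) (U i)) addrC snormD.
  have : snorm (U i - U j) <= snorm (U i - U 0) + snorm (U j - U 0).
    by rewrite -(subrKA (U 0)) (le_trans (snormD _ _))// -(opprB (U j)) snormN.
  have := var _ iN; have := var _ jN; have := sqr_ge0 (u j - 1);
    have := sqr_ge0 (u j).
  rewrite sqrrB1; lra.
by rewrite !big_split/= !cst !mulrDr lerD// lerD.
Qed.

End ChainBounds.

Section MatrixRing.
Context {R : realType}.

Lemma mxaddE (m n : nat) (A B : 'M[R]_(m, n)) i j :
  (A + B) i j = A i j + B i j.
Proof. by rewrite mxE. Qed.

Lemma mxoppE (m n : nat) (A : 'M[R]_(m, n)) i j : (- A) i j = - A i j.
Proof. by rewrite mxE. Qed.

Lemma mxscaleE (m n : nat) (k : R) (A : 'M[R]_(m, n)) i j :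
  (k *: A) i j = k * A i j.
Proof. by rewrite mxE. Qed.

Lemma mulZmx (m n p : nat) (k : R) (A : 'M[R]_(m, n)) (B : 'M[R]_(n, p)) :
  (k *: A) *m B = k *: (A *m B).
Proof. by rewrite -scalemxAl. Qed.

Lemma mulmxZ (m n p : nat) (k : R) (A : 'M[R]_(m, n)) (B : 'M[R]_(n, p)) :
  A *m (k *: B) = k *: (A *m B).
Proof. by rewrite -scalemxAr. Qed.

Lemma skew_partZ (n : nat) (k : R) (A : 'M[R]_n) :
  skew_part (k *: A) = k *: skew_part A.
Proof. by apply/matrixP => i j; rewrite !mxE; ring. Qed.

End MatrixRing.

(* Proves matrix identities by expanding the products and then comparing
   entries, the monomials being treated as atoms. *)
Ltac mx_ring :=
  rewrite ?(mulmxDl, mulmxDr, mulmxN, mulNmx, mulmxZ, mulZmx, mul1mx, mulmx1,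
    mulmxA);
  apply/matrixP => ? ?; rewrite ?(mxaddE, mxoppE, mxscaleE); ring.

(** * Asymptotics of stationary chains *)

Section DiscreteGeodesics.
Context {R : realType} {n : nat} (mu muc kappa C0 : R).
Hypothesis n_gt0 : (0 < n)%N.
Hypotheses (mu_gt0 : 0 < mu) (muc_gt0 : 0 < muc) (kappa_gt0 : 0 < kappa).
Local Notation iso := (iso_inner mu muc kappa).
Local Notation good := (@good_chain R n mu muc kappa C0).
Local Notation omega := (muc / mu).

(* An index ((N, g), i) denotes the i-th step, at time i / N, of the chain g of
   length N; the O-estimates below are uniform in all three. *)
Let I : Type := ((nat * (nat -> 'M[R]_n)) * nat)%type.
Let h (p : I) : R := p.1.1%:R^-1.
Let sh (p : I) : I := (p.1, p.2.+1).
Let bs (p : I) : I := (p.1, 0%N).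
(** [P1] is the range of the velocities, [P2] that of their increments, and [P3] that of times and
    partial products, for which the last index N is included. *)
Let P1 (p : I) := good p.1.1 p.1.2 /\ (p.2 < p.1.1)%N.
Let P2 (p : I) := good p.1.1 p.1.2 /\ (p.2.+1 < p.1.1)%N.
Let P3 (p : I) := good p.1.1 p.1.2 /\ (p.2 <= p.1.1)%N.

Let h01 p : 0 <= h p <= 1.
Proof.
rewrite /h invr_ge0 ler0n/=; have [->|N0] := posnP p.1.1;
  first by rewrite invr0.
by rewrite invf_le1 ?ltr0n// ler1n.
Qed.

Let h0 p : 0 <= h p. Proof. by have /andP[] := h01 p. Qed.

Let P21 p : P2 p -> P1 p.
Proof. by move=> [gp /ltnW ip]. Qed.

Let P2sh p : P2 p -> P1 (sh p).
Proof. by []. Qed.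

Let P1bs p : P1 p -> P1 (bs p).
Proof. by move=> [gp ip]; split => //=; exact: leq_ltn_trans ip. Qed.

Let ihle1 p : (p.2 <= p.1.1)%N -> p.2%:R * h p <= 1.
Proof.
rewrite /h; have [->|N0] := posnP p.1.1; first by rewrite invr0 mulr0.
by move=> ip; rewrite ler_pdivrMr ?ltr0n// mul1r ler_nat.
Qed.

(** At most N increments of size O(h^2) add up to O(h), because N h <= 1; one order is lost. *)
Let telescope (Q Q' : I -> Prop) (X : I -> 'M[R]_n) :
  (forall p, Q p -> (p.2 <= p.1.1)%N) ->
  (forall p j, Q p -> (j < p.2)%N -> Q' (p.1, j)) ->
  unifO h Q' 2 (fun p => X (sh p) - X p) ->
  unifO h Q 1 (fun p => X p - X (bs p)).
Proof.
move=> QN QQ' [C C_ge0 XC]; exists C => // -[p i] Qp.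
have := @snorm_telescope R n (fun j => X (p, j)) (C * h (p, i) ^+ 2) i.
move=> /(_ _)/le_trans; apply.
  by move=> j ji; have := XC _ (QQ' _ _ Qp ji).
rewrite mulrCA ler_wpM2l// expr1 expr2 mulrA ler_piMl//.
exact: ihle1 (QN _ Qp).
Qed.

Let tel21 (X : I -> 'M[R]_n) : unifO h P2 2 (fun p => X (sh p) - X p) ->
  unifO h P1 1 (fun p => X p - X (bs p)).
Proof.
apply: telescope => [p [_ /ltnW]//|p j [gp ip] ji].
by split => //=; exact: leq_ltn_trans ip.
Qed.

Let tel13 (X : I -> 'M[R]_n) : unifO h P1 2 (fun p => X (sh p) - X p) ->
  unifO h P3 1 (fun p => X p - X (bs p)).
Proof.
apply: telescope => [p []//|p j [gp ip] ji].
by split => //=; exact: leq_trans ip.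
Qed.

Let comp (Q Q' : I -> Prop) k (X : I -> 'M[R]_n) (f : I -> I) :
  (forall p, h (f p) = h p) ->
  (forall p, Q p -> Q' (f p)) -> unifO h Q' k X -> unifO h Q k (X \o f).
Proof.
by move=> hf QQ' [C C_ge0 XC]; exists C => // p /QQ' /XC; rewrite hf.
Qed.

Let U (p : I) := velocity p.1.1 p.1.2 p.2.

Let UO : unifO h P1 0 U.
Proof.
have [C C_ge0 UC] := @velocity_bounded R n mu muc kappa C0 n_gt0 mu_gt0 muc_gt0
  kappa_gt0.
by exists C => // p [gp ip]; rewrite expr0 mulr1 /U; exact: UC.
Qed.

Let D p := U (sh p) - U p.

Let U2O : unifO h P2 0 U. Proof. exact: unifO_sub UO. Qed.
Let UshO : unifO h P2 0 (U \o sh). Proof. exact: comp UO. Qed.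

Let DE p H : P2 p -> iso (D p) H =
  h p * (iso (U p) (U p *m H) - iso (U (sh p)) (H *m U (sh p))).
Proof. by move=> [gp ip]; exact: (velocity_step _ _ gp ip). Qed.

(** Stationarity determines increments only through their products with test matrices H; the choice
    H = X p and coercivity turn such weak bounds into norm bounds. *)
Let unifO_of_iso (Q : I -> Prop) k (X : I -> 'M[R]_n) : (exists2 C, 0 <= C &
    forall p H, Q p -> iso (X p) H <= C * h p ^+ k * snorm H) ->
  unifO h Q k X.
Proof.
move=> [C C_ge0 XC].
have [K K_gt0 isoK] := snorm_sqr_le_iso n_gt0 mu_gt0 muc_gt0 kappa_gt0.
exists (K * C) => [|p Qp]; first by rewrite mulr_ge0// ltW.
have [X0|X0] := eqVneq (snorm (X p)) 0.
  by rewrite X0 !mulr_ge0// ?exprn_ge0// ltW.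
have X0' : 0 < snorm (X p) by rewrite lt_def X0 snorm_ge0.
rewrite -(ler_pM2r X0') -expr2 (le_trans (isoK _))// -!mulrA.
rewrite ler_wpM2l// ?(ltW K_gt0)//.
by rewrite mulrA XC.
Qed.

Let DO : unifO h P2 1 D.
Proof.
have [K K_ge0 isoK] := @iso_inner_le R n mu muc kappa n_gt0.
have [A A_ge0 UA] := U2O; have [B B_ge0 UB] := UshO.
apply: unifO_of_iso; exists (K * (A * A + B * B)) => [|p H Pp].
  by rewrite mulr_ge0// addr_ge0// mulr_ge0.
rewrite DE// [leRHS](_ : _ = h p * (K * (A * (A * snorm H)) +
  K * (B * (snorm H * B)))); last by ring.
have UAp := UA _ Pp; have UBp := UB _ Pp; rewrite /= !(expr0, mulr1) in UAp UBp.
rewrite ler_wpM2l// -iso_innerNl//; apply: lerD.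
  apply: le_trans (ler_norm _) _; apply: le_trans (isoK _ _) _.
  apply: ler_wpM2l => //; apply: ler_pM; rewrite ?snorm_ge0//.
  by apply: le_trans (snormM _ _) _; apply: ler_pM; rewrite ?snorm_ge0.
apply: le_trans (ler_norm _) _; apply: le_trans (isoK _ _) _.
rewrite snormN; apply: ler_wpM2l => //; apply: ler_pM; rewrite ?snorm_ge0//.
by apply: le_trans (snormM _ _) _; apply: ler_pM; rewrite ?snorm_ge0.
Qed.

Let E p := D p - h p *: arnold_field mu muc (U p).

(** Bootstrap: the exact step equation involves the next velocity where the Euler-Arnold field has
    the present one, and the exchange costs h times [D], which is O(h^2) by [DO]. *)
Let EO : unifO h P2 2 E.
Proof.
have [K K_ge0 isoK] := @iso_inner_le R n mu muc kappa n_gt0.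
have [A A_ge0 UA] := U2O; have [B B_ge0 UB] := UshO; have [C C_ge0 DC] := DO.
apply: unifO_of_iso; exists (K * C * (A + B)) => [|p H Pp].
  by rewrite !mulr_ge0// addr_ge0.
have UAp := UA _ Pp; have UBp := UB _ Pp; have DCp := DC _ Pp.
rewrite /= !(expr0, mulr1) in UAp UBp; rewrite expr1 in DCp.
have -> : iso (E p) H =
    h p * (- iso (D p) (H *m U (sh p)) - iso (U p) (H *m D p)).
  rewrite /E iso_innerBl// iso_innerZl// iso_arnold_field// DE// -mulrBr.
  congr (_ * _); rewrite /D iso_innerBl// mulmxBr iso_innerBr//; ring.
rewrite [leRHS](_ : _ = h p * (K * (C * h p * (snorm H * B)) +
  K * (A * (snorm H * (C * h p))))); last by ring.
rewrite ler_wpM2l// -!iso_innerNl//; apply: lerD.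
  apply: le_trans (ler_norm _) _; apply: le_trans (isoK _ _) _.
  rewrite snormN; apply: ler_wpM2l => //; apply: ler_pM; rewrite ?snorm_ge0//.
  by apply: le_trans (snormM _ _) _; apply: ler_pM; rewrite ?snorm_ge0.
apply: le_trans (ler_norm _) _; apply: le_trans (isoK _ _) _.
rewrite snormN; apply: ler_wpM2l => //; apply: ler_pM; rewrite ?snorm_ge0//.
by apply: le_trans (snormM _ _) _; apply: ler_pM; rewrite ?snorm_ge0.
Qed.

Let K0 p := skew_part (U (bs p)).

(** Discrete conservation law: the Euler-Arnold field is symmetric, so the increment of the skew
    part is only the O(h^2) error [E], and telescoping gives O(h). *)
Let skewO : unifO h P1 1 (fun p => skew_part (U p) - K0 p).
Proof.
apply: (@tel21 (fun p => skew_part (U p))).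
apply: unifO_ext (unifO_skew EO) => p _ /=.
by rewrite /E /D skew_partB skew_partZ skew_arnold_field scaler0 subr0
  skew_partB.
Qed.

Let L p := (1 + omega) *: K0 p.

Let UbsO : unifO h P1 0 (U \o bs). Proof. exact: comp UO. Qed.

Let LO : unifO h P1 0 L.
Proof.
apply: (@unifOZ _ _ _ h P1 0 K0 (fun=> 1 + omega) `|1 + omega|) => //.
exact: unifO_skew UbsO.
Qed.

(* One step of the discrete Euler-Arnold equation, with the skew part frozen at
   its initial value. *)
Let FO : unifO h P2 2 (fun p => D p - h p *: (U p *m L p - L p *m U p)).
Proof.
have sk : unifO h P2 1 (fun p => skew_part (U p) - K0 p).
  by apply: unifO_sub skewO.
have H : unifO h P2 2 (fun p => E p + (1 + omega) *: (h p *: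
   (U p *m (skew_part (U p) - K0 p) - (skew_part (U p) - K0 p) *m U p))).
  apply: unifOD => //; apply: (unifOZ (d := `|1 + omega|)) => //.
  apply: unifOZh => //; apply: unifOB.
    exact: (unifOM U2O sk).
  exact: (unifOM sk U2O).
apply: unifO_ext H => p _; rewrite /E /L /arnold_field.
move: (skew_part (U p)) (K0 p) (U p) (D p) => k k0 u d.
mx_ring.
Qed.

Let ex (M : 'M[R]_n) (s t : R) :
  expmx (s *: M) *m expmx (t *: M) = expmx ((s + t) *: M).
Proof. by rewrite expmx_add. Qed.

Let t_ (p : I) : R := p.2%:R * h p.
(** [Q] is the rotation over one step and [Qi] the accumulated one up to step i; the letter n marks
    their inverses. *)
Let Q p := expmx (h p *: L p).
Let Qn p := expmx (- h p *: L p).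
Let Qi p := expmx (t_ p *: L p).
Let Qin p := expmx (- t_ p *: L p).

Let t_sh p : t_ (sh p) = t_ p + h p.
Proof. by rewrite /t_ /= -natr1 mulrDl mul1r. Qed.

Let t_le1 p : P3 p -> `|t_ p| <= 1.
Proof.
by move=> [_ ip]; rewrite ger0_norm; [exact: ihle1|rewrite mulr_ge0].
Qed.

Let P13 p : P1 p -> P3 p.
Proof. by move=> [gp /ltnW ip]. Qed.

Let P3bs p : P3 p -> P1 (bs p).
Proof. by move=> [[N0 gp st] ip]; split. Qed.

Let Ubs3O : unifO h P3 0 (U \o bs). Proof. exact: comp UO. Qed.

Let L3O : unifO h P3 0 L.
Proof.
apply: (@unifOZ _ _ _ h P3 0 K0 (fun=> 1 + omega) `|1 + omega|) => //.
exact: unifO_skew Ubs3O.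
Qed.

Let expO (Z : I -> 'M[R]_n) (s : I -> R) : (forall p, P3 p -> `|s p| <= 1) ->
  unifO h P3 0 Z -> unifO h P3 0 (fun p => expmx (s p *: Z p)).
Proof.
by move=> s1 ZO; apply: unifO_expmx; apply: (unifOZ (d := 1)).
Qed.

Let tn_le1 p : P3 p -> `|- t_ p| <= 1.
Proof. by rewrite normrN; exact: t_le1. Qed.

Let h_le1 p : P3 p -> `|h p| <= 1.
Proof. by move=> _; have /andP[? ?] := h01 p; rewrite ger0_norm. Qed.

Let hn_le1 p : P3 p -> `|- h p| <= 1.
Proof. by rewrite normrN; exact: h_le1. Qed.

Let Qi_sh p : Qi (sh p) = Qi p *m Q p.
Proof. by rewrite /Qi t_sh -ex. Qed.

Let Qin_sh p : Qin (sh p) = Qn p *m Qin p.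
Proof. by rewrite /Qin t_sh opprD addrC -ex. Qed.

Let QnQin p : Qn p *m Qin p = Qin p *m Qn p.
Proof. by rewrite /Qn /Qin !ex addrC. Qed.

Let QQn p : Q p *m Qn p = 1%:M.
Proof. by rewrite /Q /Qn ex addrN scale0r expmx0. Qed.

Let QinQi p : Qin p *m Qi p = 1%:M.
Proof. by rewrite /Qin /Qi ex addNr scale0r expmx0. Qed.

Let taylor (Z : I -> 'M[R]_n) (P : I -> Prop) : unifO h P 0 Z ->
  unifO h P 2 (fun p => expmx (h p *: Z p) - 1%:M - h p *: Z p).
Proof. by move=> ZO; apply: unifO_expmx_taylor1 => //; exact: unifOZh. Qed.

Let taylorN (Z : I -> 'M[R]_n) (P : I -> Prop) : unifO h P 0 Z ->
  unifO h P 2 (fun p => expmx (- h p *: Z p) - 1%:M + h p *: Z p).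
Proof.
move=> /unifON/taylor; apply: unifO_ext => p _.
by rewrite scalerN -scaleNr scaleNr opprK.
Qed.

Let L2O : unifO h P2 0 L. Proof. exact: unifO_sub LO. Qed.
Let QO : unifO h P3 0 Q. Proof. exact: expO. Qed.
Let QnO : unifO h P3 0 Qn. Proof. exact: expO. Qed.
Let QiO : unifO h P3 0 Qi. Proof. exact: expO. Qed.
Let QinO : unifO h P3 0 Qin. Proof. exact: expO. Qed.

(* The velocity in the frame rotated along the geodesic; it is constant in the
   continuous limit. *)
Let T p := Qi p *m U p *m Qin p.

Let T_bs p : T (bs p) = U (bs p).
Proof.
by rewrite /T /Qi /Qin /t_ /= mul0r oppr0 !scale0r expmx0 mul1mx mulmx1.
Qed.

Let TO : unifO h P1 1 (fun p => T p - U (bs p)).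
Proof.
suff H : unifO h P2 2 (fun p => T (sh p) - T p).
  by have := tel21 H; apply: unifO_ext => p _; rewrite T_bs.
have P23 p : P2 p -> P3 p by move=> /P21/P13.
(* This sum equals Q U' - U Q with U' = U + D the next velocity: inserting Q = 1 + hL + O(h^2), the
   first-order part is D - h (U L - L U), which [FO] bounds. *)
have H1 : unifO h P2 2 (fun p => (Q p - 1%:M - h p *: L p) *m U (sh p)
    - U p *m (Q p - 1%:M - h p *: L p)
    + (D p - h p *: (U p *m L p - L p *m U p)) + h p *: (L p *m D p)).
  apply: unifOD; [apply: unifOD; [apply: unifOB|]|] => //.
  - by apply: (@unifOM _ _ _ h P2 2 0) => //; exact: taylor.
  - by apply: (@unifOM _ _ _ h P2 0 2) => //; exact: taylor.
  - by apply: (@unifOZh _ _ _ h h01 P2 1); exact: (@unifOM _ _ _ h P2 0 1).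
have H2 := unifOM (unifO_sub P23 QiO) (unifOM H1
  (unifOM (unifO_sub P23 QnO) (unifO_sub P23 QinO))).
apply: unifO_ext H2 => p _; rewrite /T Qi_sh Qin_sh /=.
have -> : Qi p *m U p *m Qin p = Qi p *m (U p *m Q p *m (Qn p *m Qin p)).
  by rewrite -!mulmxA (mulmxA (Q p)) QQn mul1mx.
rewrite -[U p *m Q p *m _]mulmxA.
have -> : U (sh p) = U p + D p by rewrite /D addrC subrK.
move: (Qi p) (U p) (Q p) (Qn p *m Qin p) (D p) (L p) => a u q b d l.
mx_ring.
Qed.

Let T0O : unifO h P1 0 T.
Proof.
have QiO1 : unifO h P1 0 Qi by exact: unifO_sub QiO.
have QinO1 : unifO h P1 0 Qin by exact: unifO_sub QinO.
exact: (unifOM (unifOM QiO1 UO) QinO1).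
Qed.

(** Discrete Gronwall estimate: each factor multiplies the norm by at most 1 + C / N <= exp(C / N),
    and there are at most N factors. *)
Let prodO : unifO h P3 0 (fun p => chain_prod p.1.2 p.2).
Proof.
have [C C_ge0 UC] := UO; exists (n%:R * expR C) => [|[[N g] i] [gp /= iN]].
  by rewrite mulr_ge0 ?expR_ge0.
have gN : good N g by exact: gp.
clear gp; have N0 : (0 < N)%N by case: gN.
have hN : 0 <= N%:R^-1 :> R by rewrite invr_ge0.
rewrite expr0 mulr1.
have : snorm (chain_prod g i) <= n%:R * expR (i%:R * (N%:R^-1 * C)).
  elim: i iN => [|i IH] iN; first by rewrite mul0r expR0 mulr1 snorm1_le.
  have Ui : snorm (velocity N g i) <= C.
    by have := UC ((N, g), i); rewrite expr0 mulr1; apply; split.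
  rewrite /= (velocityE g i N0) mulmxDr mulmx1 -scalemxAr.
  rewrite -natr1 mulrDl mul1r expRD mulrA (le_trans (snormD _ _))//.
  apply: (@le_trans _ _ (snorm (chain_prod g i) * (1 + N%:R^-1 * C))).
    rewrite mulrDr mulr1 lerD// snormZ ger0_norm// mulrCA ler_wpM2l//.
    by rewrite (le_trans (snormM _ _))// ler_wpM2l ?snorm_ge0.
  apply: ler_pM; rewrite ?snorm_ge0 ?IH ?(ltnW iN)//.
    by rewrite addr_ge0// mulr_ge0.
  exact: expR_ge1Dx.
move=> /le_trans; apply; rewrite ler_wpM2l// ler_expR mulrA ler_piMl//.
by rewrite ler_pdivrMr ?ltr0n// mul1r ler_nat.
Qed.

Let S p := U (bs p) - L p.
Let Ein p := expmx (- t_ p *: S p).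
Let En p := expmx (- h p *: S p).

Let Ein_sh p : Ein (sh p) = En p *m Ein p.
Proof. by rewrite /Ein t_sh opprD addrC -ex. Qed.

Let SO : unifO h P3 0 S. Proof. exact: unifOB. Qed.
Let EinO : unifO h P3 0 Ein. Proof. exact: expO. Qed.

(* The endpoint of the chain compared with that of the geodesic. *)
Let X p := chain_prod p.1.2 p.2 *m Qin p *m Ein p.

Let XO : unifO h P3 1 (fun p => X p - 1%:M).
Proof.
suff H : unifO h P1 2 (fun p => X (sh p) - X p).
  have := tel13 H; apply: unifO_ext => p _; congr (_ - _).
  by rewrite /X /Qin /Ein /t_ /= mul0r oppr0 !scale0r expmx0 !mul1mx.
have S1O : unifO h P1 0 S by exact: unifO_sub SO.
have hTO : unifO h P1 1 (fun p => h p *: T p) by exact: unifOZh.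
have bO : unifO h P1 1 (fun p => Qn p - 1%:M).
  apply: unifO_expmxB1 => //.
  have := unifOZh h01 (unifON LO); apply: unifO_ext => p _.
  by rewrite scalerN scaleNr.
have cO : unifO h P1 1 (fun p => En p - 1%:M).
  apply: unifO_expmxB1 => //.
  have := unifOZh h01 (unifON S1O); apply: unifO_ext => p _.
  by rewrite scalerN scaleNr.
(* Expansion of (1 + hT) Qn En - 1. The linear terms hT, -hL and -hS combine to h (T - U_0), because
   S = U_0 - L, and this is O(h^2) by [TO]; the other terms are Taylor remainders and products of
   small factors. *)
have H1 : unifO h P1 2 (fun p => h p *: (T p - U (bs p))
   + (Qn p - 1%:M + h p *: L p) + (En p - 1%:M + h p *: S p)
   + ((h p *: T p) *m (Qn p - 1%:M) + (h p *: T p) *m (En p - 1%:M)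
   + (Qn p - 1%:M) *m (En p - 1%:M)
   + (h p *: T p) *m (Qn p - 1%:M) *m (En p - 1%:M))).
  apply: unifOD; first apply: unifOD; first apply: unifOD.
  - exact: unifOZh.
  - exact: taylorN.
  - exact: taylorN.
  apply: unifOD; first apply: unifOD; first apply: unifOD.
  - exact: (unifOM hTO bO).
  - exact: (unifOM hTO cO).
  - exact: (unifOM bO cO).
  - by apply: (unifO_le h01 (_ : 2 <= 3)%N) => //;
    exact: (unifOM (unifOM hTO bO) cO).
have H2 := unifOM (unifOM (unifO_sub P13 prodO) (unifO_sub P13 QinO))
  (unifOM H1 (unifO_sub P13 EinO)).
apply: unifO_ext H2 => p [[N0 _ _] _]; rewrite /X Qin_sh QnQin Ein_sh /=.
rewrite (velocityE p.1.2 p.2 N0) -/(h p) -/(U p).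
(* Moving the accumulated rotation to the left of the new factor replaces U by the rotated velocity
   T. *)
have -> : chain_prod p.1.2 p.2 *m (1%:M + h p *: U p) *m (Qin p *m Qn p) =
    chain_prod p.1.2 p.2 *m Qin p *m (1%:M + h p *: T p) *m Qn p.
  rewrite /T; move: (U p) => u.
  rewrite mulmxDr mulmx1 mulmxDl [in RHS]mulmxDr [in RHS]mulmxDl mulmx1.
  rewrite mulmxA; congr (_ + _); rewrite -!scalemxAr -!scalemxAl.
  by rewrite !mulmxA -(mulmxA _ (Qin p) (Qi p)) QinQi mulmx1.
rewrite /S; move: (chain_prod _ _ *m Qin p) (h p) (T p) (Qn p) (En p) (Ein p).
move: (U (bs p)) (L p) => m l a x t b c e.
mx_ring.
Qed.

(** At the last index the time is 1, and [X] is the chain product times the inverse of exp(S)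
    exp(L); multiplying [XO] by this bounded matrix gives the claim. *)
Lemma chain_endpoint : exists2 C, 0 <= C & forall N g M,
  good N g -> M = velocity N g 0 ->
  snorm (chain_prod g N - expmx (M - (1 + omega) *: skew_part M) *m
    expmx ((1 + omega) *: skew_part M)) <= C / N%:R.
Proof.
have eO : unifO h P3 0 (fun p => expmx (S p) *m expmx (L p)).
  by apply: (@unifOM _ _ _ h P3 0 0); exact: unifO_expmx.
have [C C_ge0 XC] := unifOM XO eO.
exists C => // N g _ gN ->; set M := velocity N g 0; have [N0 _ _] := gN.
have := XC ((N, g), N); rewrite addn0 expr1 => /(_ (conj gN (leqnn N))).
set p := ((N, g), N) => H.
suff <- : (X p - 1%:M) *m (expmx (S p) *m expmx (L p)) =
    chain_prod g N - expmx (M - (1 + omega) *: skew_part M) *m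
    expmx ((1 + omega) *: skew_part M) by exact: H.
have cancel (P s l : 'M[R]_n) :
    P *m expmx (- l) *m expmx (- s) *m (expmx s *m expmx l) = P.
  by rewrite -!mulmxA (mulmxA (expmx (- s))) expmxNl mul1mx expmxNl mulmx1.
rewrite mulmxBl mul1mx /X /Qin /Ein.
have -> : t_ p = 1 by rewrite /t_ /h/= mulfV// pnatr_eq0 -lt0n.
by rewrite !scaleN1r cancel.
Qed.

(** Rotations preserve the inner product, so the velocities U_i and T_i have the same norm, and T_i
    is within O(1 / N) of M. Averaging over i compares the square of M with the energy. *)
Lemma chain_energy : exists2 C, 0 <= C & forall N g M,
  good N g -> M = velocity N g 0 ->
  iso M M <= N%:R * chain_cost mu muc kappa g N + C / N%:R.
Proof.
have [K K_ge0 isoK] := @iso_inner_le R n mu muc kappa n_gt0.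
have [A A_ge0 TA] := T0O; have [B B_ge0 UB] := UO; have [C C_ge0 TC] := TO.
exists (K * (C * (A + B))) => [|N g _ gN ->].
  by rewrite !mulr_ge0// addr_ge0.
set M := velocity N g 0.
have [N0 _ _] := gN; have N0' : 0 < N%:R :> R by rewrite ltr0n.
have step i : (i < N)%N -> iso M M <=
    iso (velocity N g i) (velocity N g i) + K * (C * (A + B)) / N%:R.
  move=> iN; pose p : I := ((N, g), i).
  have Pp : P1 p by [].
  have MB : snorm M <= B.
    by have := UB _ (P1bs Pp); rewrite expr0 mulr1.
  have := TA _ Pp; rewrite expr0 mulr1 => TAp.
  have TCp := TC _ Pp.
  have -> : iso (velocity N g i) (velocity N g i) = iso (T p) (T p).
    rewrite /T /Qi /Qin scaleNr iso_inner_conj//.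
    rewrite linearZ/= -scalerN; congr (_ *: _).
    by rewrite /L linearZ/= trmx_skew_part scalerN.
  rewrite -lerBlDl.
  have -> : iso M M - iso (T p) (T p) = - iso (T p - M) (T p) - iso (T p - M) M.
    rewrite !iso_innerBl// (iso_innerC _ _ _ n_gt0 M (T p)); ring.
  rewrite [leRHS](_ : _ = K * ((C * N%:R^-1) * A) + K * ((C * N%:R^-1) * B));
    last by ring.
  rewrite -!iso_innerNl//; apply: lerD; (apply: le_trans (ler_norm _) _;
    apply: le_trans (isoK _ _) _; rewrite snormN; apply: ler_wpM2l => //;
    by apply: ler_pM; rewrite ?snorm_ge0).
rewrite -(ler_pM2l N0') [leRHS]mulrDr -velocity_energy//.
have -> : N%:R * iso M M = \sum_(0 <= i < N) iso M M.
  by rewrite sumr_const_nat subn0 mulr_natl.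
have -> : N%:R * (K * (C * (A + B)) / N%:R) =
    \sum_(0 <= i < N) (K * (C * (A + B)) / N%:R).
  by rewrite sumr_const_nat subn0 mulr_natl.
rewrite -big_split/= big_nat_cond [leRHS]big_nat_cond; apply: ler_sum => i.
by rewrite andbT => /andP[_ iN]; exact: step.
Qed.

Lemma chain_velocity0_bounded : exists2 C, 0 <= C & forall N g, good N g ->
  snorm (velocity N g 0) <= C.
Proof.
have [C C_ge0 UC] := UO; exists C => // N g gN; have [N0 _ _] := gN.
by have := UC ((N, g), 0%N) (conj gN N0); rewrite expr0 mulr1.
Qed.

End DiscreteGeodesics.

(** * Minimal chains *)

Section MinimalChains.
Context {R : realType} {n : nat} (mu muc kappa : R).
Hypothesis n_gt0 : (0 < n)%N.
Hypotheses (mu_gt0 : 0 < mu) (muc_gt0 : 0 < muc) (kappa_gt0 : 0 < kappa).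
Local Notation iso := (iso_inner mu muc kappa).
Local Notation cost := (@chain_cost R n mu muc kappa).
Implicit Types g : nat -> 'M[R]_n.

Lemma eq_chain_prod g g' k : (forall i, (i < k)%N -> g i = g' i) ->
  chain_prod g k = chain_prod g' k.
Proof.
elim: k => [//|k IH] gg' /=; rewrite IH ?gg'// => i ik.
by apply: gg'; rewrite ltnW.
Qed.

Lemma eq_chain_cost g g' k : (forall i, (i < k)%N -> g i = g' i) ->
  cost g k = cost g' k.
Proof.
move=> gg'; rewrite /chain_cost big_nat_cond [RHS]big_nat_cond.
by apply: eq_bigr => i; rewrite andbT => /andP[_ /gg' ->].
Qed.

Lemma chain_cost_ge0 g k : 0 <= cost g k.
Proof. by rewrite sumr_ge0// => i _; rewrite iso_inner_ge0. Qed.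

Section Encoding.
Variable N : nat.

(** Chains are encoded as row vectors so that [bounded_closed_compact] applies; indices beyond N are
    sent to the identity. *)
Let chain_of (v : 'rV[R]_(N * (n * n))) (i : nat) : 'M[R]_n :=
  if insub i is Some k then vec_mx (row k (vec_mx v)) else 1%:M.

Let chain_ofE v (k : 'I_N) a b :
  chain_of v k a b = v 0 (mxvec_index k (mxvec_index a b)).
Proof. by rewrite /chain_of valK !mxE. Qed.

Let encode g : 'rV[R]_(N * (n * n)) :=
  mxvec (\matrix_(k < N) mxvec (g k)).

Let encodeK g i : (i < N)%N -> chain_of (encode g) i = g i.
Proof.
move=> iN; apply/matrixP => a b; rewrite (chain_ofE _ (Ordinal iN)).
by rewrite /encode mxvecE mxE mxvecE.
Qed.

Let chain_of_continuous i : continuous (fun v => chain_of v i).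
Proof.
move=> v; rewrite /chain_of; case: insubP => [k _ _|_];
  last exact: cst_continuous.
apply/(@cvg_mxP R _ (nbhs v) (nbhs_filter v)) => a b.
rewrite !mxE; under eq_fun do rewrite !mxE.
exact: coord_continuous.
Qed.

Let chain_prod_continuous k : continuous (fun v => chain_prod (chain_of v) k).
Proof.
elim: k => [|k IH] v; first exact: cst_continuous.
apply: (@cvg_mulmx R _ (nbhs v) (nbhs_filter v)).
  exact: (IH v).
exact: (@chain_of_continuous k v).
Qed.

Let chain_cost_continuous : continuous (fun v => cost (chain_of v) N).
Proof.
move=> v; have FF := nbhs_filter v.
apply: (@cvg_sumr R _ (nbhs v) FF) => i.
have cB : chain_of w i - 1%:M @[w --> v] --> chain_of v i - 1%:M.
  apply: (@cvgB _ _ _ (nbhs v) FF); first exact: (@chain_of_continuous i v).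
  exact: cst_continuous.
exact: (@cvg_iso_inner R n mu muc kappa n_gt0 _ (nbhs v) FF).
Qed.

(** The chains with product B that cost no more than [g0] form a nonempty compact set, on which the
    continuous cost attains its minimum; a chain outside this set with product B costs more than
    [g0]. *)
Lemma minimal_chain_exists (B : 'M[R]_n) g0 : chain_prod g0 N = B ->
  exists2 g, chain_prod g N = B &
    forall g', chain_prod g' N = B -> cost g N <= cost g' N.
Proof.
move=> g0B; pose c0 := cost g0 N.
pose A := [set v | `|chain_prod (chain_of v) N - B| <= 0] `&`
          [set v | cost (chain_of v) N <= c0].
have AE g' : chain_prod g' N = B -> cost g' N <= c0 -> A (encode g').
  move=> g'B g'c; split => /=.
    by rewrite (@eq_chain_prod _ g') ?g'B ?subrr ?normr0// => i /encodeK.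
  by rewrite (@eq_chain_cost _ g')// => i /encodeK.
have cA : closed A.
  apply: closedI.
    apply: (@preimage_closed _ _ (fun v => `|chain_prod (chain_of v) N - B|)
      [set x | x <= 0]); last exact: closed_le.
    move=> v _; have FF := nbhs_filter v.
    apply: (@cvg_norm _ _ _ (nbhs v) FF); apply: (@cvgB _ _ _ (nbhs v) FF).
      exact: (@chain_prod_continuous N v).
    exact: cst_continuous.
  apply: (@preimage_closed _ _ (fun v => cost (chain_of v) N)
    [set x | x <= c0]); last exact: closed_le.
  by move=> v _; exact: chain_cost_continuous.
have bA : bounded_set A.
  have [K K_gt0 isoK] := snorm_sqr_le_iso n_gt0 mu_gt0 muc_gt0 kappa_gt0.
  (* A factor differs from the identity by at most x with x^2 <= K c0, hence x <= 1 + K c0; the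
     final 1 accounts for the entries of the identity. *)
  exists (1 + K * c0 + 1); split; first exact: num_real.
  move=> M /ltW Mgt v [_ /= vc].
  have c0_ge0 : 0 <= c0 by exact: chain_cost_ge0.
  apply: le_trans Mgt; apply: mx_norm_leP => [|i j].
    by rewrite !addr_ge0// mulr_ge0// ltW.
  rewrite ord1; case/mxvec_indexP: j => k j; case/mxvec_indexP: j => a b.
  rewrite -chain_ofE.
  have : `|chain_of v k - 1%:M| <= 1 + K * c0.
    rewrite (le_trans (norm_le_snorm _ n_gt0))//.
    have := isoK (chain_of v k - 1%:M); set x := snorm _ => xK.
    have : iso (chain_of v k - 1%:M) (chain_of v k - 1%:M) <= c0.
      apply: le_trans vc; rewrite /chain_cost big_mkord (bigD1 k)//= lerDl.
      by rewrite sumr_ge0// => l _; rewrite iso_inner_ge0.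
    rewrite -(ler_pM2l K_gt0) => /(le_trans xK).
    by have := sqr_ge0 (x - 1); have := sqr_ge0 x; rewrite sqrrB1; lra.
  have := mxentry_le_norm (chain_of v k - 1%:M) a b.
  have := mxentry_le_norm (1%:M : 'M[R]_n) a b; have := @norm_mx1_le1 R n.
  rewrite mxaddE mxoppE.
  have := ler_normD (chain_of v k a b - 1%:M a b) (1%:M a b); rewrite subrK.
  lra.
have [|v vA vmin] := compact_EVT_min _ (bounded_closed_compact bA cA)
  (continuous_subspaceT chain_cost_continuous).
  by exists (encode g0); apply: AE.
move: vA; rewrite inE => -[/=]; rewrite normr_le0 subr_eq0 => /eqP vB vc.
exists (chain_of v) => // g' g'B.
have [g'c|/ltW] := leP (cost g' N) c0; last exact: le_trans.
have := vmin (encode g'); rewrite inE => /(_ (AE _ g'B g'c)).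
by rewrite (@eq_chain_cost (chain_of (encode g')) g')// => i /encodeK.
Qed.

End Encoding.

(** Exponentials instead of 1 + eH keep the product exactly constant for every e, with an explicit
    inverse, and have the same first-order term. *)
Let vary g i H (e : R) j : 'M[R]_n :=
  if j == i then g i *m expmx (e *: H)
  else if j == i.+1 then expmx (- e *: H) *m g i.+1 else g j.

Let vary_prod g i H e k : (i.+1 < k)%N ->
  chain_prod (vary g i H e) k = chain_prod g k.
Proof.
elim: k => [//|k IH]; rewrite ltnS leq_eqVlt => /predU1P[<-|ik] /=.
  rewrite /= (@eq_chain_prod _ g i) => [|j ji].
    rewrite /vary eqxx gtn_eqF// eqxx -!mulmxA; congr (_ *m (_ *m _)).
    by rewrite mulmxA -expmx_add subrr scale0r expmx0 mul1mx.
  by rewrite /vary !ltn_eqF// ltnW.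
by rewrite IH// /vary !gtn_eqF// ltnW.
Qed.

Let vary_cost_part g i H (e : R) :=
  iso (g i *m expmx (e *: H) - 1%:M) (g i *m expmx (e *: H) - 1%:M) +
  iso (expmx (- e *: H) *m g i.+1 - 1%:M) (expmx (- e *: H) *m g i.+1 - 1%:M).

Let vary_cost g i H e N : (i.+1 < N)%N ->
  cost (vary g i H e) N =
  cost g N + (vary_cost_part g i H e - vary_cost_part g i H 0).
Proof.
move=> iN; have iN' := ltnW iN.
have split (F : nat -> R) : \sum_(0 <= j < N) F j = F i + F i.+1 +
    \sum_(0 <= j < N | (j != i) && (j != i.+1)) F j.
  rewrite (bigD1_seq i) ?iota_uniq ?mem_index_iota//= -addrA; congr (_ + _).
  rewrite [LHS](big_rem i.+1) ?mem_index_iota//= gtn_eqF//=; congr (_ + _).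
  rewrite rem_filter ?iota_uniq// big_filter_cond.
  by apply: eq_bigl => j /=; rewrite andbC.
rewrite /chain_cost !split
  [in LHS](eq_bigr (fun j => iso (g j - 1%:M) (g j - 1%:M))).
  rewrite /vary_cost_part /vary !eqxx gtn_eqF//
    oppr0 scale0r expmx0 mulmx1 mul1mx; ring.
by move=> j /andP[/negbTE ji /negbTE ji1]; rewrite /vary ji ji1.
Qed.

(** Up to a constant, the varied cost is a function [phi] of e with a minimum at 0; equating its
    computed derivative with 0 gives twice the stationarity condition. *)
Lemma minimal_chain_stationary N g :
  (forall g', chain_prod g' N = chain_prod g N -> cost g N <= cost g' N) ->
  chain_stationary mu muc kappa g N.
Proof.
move=> gmin i H iN.
have phi_min e : vary_cost_part g i H 0 <= vary_cost_part g i H e.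
  have := gmin _ (vary_prod g H e iN); rewrite (vary_cost g H e iN).
  move: (cost g N) (vary_cost_part g i H e) (vary_cost_part g i H 0) => x y z.
  by rewrite lerDl subr_ge0.
pose phi := vary_cost_part g i H.
have D1 (e : R) : is_derive e 1 (fun e => g i *m expmx (e *: H) - 1%:M)
    (g i *m (H *m expmx (e *: H))).
  apply: (is_derive_eq
    (is_deriveB (is_derive_mulmxl (g i) (is_derive_expmx H e))
    (is_derive_cst (1%:M : 'M[R]_n) e 1))).
  by rewrite subr0.
have D2 (e : R) : is_derive e 1 (fun e => expmx (- e *: H) *m g i.+1 - 1%:M)
    ((-1 *: (H *m expmx (- e *: H))) *m g i.+1).
  apply: (is_derive_eq (is_deriveB (is_derive_mulmxr (g i.+1)
    (is_derive_expmx_comp H (is_deriveNid e 1)))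
    (is_derive_cst (1%:M : 'M[R]_n) e 1))).
  by rewrite subr0.
pose a := g i - 1%:M; pose b := g i.+1 - 1%:M.
have Dphi (e : R) := is_deriveD
  (is_derive_iso_inner mu muc kappa n_gt0 (D1 e) (D1 e))
  (is_derive_iso_inner mu muc kappa n_gt0 (D2 e) (D2 e)).
have Dphi0 : is_derive (0 : R) (1 : R) phi
    (iso (g i *m H) a + iso a (g i *m H) + (iso (- (H *m g i.+1)) b +
     iso b (- (H *m g i.+1)))).
  apply: (is_derive_eq (Dphi 0)).
  by rewrite oppr0 !scale0r expmx0 !mulmx1 scaleN1r mulNmx mul1mx.
have dphi0 : is_derive (0 : R) (1 : R) phi 0.
  apply: (@derive1_at_min _ phi (-1) 1) => [|t _||t _].
  - by lra.
  - by have := Dphi t.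
  - by rewrite in_itv/= ltrN10 ltr01.
  - exact: phi_min.
have := @derive_val _ _ _ _ _ _ _ Dphi0.
rewrite (@derive_val _ _ _ _ _ _ _ dphi0) iso_innerNl// iso_innerNr//.
by rewrite (iso_innerC _ _ _ _ (g i *m H))// (iso_innerC _ _ _ _ (H *m _))//;
  lra.
Qed.

End MinimalChains.

(** * Lipschitz paths of positive determinant *)

Section Connectedness.
Context {R : realType}.

(* B is joined to the identity by a Lipschitz path P of invertible matrices
   with bounded inverse path Q. *)
Definition lipschitz_connected (n : nat) (B : 'M[R]_n) :=
  exists (P Q : R -> 'M[R]_n) (C : R), [/\ 0 <= C, P 0 = 1%:M, P 1 = B,
    forall t, 0 <= t <= 1 -> [/\ P t *m Q t = 1%:M, `|P t| <= C & `|Q t| <= C] &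
    forall s t, 0 <= s <= 1 -> 0 <= t <= 1 -> `|P s - P t| <= C * `|s - t|].

Lemma lipschitz_connectedM (n : nat) (A B : 'M[R]_n) :
  lipschitz_connected A -> lipschitz_connected B ->
  lipschitz_connected (A *m B).
Proof.
move=> [P [Q [C [C0 P0 P1 PQ PL]]]] [P' [Q' [C' [C'0 P'0 P'1 PQ' PL']]]].
exists (fun t => P t *m P' t), (fun t => Q' t *m Q t), (2 * (n%:R * C * C')).
have nCC : 0 <= n%:R * C * C' by rewrite !mulr_ge0.
have mulb (X Y : 'M[R]_n) x y : 0 <= x -> `|X| <= x -> `|Y| <= y ->
    `|X *m Y| <= n%:R * x * y.
  move=> x0 Xx Yy; rewrite (le_trans (norm_mulmx_le _ _))//.
  by apply: ler_pM => //; rewrite ler_wpM2l.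
split; rewrite ?P0 ?P'0 ?P1 ?P'1 ?mulmx1//; first by rewrite mulr_ge0.
- move=> t t01; have [PQ1 Pb Qb] := PQ _ t01; have [PQ1' Pb' Qb'] := PQ' _ t01.
  split.
  + by rewrite mulmxA -(mulmxA (P t)) PQ1' mulmx1.
  + by have := mulb _ _ _ _ C0 Pb Pb'; lra.
  + have := mulb _ _ _ _ C'0 Qb' Qb.
    by rewrite (_ : n%:R * C' * C = n%:R * C * C'); [lra|ring].
- move=> s t s01 t01; have [_ Pb _] := PQ _ t01; have [_ Pb' _] := PQ' _ s01.
  have -> : P s *m P' s - P t *m P' t =
      (P s - P t) *m P' s + P t *m (P' s - P' t).
    by rewrite mulmxBl mulmxBr addrA subrK.
  rewrite (le_trans (ler_normD _ _))//.
  have Ls : 0 <= C * `|s - t| by rewrite mulr_ge0.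
  have := mulb _ _ _ _ Ls (PL _ _ s01 t01) Pb'.
  have := mulb _ _ _ _ C0 Pb (PL' _ _ s01 t01).
  rewrite (_ : n%:R * (C * `|s - t|) * C' = n%:R * C * C' * `|s - t|);
    last by ring.
  by rewrite -[n%:R * C * (C' * _)]mulrA !mulrA; lra.
Qed.

(** As E^2 = 0, the segment 1 + tE has the inverse 1 - tE, so both are bounded without any
    determinant estimate. *)
Lemma lipschitz_connected_unipotent (n : nat) (E : 'M[R]_n) :
  E *m E = 0 -> lipschitz_connected (1%:M + E).
Proof.
move=> EE; exists (fun t => 1%:M + t *: E), (fun t => 1%:M - t *: E),
  (1 + `|E|).
have tE t : 0 <= t <= 1 -> `|t *: E| <= `|E|.
  by move=> /andP[t0 t1]; rewrite mx_normZ ger0_norm// ler_piMl.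
split; rewrite ?scale0r ?addr0 ?scale1r//.
- move=> t t01; split.
  + rewrite mulmxBr mulmx1 mulmxDl mul1mx -scalemxAl -scalemxAr EE !scaler0
    addr0.
    by rewrite addrK.
  + by rewrite (le_trans (ler_normD _ _))// lerD// ?norm_mx1_le1// tE.
  + by rewrite (le_trans (ler_normB _ _))// lerD// ?norm_mx1_le1// tE.
- move=> s t _ _; rewrite opprD addrACA subrr add0r -scalerBl mx_normZ mulrC.
  by rewrite ler_wpM2r// lerDr.
Qed.

Lemma lipschitz_connected_unipotentM (n : nat) (E B : 'M[R]_n) :
  E *m E = 0 -> lipschitz_connected ((1%:M + E) *m B) -> lipschitz_connected B.
Proof.
move=> EE cB; have -> : B = (1%:M - E) *m ((1%:M + E) *m B).
  rewrite mulmxA mulmxDr mulmx1 mulmxBl EE mul1mx subr0 subrK.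
  by rewrite mul1mx.
apply: lipschitz_connectedM => //; apply: lipschitz_connected_unipotent.
by rewrite mulmxN mulNmx EE !oppr0.
Qed.

Lemma lipschitz_connected_pos1 (B : 'M[R]_1) :
  0 < B 0 0 -> lipschitz_connected B.
Proof.
set b := B 0 0 => b0.
have BE : B = b%:M by rewrite [LHS]mx11_scalar.
have scal1 (x : R) : `|x%:M : 'M[R]_1| <= `|x|.
  by apply: mx_norm_leP => // i j; rewrite !ord1 mxE eqxx mulr1n.
(* Lower bound for the segment from 1 to b, whose reciprocal bounds the inverse path. *)
pose m := Num.min 1 b; have m0 : 0 < m by rewrite lt_min ltr01.
have lb t : 0 <= t <= 1 -> m <= 1 + t * (b - 1).
  have m1 : m <= 1 by rewrite ge_min lexx.
  have mb : m <= b by rewrite ge_min lexx orbT.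
  move=> /andP[t0 t1].
  have := mulr_ge0 t0 (_ : 0 <= b - m); rewrite subr_ge0 => /(_ mb).
  have := mulr_ge0 (_ : 0 <= 1 - t) (_ : 0 <= 1 - m); rewrite !subr_ge0.
  move=> /(_ t1 m1); lra.
exists (fun t => (1 + t * (b - 1))%:M), (fun t => (1 + t * (b - 1))^-1%:M).
exists (1 + `|b - 1| + m^-1); split.
- by rewrite !addr_ge0// invr_ge0 ltW.
- by rewrite mul0r addr0.
- by rewrite mul1r addrC subrK.
- move=> t t01; have lbt := lb _ t01.
  have pt : 0 < 1 + t * (b - 1) by exact: lt_le_trans lbt.
  have mi : 0 < m^-1 by rewrite invr_gt0.
  split; first by rewrite -scalar_mxM mulfV// gt_eqF.
  + rewrite (le_trans (scal1 _))// (le_trans (ler_normD _ _))// normr1 normrM.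
    have /andP[t0 t1] := t01; rewrite (ger0_norm t0).
    by have := ler_piMl (normr_ge0 (b - 1)) t1; lra.
  + rewrite (le_trans (scal1 _))// ger0_norm ?invr_ge0 ?ltW//.
    have : (1 + t * (b - 1))^-1 <= m^-1 by rewrite lef_pV2// posrE.
    by have := normr_ge0 (b - 1); lra.
- move=> s t _ _; rewrite -raddfB (le_trans (scal1 _))//.
  have -> : 1 + s * (b - 1) - (1 + t * (b - 1)) = (b - 1) * (s - t) by ring.
  rewrite normrM ler_wpM2r//.
  have mi : 0 < m^-1 by rewrite invr_gt0.
  by lra.
Qed.

Lemma lipschitz_connected_block (n : nat) (B : 'M[R]_n) :
  lipschitz_connected B ->
    lipschitz_connected (block_mx (1%:M : 'M[R]_1) 0 0 B).
Proof.
have nb (x : 'M[R]_1) (X : 'M[R]_n) (c : R) : `|x| <= c -> `|X| <= c ->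
    `|block_mx x 0 0 X| <= c.
  move=> xc Xc; have c0 : 0 <= c := le_trans (normr_ge0 _) xc.
  apply: mx_norm_leP => // i j.
  case: (split_ordP i) => i' ->; case: (split_ordP j) => j' ->.
  - by rewrite block_mxEul (le_trans (mxentry_le_norm _ _ _)).
  - by rewrite block_mxEur mxE normr0.
  - by rewrite block_mxEdl mxE normr0.
  - by rewrite block_mxEdr (le_trans (mxentry_le_norm _ _ _)).
move=> [P [Q [C [C0 P0 P1 PQ PL]]]].
exists (fun t => block_mx 1%:M 0 0 (P t)), (fun t => block_mx 1%:M 0 0 (Q t)).
exists (1 + C); split.
- by rewrite addr_ge0.
- by rewrite P0 -scalar_mx_block.
- by rewrite P1.
- move=> t t01; have [PQ1 Pb Qb] := PQ _ t01; split.
  + by rewrite mulmx_block !mulmx0 !mul0mx !mul1mx !addr0 !add0r PQ1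
    -scalar_mx_block.
  + by apply: nb; [have := @norm_mx1_le1 R 1|]; lra.
  + by apply: nb; [have := @norm_mx1_le1 R 1|]; lra.
- move=> s t s01 t01; rewrite opp_block_mx add_block_mx subrr !subr0.
  have L := PL _ _ s01 t01; have := normr_ge0 (s - t).
  have Cst : 0 <= C * `|s - t| by rewrite mulr_ge0.
  by move=> st0; apply: nb; rewrite ?normr0 mulrDl mul1r; lra.
Qed.

(* Block Gaussian elimination by unipotent factors, which are joined to the
   identity by straight segments. *)
Lemma det_gt0_lipschitz_connected (n : nat) (B : 'M[R]_n) :
  0 < \det B -> lipschitz_connected B.
Proof.
elim: n B => [|m IH] B detB.
  rewrite (_ : B = 1%:M + 0); last by apply/matrixP => -[].
  by apply: lipschitz_connected_unipotent; rewrite mulmx0.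
rewrite -[m.+1]/(1 + m)%N in B detB *.
have lowE (w : 'cV[R]_m) : 1%:M + block_mx 0 0 w 0 =
  block_mx (1%:M : 'M[R]_1) 0 w 1%:M.
  by rewrite scalar_mx_block add_block_mx !addr0 add0r.
have upE (v : 'rV[R]_m) : 1%:M + block_mx 0 v 0 0 =
  block_mx (1%:M : 'M[R]_1) v 0 1%:M.
  by rewrite scalar_mx_block add_block_mx !addr0 add0r.
have low0 (w : 'cV[R]_m) : block_mx 0 0 w 0 *m block_mx 0 0 w 0 =
  0 :> 'M[R]_(1 + m).
  by rewrite mulmx_block !mulmx0 !mul0mx !addr0 block_mx0.
have up0 (v : 'rV[R]_m) : block_mx 0 v 0 0 *m block_mx 0 v 0 0 =
  0 :> 'M[R]_(1 + m).
  by rewrite mulmx_block !mulmx0 !mul0mx !addr0 block_mx0.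
(* With corner 1, the middle factor of the LDU factorization contains the Schur complement D - c r,
   of the same determinant, to which the induction hypothesis applies. *)
have stepA (r : 'rV[R]_m) (c : 'cV[R]_m) (D : 'M[R]_m) :
    0 < \det (block_mx (1%:M : 'M[R]_1) r c D) ->
    lipschitz_connected (block_mx (1%:M : 'M[R]_1) r c D).
  have E : block_mx (1%:M : 'M[R]_1) r c D = (1%:M + block_mx 0 0 c 0) *m
      (block_mx 1%:M 0 0 (D - c *m r) *m (1%:M + block_mx 0 r 0 0)).
    rewrite lowE upE !mulmx_block !mulmx0 !mul0mx !mul1mx !mulmx1 !addr0 !add0r.
    by rewrite mulmx1 addrC subrK.
  rewrite E !det_mulmx lowE upE !(det_lblock, det_ublock) !det1 !mul1r mulr1.
  move=> /IH cD; rewrite -lowE -upE.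
  apply: lipschitz_connectedM; first exact: lipschitz_connected_unipotent.
  apply: lipschitz_connectedM; last exact: lipschitz_connected_unipotent.
  exact: lipschitz_connected_block.
have stepB (a : 'M[R]_1) (r : 'rV[R]_m) (c : 'cV[R]_m) (D : 'M[R]_m) : c != 0 ->
    0 < \det (block_mx a r c D) -> lipschitz_connected (block_mx a r c D).
  move=> /matrix0Pn[i [j ci]]; rewrite ord1 {j} in ci.
  (* Coefficients of a row operation that makes the corner 1, using only the row of the nonzero
     entry [c i 0]. *)
  pose v : 'rV[R]_m := ((1 - a 0 0) / c i 0) *: delta_mx 0 i.
  have vc : a + v *m c = 1%:M.
    rewrite /v -scalemxAl -rowE [a]mx11_scalar; apply/matrixP => x y.
    by rewrite !ord1 !mxE eqxx mulr1n divfK// addrC subrK.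
  move=> detD; apply: (lipschitz_connected_unipotentM (up0 v)).
  have E : (1%:M + block_mx 0 v 0 0) *m block_mx a r c D =
      block_mx 1%:M (r + v *m D) c D.
    by rewrite upE mulmx_block !mul1mx !mul0mx !add0r vc.
  by rewrite E; apply: stepA; rewrite -E det_mulmx upE det_ublock !det1 !mul1r.
rewrite -[B]submxK in detB *.
move: (ulsubmx B) (ursubmx B) (dlsubmx B) (drsubmx B) detB => a r c D detB.
(* If the column below the corner vanishes, the corner does not, as the determinant is positive.
   Adding the first row to all others then makes the column nonzero, unless the matrix is 1 by 1. *)
have [c0|] := eqVneq c 0; last by move=> c0; exact: stepB.
rewrite c0 in detB *.
have a0 : a 0 0 != 0.
  apply: contraTneq detB => a0; rewrite det_ublock det_mx11 a0 mul0r.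
  by rewrite ltxx.
have [m0|m0] := posnP m.
  by subst m; apply: lipschitz_connected_pos1; rewrite -det_mx11; exact: detB.
pose w : 'cV[R]_m := const_mx 1.
apply: (lipschitz_connected_unipotentM (low0 w)).
have E : (1%:M + block_mx 0 0 w 0) *m block_mx a r 0 D =
    block_mx a r (w *m a) (w *m r + D).
  by rewrite lowE mulmx_block !mul1mx !mul0mx !addr0.
rewrite E; apply: stepB; last first.
  by rewrite -E det_mulmx lowE det_lblock !det1 !mul1r.
apply/matrix0Pn; exists (Ordinal m0), 0.
by rewrite mxE big_ord1 mxE mul1r.
Qed.

(** The path is sampled at the times i / N, with factors P(t_i)^-1 P(t_(i+1)) that are O(1 / N) away
    from the identity; N of them cost O(1 / N), which the factor N compensates. *)
Lemma lipschitz_connected_chain (n : nat) (mu muc kappa : R) (B : 'M[R]_n) :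
  (0 < n)%N -> lipschitz_connected B ->
  exists2 C, 0 <= C & forall N, (0 < N)%N -> exists2 g, chain_prod g N = B &
    N%:R * chain_cost mu muc kappa g N <= C.
Proof.
move=> n_gt0 [P [Q [C [C0 P0 P1 PQ PL]]]].
have [K K_ge0 isoK] := @iso_inner_le R n mu muc kappa n_gt0.
pose c : R := (n%:R * C) * (n%:R * C).
exists (K * (c * c)) => [|N N0].
  by rewrite !mulr_ge0.
have N0' : 0 < N%:R :> R by rewrite ltr0n.
pose t i : R := i%:R / N%:R.
have t01 i : (i <= N)%N -> 0 <= t i <= 1.
  by move=> iN; rewrite divr_ge0//= ler_pdivrMr// mul1r ler_nat.
have tS i : t i.+1 - t i = N%:R^-1.
  by rewrite /t -mulrBl -natr1 addrAC subrr add0r mul1r.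
pose g i := Q (t i) *m P (t i.+1).
have gP k : (k <= N)%N -> chain_prod g k = P (t k).
  elim: k => [|k IH] kN; first by rewrite /t mul0r P0.
  rewrite /= IH 1?ltnW// /g mulmxA.
  by have [-> _ _] := PQ _ (t01 _ (ltnW kN)); rewrite mul1mx.
exists g; first by rewrite gP// /t mulfV ?gt_eqF// P1.
have gB i : (i < N)%N -> snorm (g i - 1%:M) <= c / N%:R.
  move=> iN; have [PQ1 _ Qb] := PQ _ (t01 _ (ltnW iN)).
  have -> : g i - 1%:M = Q (t i) *m (P (t i.+1) - P (t i)).
    by rewrite mulmxBr (mulmx1C PQ1).
  rewrite (le_trans (snormM _ _))// /c -[leRHS]mulrA.
  have Pb := PL _ _ (t01 _ iN) (t01 _ (ltnW iN)).
  have N1 : 0 <= N%:R^-1 :> R by rewrite invr_ge0.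
  rewrite tS (ger0_norm N1) in Pb.
  apply: ler_pM; rewrite ?snorm_ge0// snormE.
    by rewrite ler_wpM2l.
  by rewrite -mulrA ler_wpM2l.
apply: (@le_trans _ _ (N%:R * \sum_(0 <= i < N) K * ((c / N%:R) * (c / N%:R)))).
  apply: ler_wpM2l; first exact: ltW.
  rewrite /chain_cost big_nat_cond [leRHS]big_nat_cond.
  apply: ler_sum => i; rewrite andbT => /andP[_ iN].
  apply: le_trans (ler_norm _) _; apply: le_trans (isoK _ _) _.
  rewrite ler_wpM2l//; apply: ler_pM; rewrite ?snorm_ge0//; exact: gB.
rewrite sumr_const_nat subn0 -mulr_natl le_eqVlt; apply/orP; left; apply/eqP.
by field; rewrite gt_eqF.
Qed.

End Connectedness.

(** * Chains along admissible curves *)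

Section Reachability.
Context {R : realType} {n : nat} (mu muc kappa : R).
Hypothesis n_gt0 : (0 < n)%N.
Hypotheses (mu_gt0 : 0 < mu) (muc_gt0 : 0 < muc) (kappa_gt0 : 0 < kappa).
Local Notation iso := (iso_inner mu muc kappa).
Local Notation inorm := (iso_norm mu muc kappa).
Local Notation cost := (@chain_cost R n mu muc kappa).
Implicit Types A B : 'M[R]_n.

(* B is reached from A by chains of arbitrarily small steps of total length
   arbitrarily close to l. *)
Definition chain_reach A B (l : R) := forall e, 0 < e ->
  exists2 d0, 0 < d0 & forall d, 0 < d -> d < d0 ->
    exists (g : nat -> 'M[R]_n) (k : nat), [/\ A *m chain_prod g k = B,
      k%:R * d <= l + e & forall i, (i < k)%N -> inorm (g i - 1%:M) <= d].

Lemma chain_prod_cat (g g' : nat -> 'M[R]_n) k k' :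
  chain_prod (fun i => if (i < k)%N then g i else g' (i - k)%N) (k + k') =
  chain_prod g k *m chain_prod g' k'.
Proof.
elim: k' => [|k' IH];
  last by rewrite addnS /= IH ltnNge leq_addr/= addKn mulmxA.
by rewrite addn0 mulmx1; apply: eq_chain_prod => i ->.
Qed.

Lemma chain_reach0 A : chain_reach A A 0.
Proof.
move=> e e0; exists 1 => // d d0 _; exists (fun=> 1%:M), 0%N.
by split => //; rewrite ?mulmx1// mul0r add0r ltW.
Qed.

Lemma chain_reach_trans A B C l l' :
  chain_reach A B l -> chain_reach B C l' -> chain_reach A C (l + l').
Proof.
move=> AB BC e e0; have e20 : 0 < e / 2 by rewrite divr_gt0.
have [d1 d10 H1] := AB _ e20; have [d2 d20 H2] := BC _ e20.
exists (Num.min d1 d2); first by rewrite lt_min d10.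
move=> d d0; rewrite lt_min => /andP[dd1 dd2].
have [g [k [gB kd gd]]] := H1 _ d0 dd1.
have [g' [k' [gC kd' gd']]] := H2 _ d0 dd2.
exists (fun i => if (i < k)%N then g i else g' (i - k)%N), (k + k')%N; split.
- by rewrite chain_prod_cat mulmxA gB gC.
- by rewrite natrD mulrDl; lra.
- move=> i; have [ik _|ki ikk] := ltnP i k; first exact: gd.
  by apply: gd'; rewrite -(ltn_add2l k) subnKC.
Qed.

(** With step size d = (l + e) / N, the bound k d <= l + e forces k <= N; identity factors fill the
    chain up to length N at no cost, and N * N * d^2 = (l + e)^2. The threshold on N ensures d <
    d0. *)
Lemma chain_reach_cost A B l : 0 <= l -> chain_reach A B l ->
  forall e, 0 < e -> exists N0, forall N, (N0 <= N)%N -> (0 < N)%N ->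
    exists2 g, A *m chain_prod g N = B & N%:R * cost g N <= (l + e) ^+ 2.
Proof.
move=> l0 AB e e0; have [d0 d00 H] := AB _ e0.
have le0 : 0 < l + e by lra.
exists (Num.truncn ((l + e) / d0)).+1 => N N0N N0.
have N0' : 0 < N%:R :> R by rewrite ltr0n.
pose d := (l + e) / N%:R.
have dp : 0 < d by rewrite divr_gt0.
have dd0 : d < d0.
  rewrite ltr_pdivrMr// mulrC -ltr_pdivrMr//.
  by rewrite (lt_le_trans (truncnS_gt _))// ler_nat.
have [g [k [gB kd gd]]] := H _ dp dd0.
have kN : (k <= N)%N.
  rewrite -(ler_nat R) -(ler_pM2r dp) (le_trans kd)//.
  by rewrite mulrC divfK// gt_eqF.
pose g' i := if (i < k)%N then g i else 1%:M.
exists g'.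
  rewrite -gB; congr (_ *m _).
  have := chain_prod_cat g (fun=> 1%:M) k (N - k).
  rewrite subnKC// => E; apply: etrans E _.
  rewrite (_ : chain_prod (fun=> 1%:M) _ = 1%:M) ?mulmx1//.
  by elim: (N - k)%N => //= m ->; rewrite mulmx1.
have gd2 i : iso (g' i - 1%:M) (g' i - 1%:M) <= d ^+ 2.
  rewrite /g'; case: ltnP => [ik|_].
    rewrite -iso_norm_sqr// ler_pXn2r// ?nnegrE ?sqrtr_ge0 ?(ltW dp)//.
    exact: gd.
  by rewrite subrr iso_inner0l// sqr_ge0.
apply: (@le_trans _ _ (N%:R * \sum_(0 <= i < N) d ^+ 2)).
  by rewrite ler_wpM2l ?(ltW N0')//; apply: ler_sum.
rewrite sumr_const_nat subn0 -mulr_natl /d le_eqVlt; apply/orP; left; apply/eqP.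
by field; rewrite gt_eqF.
Qed.

End Reachability.

Section WithinLimits.
Context {R : realType}.

Lemma within_continuous_bounded (V : normedModType R) (c d : R) (f : R -> V) :
  c <= d -> {within `[c, d], continuous f} ->
  exists2 C, 0 <= C & forall t, t \in `[c, d] -> `|f t| <= C.
Proof.
move=> cd cf.
have cn : {within `[c, d], continuous (fun t => `|f t|)}.
  by move=> t; apply: cvg_norm; exact: cf.
have [t _ tmax] := EVT_max cd cn.
by exists `|f t|.
Qed.

Lemma C1_on_is_derive (n : nat) (c d : R) (Y dY : R -> 'M[R]_n) (t : R) :
  C1_on c d Y dY -> t \in `]c, d[ -> is_derive t 1 Y (dY t).
Proof.
move=> [_ CY]; rewrite in_itv/= => /andP[ct td].
have H : h^-1 *: (Y (h *: 1 + t) - Y t) @[h --> 0^'] --> dY t.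
  have ctd : c <= t <= d by rewrite !ltW.
  have /cvgrPdist_lt CYt := CY t ctd.
  apply/cvgrPdist_lt => e e0; have [r /= r0 rP] := CYt _ e0.
  near=> h.
  have := rP (h *: 1 + t);
    rewrite /ball_/= opprD addrA addrAC subrr add0r normrN.
  rewrite [h *: 1]mulr1 addrK; apply.
  - by near: h; apply: dnbhs0_lt.
  - rewrite -subr_eq0 addrK; near: h; exact: nbhs_dnbhs_neq.
  - have hb : `|h| < Num.min (t - c) (d - t).
      by near: h; apply: dnbhs0_lt; rewrite lt_min !subr_gt0 ct.
    move: hb; rewrite lt_min !ltr_norml in_itv/=
      => /andP[/andP[? ?] /andP[? ?]].
    by apply/andP; split; lra.
by split; [apply/cvg_ex; exists (dY t)|apply: cvg_lim].
Unshelve. all: by end_near. Qed.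

End WithinLimits.

(** * Arclength and subdivision of a single C^1 piece *)

Section CurvePieces.
Context {R : realType} {n : nat} (mu muc kappa : R).
Hypothesis n_gt0 : (0 < n)%N.
Hypotheses (mu_gt0 : 0 < mu) (muc_gt0 : 0 < muc) (kappa_gt0 : 0 < kappa).
Local Notation iso := (iso_inner mu muc kappa).
Local Notation inorm := (iso_norm mu muc kappa).
Local Notation leb := (@lebesgue_measure R).

Lemma iso_norm_le : exists2 C, 0 <= C & forall M : 'M[R]_n,
  inorm M <= C * snorm M.
Proof.
have [K K0 isoK] := @iso_inner_le R n mu muc kappa n_gt0.
exists (K + 1) => [|M]; first by rewrite addr_ge0.
rewrite -(@ler_pXn2r _ 2)// ?nnegrE ?sqrtr_ge0 ?mulr_ge0 ?addr_ge0 ?snorm_ge0//.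
rewrite iso_norm_sqr//.
have := le_trans (ler_norm _) (isoK M M); rewrite -expr2 => /le_trans; apply.
rewrite exprMn ler_wpM2r ?sqr_ge0//.
by have := sqr_ge0 K; rewrite sqrrD1; lra.
Qed.

Variables (c d : R) (Y dY : R -> 'M[R]_n).
Hypotheses (cd : c < d) (CY : C1_on c d Y dY)
  (cY : {within `[c, d], continuous Y})
  (Y_GL : forall t, t \in `[c, d] -> \det (Y t) != 0).

Let w t := inorm (invmx (Y t) *m dY t).

Let cinv : {within `[c, d], continuous (fun t => invmx (Y t))}.
Proof.
apply/subspace_continuousP => t tcd; apply: cvg_invmx; first exact: Y_GL.
by move/subspace_continuousP : cY; exact.
Qed.

Let cdY : {within `[c, d], continuous dY}. Proof. by case: CY. Qed.

Let cw : {within `[c, d], continuous w}.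
Proof.
apply/subspace_continuousP => t tcd; rewrite /w /iso_norm.
have cM : invmx (Y s) *m dY s @[s --> within `[c, d] (nbhs t)] -->
    invmx (Y t) *m dY t.
  apply: cvg_mulmx; first by move/subspace_continuousP : cinv; exact.
  by move/subspace_continuousP : cdY; exact.
have ciso := @cvg_iso_inner R n mu muc kappa n_gt0 _ _ _ _ _ _ _ cM cM.
exact: (@continuous_cvg _ _ _ _ _ _ Num.sqrt _ (@sqrt_continuous R _) (ciso _)).
Qed.

Let wi : leb.-integrable `[c, d] (EFin \o w).
Proof. exact: continuous_compact_integrable (@segment_compact _ c d) cw. Qed.

Let F t := parameterized_integral leb c t w.

Let cF : {within `[c, d], continuous F}.
Proof. exact: parameterized_integral_continuous (ltW cd) wi. Qed.

Let F_derive t : t \in `]c, d[ -> is_derive t 1 F (w t).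
Proof.
move=> tcd; have /andP[ct td] : c < t < d by move: tcd; rewrite in_itv.
have wt : {for t, continuous w}.
  by have /(continuous_within_itvP _ cd)[+ _ _] := cw; apply; rewrite inE.
have [dF F'] := continuous_FTC1_closed td wi ct wt.
have DF : 'D_1 F t = w t by rewrite -derive1E; exact: F'.
exact: DeriveDef dF DF.
Qed.

Let F_c : F c = 0.
Proof. by rewrite /F /parameterized_integral set_itv1 Rintegral_set1. Qed.

Let F_d : (F d)%:E = (\int[leb]_(t in `[c, d]) (w t)%:E)%E.
Proof.
rewrite /F /parameterized_integral /Rintegral fineK//.
exact: integrable_fin_num.
Qed.

Let Y_derive t : t \in `]c, d[ -> is_derive t 1 Y (dY t).
Proof. exact: C1_on_is_derive. Qed.

Let ooW s t u : s \in `[c, d] -> t \in `[c, d] -> u \in `]s, t[ ->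
  u \in `]c, d[.
Proof. by rewrite !in_itv/= => /andP[? ?] /andP[? ?] /andP[? ?]; lra. Qed.

Let ccW s t : s \in `[c, d] -> t \in `[c, d] -> `[s, t] `<=` `[c, d].
Proof.
move=> + + u /=; rewrite !in_itv/= => /andP[? ?] /andP[? ?] /andP[? ?].
by apply/andP; split; lra.
Qed.

(** The resolvent identity Y_s^-1 = Y_t^-1 + Y_s^-1 (Y_t - Y_s) Y_t^-1 is combined with the
    Lipschitz bound on Y and the boundedness of the inverse and of the derivative. *)
Let nearby_velocity e : 0 < e -> exists2 r, 0 < r & forall s t,
  s \in `[c, d] -> t \in `[c, d] -> `|s - t| <= r ->
  inorm (invmx (Y s) *m dY t) <= w t + e.
Proof.
move=> e0; have [K K0 inormK] := iso_norm_le.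
have [C C0 YC] := within_continuous_bounded (ltW cd) cinv.
have [D D0 dYD] := within_continuous_bounded (ltW cd) cdY.
have lip s t : s \in `[c, d] -> t \in `[c, d] -> s <= t ->
    `|Y t - Y s| <= D * (t - s).
  move=> scd tcd st; apply: (@mx_mean_value_oo R n n Y dY s t D st D0).
  - by move=> u /(ooW scd tcd)/Y_derive.
  - exact: continuous_subspaceW (ccW scd tcd) cY.
  - move=> u /(ooW scd tcd) ucd; apply: dYD.
    by move: ucd; rewrite !in_itv/= => /andP[/ltW-> /ltW->].
have [A A0 AE] : exists2 A, 0 <= A & A = n%:R * C.
  by exists (n%:R * C); rewrite ?mulr_ge0.
have [B B0 BE] : exists2 B, 0 <= B & B = n%:R * D.
  by exists (n%:R * D); rewrite ?mulr_ge0.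
have lipn s t : s \in `[c, d] -> t \in `[c, d] ->
    snorm (Y t - Y s) <= B * `|s - t|.
  move=> scd tcd; rewrite snormE BE -mulrA ler_wpM2l//.
  have [st|/ltW ts] := leP s t.
    by rewrite (distrC s) (@ger0_norm _ (t - s)) ?subr_ge0//; exact: lip.
  by rewrite distrC (@ger0_norm _ (s - t)) ?subr_ge0//; exact: lip.
have ABAB : 0 <= K * (A * B * A * B) by rewrite !mulr_ge0.
have [q q0 qE] : exists2 q, 0 < q & q = K * (A * B * A * B) + 1.
  by exists (K * (A * B * A * B) + 1) => //; lra.
exists (e / q) => [|s t scd tcd str]; first by rewrite divr_gt0.
have sU : Y s \in unitmx by rewrite unitmxE unitfE Y_GL.
have tU : Y t \in unitmx by rewrite unitmxE unitfE Y_GL.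
have -> : invmx (Y s) *m dY t = invmx (Y t) *m dY t +
    invmx (Y s) *m (Y t - Y s) *m invmx (Y t) *m dY t.
  rewrite mulmxBr mulVmx// mulmxBl -mulmxA mulmxV// mulmx1 mul1mx mulmxBl.
  by rewrite addrC subrK.
rewrite (le_trans (iso_normD _ _ _ _ _ _))// lerD2l.
rewrite (le_trans (inormK _))//.
have Cs u : u \in `[c, d] -> snorm (invmx (Y u)) <= A.
  by move=> ucd; rewrite snormE AE ler_wpM2l// YC.
have Ds : snorm (dY t) <= B by rewrite snormE BE ler_wpM2l// dYD.
have H : snorm (invmx (Y s) *m (Y t - Y s) *m invmx (Y t) *m dY t) <=
    A * (B * (e / q)) * A * B.
  apply: le_trans (snormM _ _) _; apply: ler_pM; rewrite ?snorm_ge0//.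
  apply: le_trans (snormM _ _) _; apply: ler_pM; rewrite ?snorm_ge0 ?Cs//.
  apply: le_trans (snormM _ _) _; apply: ler_pM; rewrite ?snorm_ge0 ?Cs//.
  by rewrite (le_trans (lipn _ _ scd tcd))// ler_wpM2l.
apply: le_trans (ler_wpM2l K0 H) _.
rewrite [leLHS](_ : _ = K * (A * B * A * B) / q * e);
  last by field; rewrite gt_eqF.
by rewrite ler_piMl ?(ltW e0)// ler_pdivrMr// mul1r qE lerDl.
Qed.

(** Instead of integrating a matrix function, the displacement Z is paired with itself:
    Cauchy-Schwarz bounds the derivative of the pairing, monotonicity of the scalar [psi] integrates
    it, and one factor |Z| is divided out. *)
Let chord e s t : 0 <= e -> s \in `[c, d] -> t \in `[c, d] -> s <= t ->
  (forall u, u \in `]s, t[ -> inorm (invmx (Y s) *m dY u) <= w u + e) ->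
  inorm (invmx (Y s) *m Y t - 1%:M) <= F t - F s + e * (t - s).
Proof.
move=> e0 scd tcd st H; pose Z := invmx (Y s) *m Y t - 1%:M.
have mono (k : R) (M : 'M[R]_n) (H' : forall u, u \in `]s, t[ ->
      iso (invmx (Y s) *m dY u) M <= k * (w u + e)) :
    iso (invmx (Y s) *m Y t) M - iso (invmx (Y s) *m Y s) M <=
    k * (F t - F s + e * (t - s)).
  pose psi (u : R) : R := k *: (fun u => F u + e * u) u -
    iso (invmx (Y s) *m Y u) M.
  have psiD (u : R) : u \in `]s, t[ -> is_derive u 1 psi
      (k *: (w u + e) - iso (invmx (Y s) *m dY u) M).
    move=> /(ooW scd tcd) ucd.
    have D1 : is_derive u 1 (fun u => F u + e * u) (w u + e).
      have := is_deriveD (F_derive ucd) (is_deriveZ e (is_derive_id u (1 : R))).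
      by rewrite /GRing.scale/= mulr1.
    have D2 := is_derive_iso_inner mu muc kappa n_gt0
      (is_derive_mulmxl (invmx (Y s)) (Y_derive ucd))
        (is_derive_cst M u (1 : R)).
    apply: (is_derive_eq (is_deriveB (is_deriveZ k D1) D2)).
    by rewrite (iso_innerC _ _ _ n_gt0 _ 0) iso_inner0l// addr0.
  have psi_c : {within `[s, t], continuous psi}.
    have sub := ccW scd tcd.
    apply/subspace_continuousP => u ust; rewrite /psi; apply: cvgB.
      apply: cvgZl_tmp; apply: cvgD.
        have := continuous_subspaceW sub cF.
        by move/subspace_continuousP; exact.
      by apply: cvgMl_tmp; apply: cvg_within.
    apply: cvg_iso_inner => //; last exact: cvg_cst.
    apply: cvg_mulmx; first exact: cvg_cst.
    by have := continuous_subspaceW sub cY; move/subspace_continuousP; exact.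
  have psi_d (u : R) : u \in `]s, t[ -> derivable psi u (1 : R) by move/psiD.
  have psi_ge0 (u : R) : u \in `]s, t[ -> 0 <= derive1 psi u.
    move=> ust; have := psiD _ ust => Du; rewrite derive1E derive_val.
    by rewrite subr_ge0 /GRing.scale/= H'.
  have := ger0_derive1_le_cc psi_d psi_ge0 psi_c.
  move=> /(_ s t); rewrite !in_itv/= !lexx st => /(_ isT isT isT).
  by rewrite /psi /GRing.scale/=; lra.
have iso0 (M : 'M[R]_n) : iso M 0 = 0 by rewrite iso_innerC// iso_inner0l.
(* When Z = 0 nothing can be divided out; [mono] with the test matrix 0 still shows that the
   right-hand side is nonnegative. *)
have [Z0|Z0] := eqVneq (inorm Z) 0.
  rewrite -/Z Z0; have := mono 1 0; rewrite !iso0 subrr mul1r; apply => u _.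
  by rewrite iso0 mul1r addr_ge0// sqrtr_ge0.
have Zp : 0 < inorm Z by rewrite lt_def Z0 sqrtr_ge0.
have sU : Y s \in unitmx by rewrite unitmxE unitfE Y_GL.
rewrite -/Z -(ler_pM2l Zp) -expr2 iso_norm_sqr//.
have := mono (inorm Z) Z; rewrite mulVmx// -iso_innerBl//; apply => u ust.
apply: le_trans (iso_inner_CS _ _ _ _ _ _) _ => //.
by rewrite mulrC ler_wpM2l ?sqrtr_ge0// H.
Qed.

(** The cut points are equidistant for G = F + e t rather than for the arclength F. Where the speed
    vanishes F is constant, whereas G grows at rate at least e, so that a small increment of G also
    bounds the elapsed time. *)
Lemma piece_chain_reach : chain_reach mu muc kappa (Y c) (Y d) (F d).
Proof.
move=> e0 e0_gt0; pose e := e0 / 2 / (d - c).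
have dc : 0 < d - c by rewrite subr_gt0.
have e_gt0 : 0 < e by rewrite !divr_gt0.
have edc : e * (d - c) = e0 / 2 by rewrite /e divfK// gt_eqF.
have [r r0 near] := nearby_velocity e_gt0.
(* A step below e r keeps consecutive cut points within distance r. A step below e0 / 2 pays for
   rounding the number of steps up; the other half of e0 pays for the term e t of G. *)
exists (Num.min (e * r) (e0 / 2)); first by rewrite lt_min mulr_gt0 ?divr_gt0.
move=> de de0; rewrite lt_min => /andP[de_er de_e0].
have [G G_F] : exists G : R -> R, forall t, G t = F t + e * t.
  by exists (fun t => F t + e * t).
have ccd : c \in `[c, d] by rewrite in_itv/= lexx ltW.
have dcd : d \in `[c, d] by rewrite in_itv/= lexx ltW.
have F_mono s t : s \in `[c, d] -> t \in `[c, d] -> s <= t -> F s <= F t.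
  apply: (@ger0_derive1_le_cc R F c d) => // [u /F_derive//|u /F_derive Du].
  by rewrite derive1E derive_val sqrtr_ge0.
have G_incr s t : s \in `[c, d] -> t \in `[c, d] -> s <= t ->
    e * (t - s) <= G t - G s.
  by move=> scd tcd st; have := F_mono _ _ scd tcd st; rewrite !G_F; lra.
have G_le s t : s \in `[c, d] -> t \in `[c, d] -> G s <= G t -> s <= t.
  move=> scd tcd Gst; rewrite leNgt; apply/negP => ts.
  have := G_incr _ _ tcd scd (ltW ts).
  have := mulr_gt0 e_gt0 (_ : 0 < s - t); rewrite subr_gt0 => /(_ ts).
  lra.
have cG : {within `[c, d], continuous G}.
  have -> : G = (fun t => F t + e * t) by apply/funext.
  apply/subspace_continuousP => u ucd; apply: cvgD.
    by move/subspace_continuousP : cF; exact.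
  by apply: cvgM; [exact: cvg_cst|apply: cvg_within].
have Gcd : G c <= G d by have := G_incr _ _ ccd dcd (ltW cd); nra.
pose k := (Num.truncn ((G d - G c) / de)).+1.
have kde : k%:R * de <= G d - G c + de.
  rewrite /k -natr1 mulrDl mul1r lerD2r -ler_pdivlMr// truncn_le.
  by rewrite divr_ge0 ?(ltW de0)// subr_ge0.
have kde' : G d <= G c + k%:R * de.
  by rewrite -lerBlDl -ler_pdivrMr// ltW// truncnS_gt.
have /choice[t tP] : forall j : nat, exists t,
    t \in `[c, d] /\ G t = Num.min (G c + j%:R * de) (G d).
  move=> j; have jde : 0 <= j%:R * de by rewrite mulr_ge0// ltW.
  have [|t tcd tE] := @IVT R G c d (Num.min (G c + j%:R * de) (G d))
    (ltW cd) cG.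
    rewrite (min_idPl Gcd) (max_idPr Gcd) ge_min lexx orbT andbT.
    by rewrite le_min Gcd lerDl jde.
  by exists t.
have t_cd j : t j \in `[c, d] by have [] := tP j.
have t_G j : G (t j) = Num.min (G c + j%:R * de) (G d) by have [] := tP j.
have G_inj s u : s \in `[c, d] -> u \in `[c, d] -> G s = G u -> s = u.
  move=> scd ucd Gsu; apply/eqP; rewrite eq_le.
  by apply/andP; split; apply: G_le => //; rewrite Gsu.
have t0 : t 0%N = c.
  apply: G_inj; [exact: t_cd|exact: ccd|].
  by rewrite t_G mul0r addr0 (min_idPl Gcd).
have tk : t k = d.
  by apply: G_inj; [exact: t_cd|exact: dcd|rewrite t_G; apply/min_idPr].
have G_step j : 0 <= G (t j.+1) - G (t j) <= de.
  rewrite !t_G -natr1 mulrDl mul1r.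
  by case: (leP (G c + (j%:R * de + de)) (G d)) => ?;
    case: (leP (G c + j%:R * de) (G d)) => ?; apply/andP; split; lra.
have t_step j : t j <= t j.+1.
  by apply: G_le => //; rewrite -subr_ge0; have /andP[] := G_step j.
have Y_unit j : Y (t j) \in unitmx by rewrite unitmxE unitfE Y_GL.
exists (fun j => invmx (Y (t j)) *m Y (t j.+1)), k; split.
- rewrite -t0 -tk; elim: k {kde kde' tk} => [|k IH]; first by rewrite mulmx1.
  by rewrite /= mulmxA IH mulmxA mulmxV// mul1mx.
- rewrite (le_trans kde)// !G_F; have := edc; rewrite F_c; lra.
- move=> j _; have /andP[_ Gj] := G_step j; apply: le_trans Gj.
  have st_r : t j.+1 - t j <= r.
    rewrite -(ler_pM2l e_gt0) (le_trans (G_incr _ _ _ _ _))//.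
    have /andP[_ Gj] := G_step j; apply: le_trans Gj _; exact: ltW.
  apply: le_trans (chord (ltW e_gt0) (t_cd j) (t_cd j.+1) (t_step j) _) _.
    move=> u utt; apply: near => //.
      by have := ooW (t_cd j) (t_cd j.+1) utt;
        rewrite !in_itv/= => /andP[/ltW-> /ltW->].
    move: utt; rewrite in_itv/= => /andP[tu ut].
    by rewrite ler0_norm; lra.
  by rewrite !G_F; lra.
Qed.

Let speed (t : R) : R :=
  Num.sqrt (riem_metric mu muc kappa (Y t) (derive1 Y t) (derive1 Y t)).

Let speedE t : t \in `]c, d[ -> speed t = w t.
Proof.
by move=> /Y_derive YD; rewrite /speed derive1E derive_val.
Qed.

(** At the two ends [derive1] need not agree with the one-sided derivative, so measurability is
    proved on the open interval and the end points are added afterwards. *)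
Lemma piece_length_measurable : measurable_fun `[c, d] speed.
Proof.
apply/measurable_fun_itv_bndo_bndcP/measurable_fun_itv_obnd_cbndP.
have mw : measurable_fun `]c, d[ w.
  apply: (@measurable_funS _ _ _ _ `[c, d]) => //.
    exact: subset_itv_oo_cc.
  exact: subspace_continuous_measurable_fun.
apply: eq_measurable_fun mw => t; rewrite inE => tcd; exact/esym/speedE.
Qed.

Lemma piece_length : curve_length mu muc kappa c d Y = (F d)%:E.
Proof.
rewrite F_d /curve_length.
have mS := piece_length_measurable.
have sub : `]c, d[ `<=` `[c, d] by exact: subset_itv_oo_cc.
rewrite (integral_itv_bndoo true false); last first.
  by apply/measurable_EFinP; exact: measurable_funS mS.
rewrite [RHS](integral_itv_bndoo true false); last first.
  apply/measurable_EFinP; apply: (@measurable_funS _ _ _ _ `[c, d]) => //.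
  exact: subspace_continuous_measurable_fun.
by apply: eq_integral => t; rewrite inE => tcd; congr EFin; exact: speedE.
Qed.

Lemma piece_length_ge0 : 0 <= F d.
Proof. by rewrite /F /parameterized_integral Rintegral_ge0// => t _;
  exact: sqrtr_ge0. Qed.

Lemma piece_length_le (K : R) :
  (forall t, t \in `]c, d[ -> inorm (invmx (Y t) *m dY t) <= K) ->
  (curve_length mu muc kappa c d Y <= (K * (d - c))%:E)%E.
Proof.
move=> wK; rewrite piece_length lee_fin.
have [x xcd] := MVT cd F_derive cF; rewrite F_c subr0 => ->.
by apply: ler_wpM2r; [rewrite subr_ge0 ltW|exact: wK].
Qed.

End CurvePieces.

Section CurveLength.
Context {R : realType} {n : nat} (mu muc kappa : R).
Hypothesis n_gt0 : (0 < n)%N.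
Hypotheses (mu_gt0 : 0 < mu) (muc_gt0 : 0 < muc) (kappa_gt0 : 0 < kappa).
Local Notation leb := (@lebesgue_measure R).
Implicit Type Y : R -> 'M[R]_n.

Definition curve_speed Y (t : R) : R :=
  Num.sqrt (riem_metric mu muc kappa (Y t) (derive1 Y t) (derive1 Y t)).

Lemma curve_lengthD Y (a x b : R) : a <= x -> x <= b ->
  measurable_fun `[a, x] (curve_speed Y) ->
  measurable_fun `[x, b] (curve_speed Y) ->
  curve_length mu muc kappa a b Y =
  (curve_length mu muc kappa a x Y + curve_length mu muc kappa x b Y)%E /\
  measurable_fun `[a, b] (curve_speed Y).
Proof.
move=> ax xb m1 m2.
have E : `[a, b]%classic = `[a, x] `|` `]x, b] :> set R.
  by rewrite -itv_bndbnd_setU// bnd_simp.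
have m2' : measurable_fun `]x, b] (curve_speed Y).
  by apply: measurable_funS m2 => //; exact: subset_itv_oc_cc.
have m : measurable_fun `[a, b] (curve_speed Y).
  by rewrite E; apply/measurable_funU.
have dj : [disjoint `[a, x]%classic & `]x, b]%classic].
  apply/disj_set2P; rewrite -subset0 => t/=;
    rewrite !in_itv/= => -[/andP[_ tx]].
  by rewrite ltNge tx.
split=> //; rewrite /curve_length E ge0_integral_setU//.
- congr (_ + _)%E; apply: integral_itv_obnd_cbnd.
  by apply/measurable_EFinP; exact: m2'.
- by rewrite -E; apply/measurable_EFinP.
Qed.

Lemma piecewise_C1_chain_reach Y (a b : R) (s : seq R) : itv_partition a b s ->
  (forall t, a <= t <= b -> GL (Y t)) -> {within `[a, b], continuous Y} ->
  (forall i, (i < size s)%N -> exists dY,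
    C1_on (nth a (a :: s) i) (nth a (a :: s) i.+1) Y dY) ->
  exists l : R, [/\ 0 <= l, curve_length mu muc kappa a b Y = l%:E,
    measurable_fun `[a, b] (curve_speed Y) &
    chain_reach mu muc kappa (Y a) (Y b) l].
Proof.
elim: s a => [|x s IH] a abs YGL cY CY.
  have <- := itv_partition_nil abs; exists 0; split=> //.
  - by rewrite /curve_length set_itv1 integral_set1.
  - by rewrite set_itv1; exact: measurable_fun_set1.
  - exact: chain_reach0.
have xbs := itv_partition_cons abs; have xb := itv_partition_le xbs.
have ax : a < x by case: abs => /= /andP[].
have [l [l0 lE lm lr]] : exists l : R, [/\ 0 <= l,
    curve_length mu muc kappa x b Y = l%:E,
    measurable_fun `[x, b] (curve_speed Y) &
    chain_reach mu muc kappa (Y x) (Y b) l].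
  apply: IH => //.
  - by move=> t /andP[xt tb]; apply: YGL; rewrite tb (le_trans (ltW ax)).
  - apply: continuous_subspaceW cY; apply: subset_itvr.
    by rewrite bnd_simp ltW.
  - move=> i si; have [dY CdY] := CY i.+1 si; exists dY.
    (* Piece i + 1 of the partition is piece i of its tail; only the default value of [nth] changes,
       at indices that are in range. *)
    by move: CdY; rewrite /= (set_nth_default x) ?(set_nth_default x a)//= ltnW.
have [dY CdY] : exists dY, C1_on a x Y dY by exact: (CY 0%N).
have cYax : {within `[a, x], continuous Y}.
  by apply: continuous_subspaceW cY; apply: subset_itvl; rewrite bnd_simp.
have YGLax t : t \in `[a, x] -> \det (Y t) != 0.
  rewrite in_itv/= => /andP[at_ tx]; apply: YGL.
  by rewrite at_ (le_trans tx).
have [D m] := curve_lengthD (ltW ax) xb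
  (@piece_length_measurable R n mu muc kappa n_gt0 a x Y dY CdY cYax YGLax) lm.
rewrite D lE (@piece_length R n mu muc kappa n_gt0 a x Y dY CdY cYax YGLax).
eexists; split; last first.
- apply: chain_reach_trans lr.
  exact: (@piece_chain_reach R n mu muc kappa n_gt0 mu_gt0 muc_gt0 kappa_gt0
    a x Y dY ax CdY cYax YGLax).
- exact: m.
- by rewrite EFinD.
- by rewrite addr_ge0// piece_length_ge0.
Qed.

End CurveLength.

Section ClusterPoint.
Context {R : realType} {n : nat}.

Lemma bounded_mx_cluster (u : nat -> 'M[R]_n) (C : R) :
  (forall N, `|u N| <= C) ->
  exists M, forall e, 0 < e -> forall N0,
    exists2 N, (N0 <= N)%N & `|u N - M| < e.
Proof.
move=> uC; pose v N := mxvec (u N).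
have C0 : 0 <= C := le_trans (normr_ge0 _) (uC 0%N).
have vC N : `|v N| <= C.
  apply: mx_norm_leP => // i j; rewrite ord1; case/mxvec_indexP: j => a b.
  by rewrite mxvecE (le_trans (mxentry_le_norm _ _ _)).
pose A := [set w : 'rV[R]_(n * n) | `|w| <= C].
have cA : closed A.
  apply: (@preimage_closed _ _ (fun w : 'rV[R]_(n * n) => `|w|)
    [set x | x <= C]).
    by move=> w _; exact: norm_continuous.
  exact: closed_le.
have bA : bounded_set A.
  exists C; split; first exact: num_real.
  by move=> x Cx w /= /le_trans; apply; exact: ltW.
have [|w [_ wcl]] := @bounded_closed_compact R (n * n) A bA cA (v @ \oo) _.
  by exists 0%N => // N _; exact: vC.
exists (vec_mx w) => e e0 N0.
have [] := wcl [set v N | N in [set N | (N0 <= N)%N]] (ball w e).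
- by exists N0 => // N /= N0N; exists N.
- exact: nbhsx_ballx.
move=> _ [[N /= N0N <-]]; rewrite mx_norm_ball /ball_/= => wv; exists N => //.
rewrite -normrN opprB; apply: le_lt_trans wv.
apply: mx_norm_leP => // i j; rewrite !mxE.
have := mxentry_le_norm (w - v N) 0 (mxvec_index i j).
by rewrite !mxE mxvecE.
Qed.

End ClusterPoint.

(** * Geodesic curves and loops *)

Section C1Curves.
Context {R : realType} {n : nat}.
Implicit Types Y dY Z : R -> 'M[R]_n.

Lemma is_derive_C1_on Y dY (c d : R) :
  (forall t : R, is_derive t 1 Y (dY t)) -> continuous dY -> C1_on c d Y dY.
Proof.
move=> YD cdY; split; first exact: continuous_subspaceT.
move=> t _; apply: cvg_within_filter.
have YDt := YD t.
have /cvg_ex[l Hl] : derivable Y t 1 by [].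
have lE : l = dY t by rewrite -(@derive_val _ _ _ _ _ _ _ YDt);
  exact/esym/cvg_lim.
rewrite lE in Hl; move/cvgrPdist_lt : Hl => Hl.
apply/cvgrPdist_lt => e e0; have [r /= r0 rP] := Hl _ e0.
exists r => // s /= str st.
have := rP (s - t); rewrite /= sub0r normrN distrC subr_eq0 => /(_ str st).
by rewrite [(s - t) *: 1]mulr1 subrK.
Qed.

Lemma C1_on_ext Y Z dZ (c d : R) : {in `[c, d], Y =1 Z} ->
  C1_on c d Z dZ -> C1_on c d Y dZ.
Proof.
move=> YZ [cZ HZ]; split=> // t tcd.
apply: cvg_trans (HZ _ tcd); apply: near_eq_cvg.
apply: filterS (withinT _ _) => s scd.
by rewrite !YZ// in_itv.
Qed.

End C1Curves.

Section GeodesicCurves.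
Context {R : realType} {n : nat} (mu muc kappa : R).
Hypothesis n_gt0 : (0 < n)%N.
Hypotheses (mu_gt0 : 0 < mu) (muc_gt0 : 0 < muc) (kappa_gt0 : 0 < kappa).
Local Notation leb := (@lebesgue_measure R).
Variables (A S L M : 'M[R]_n).
Hypotheses (SLM : S + L = M) (LT : L^T = - L).

Definition geodesic (t : R) : 'M[R]_n :=
  A *m expmx (t *: S) *m expmx (t *: L).

Definition geodesic_velocity (t : R) : 'M[R]_n :=
  A *m expmx (t *: S) *m M *m expmx (t *: L).

Lemma is_derive_geodesic (t : R) : is_derive t 1 geodesic (geodesic_velocity t).
Proof.
apply: (is_derive_eq
  (is_derive_mulmx (is_derive_mulmxl A (is_derive_expmx_r S t))
  (is_derive_expmx L t))).
by rewrite /geodesic_velocity -SLM mulmxDr mulmxDl !mulmxA.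
Qed.

Lemma continuous_geodesic_velocity : continuous geodesic_velocity.
Proof.
move=> t; apply: is_derive_continuous.
exact: (is_derive_mulmx (is_derive_mulmxr M (is_derive_mulmxl A
  (is_derive_expmx S t))) (is_derive_expmx L t)).
Qed.

Lemma det_geodesic_gt0 t : 0 < \det A -> 0 < \det (geodesic t).
Proof. by move=> A0; rewrite !det_mulmx !mulr_gt0// det_expmx_gt0. Qed.

Lemma geodesic_velocity_neq0 t : A \in unitmx -> M != 0 ->
  geodesic_velocity t != 0.
Proof.
move=> AU; have unit_exp N : expmx N \in @unitmx R n.
  by rewrite unitmxE unitfE gt_eqF// det_expmx_gt0.
have UU : A *m expmx (t *: S) \in unitmx by rewrite unitmx_mul AU unit_exp.
apply: contraNneq => V0; rewrite /geodesic_velocity in V0.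
rewrite -[M](mulKmx UU) -[_ *m M](mulmxK (unit_exp (t *: L))).
by rewrite V0 mul0mx mulmx0.
Qed.

Lemma geodesic_C1_on c d : C1_on c d geodesic geodesic_velocity.
Proof.
apply: is_derive_C1_on; first exact: is_derive_geodesic.
exact: continuous_geodesic_velocity.
Qed.

Lemma geodesic_piecewise_C1 (P : set 'M[R]_n) : 0 < \det A ->
  (forall t, P (geodesic_velocity t)) -> piecewise_C1 P 0 1 geodesic.
Proof.
move=> A0 PV; split.
- by move=> t _; rewrite /GL/= gt_eqF// det_geodesic_gt0.
- apply: continuous_subspaceT => t.
  exact: is_derive_continuous (is_derive_geodesic t).
- exists [:: 1]; split; first exact: itv_partition1.
  move=> [|//] _ /=; exists geodesic_velocity; split => //.
  exact: geodesic_C1_on.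
Qed.

(** The left logarithmic derivative is exp(-tL) M exp(tL), a conjugate of M by a rotation, so the
    speed is constant. *)
Lemma geodesic_speed t : A \in unitmx ->
  riem_metric mu muc kappa (geodesic t) (derive1 geodesic t)
    (derive1 geodesic t) =
  iso_inner mu muc kappa M M.
Proof.
move=> AU; have Dt := is_derive_geodesic t.
rewrite derive1E derive_val /riem_metric.
suff -> : invmx (geodesic t) *m geodesic_velocity t =
    expmx (- (t *: L)) *m M *m expmx (- - (t *: L)).
  by rewrite iso_inner_conj// linearN linearZ/= LT scalerN.
have E : geodesic t *m (expmx (- (t *: L)) *m M *m expmx (t *: L)) =
    geodesic_velocity t.
  by rewrite /geodesic !mulmxA -(mulmxA (A *m _)) expmxNr mulmx1.
have gU : geodesic t \in unitmx.
  have unit_exp N : expmx N \in @unitmx R n.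
    by rewrite unitmxE unitfE gt_eqF// det_expmx_gt0.
  by rewrite !unitmx_mul AU !unit_exp.
by rewrite -E mulKmx// opprK.
Qed.

Lemma geodesic_length : A \in unitmx ->
  curve_length mu muc kappa 0 1 geodesic = (iso_norm mu muc kappa M)%:E.
Proof.
move=> AU; rewrite /curve_length.
under eq_integral do rewrite geodesic_speed//.
rewrite integral_cst//= lebesgue_measure_itv/= lte_fin ltr01.
by rewrite -EFinD subr0 mule1.
Qed.

End GeodesicCurves.

Section ShortLoops.
Context {R : realType} {n : nat} (mu muc kappa : R).
Hypothesis n_gt0 : (0 < n)%N.
Hypotheses (mu_gt0 : 0 < mu) (muc_gt0 : 0 < muc) (kappa_gt0 : 0 < kappa).
Local Notation inorm := (iso_norm mu muc kappa).

Lemma iso_normZ (k : R) (M : 'M[R]_n) : inorm (k *: M) = `|k| * inorm M.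
Proof.
rewrite /iso_norm iso_innerZl// iso_innerZr// mulrA -expr2.
by rewrite sqrtrM ?sqr_ge0// sqrtr_sqr.
Qed.

Lemma is_derive_affine (p q : R) (A : 'M[R]_n) (t : R) :
  is_derive t 1 (fun s => (p + q * s) *: A) (q *: A).
Proof.
apply/is_derive_mxP => i j.
have -> : (fun s => ((p + q * s) *: A) i j) =
    cst (p * A i j) + (q * A i j) *: id.
  apply/funext => s; rewrite mxE.
  by change ((p + q * s) * A i j = p * A i j + (q * A i j) * s); ring.
apply: (is_derive_eq (is_deriveD (is_derive_cst (p * A i j) t 1)
  (is_deriveZ (q * A i j) (is_derive_id t 1)))).
by rewrite add0r mxE /GRing.scale/= mulr1.
Qed.

Lemma affine_C1_on (p q c d : R) (A : 'M[R]_n) :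
  C1_on c d (fun s => (p + q * s) *: A) (fun=> q *: A).
Proof.
apply: is_derive_C1_on; first exact: is_derive_affine.
by move=> t; exact: cst_continuous.
Qed.

(* The loop runs from A to (1 + e) A and back; the velocity may not vanish, so a
   constant curve is not admissible. *)
Definition loop (A : 'M[R]_n) (e t : R) : 'M[R]_n := (1 + e * (1 - `|t|)) *: A.

Lemma loopNE (A : 'M[R]_n) e :
  {in `[-1, 0], loop A e =1 (fun t => (1 + e + e * t) *: A)}.
Proof.
move=> t; rewrite in_itv/= => /andP[_ t0]; rewrite /loop ler0_norm//.
by congr (_ *: _); ring.
Qed.

Lemma loopPE (A : 'M[R]_n) e :
  {in `[0, 1], loop A e =1 (fun t => (1 + e + (- e) * t) *: A)}.
Proof.
move=> t; rewrite in_itv/= => /andP[t0 _]; rewrite /loop ger0_norm//.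
by congr (_ *: _); ring.
Qed.

Lemma loop_continuous (A : 'M[R]_n) e : continuous (loop A e).
Proof.
move=> t; apply: cvgZr_tmp; apply: cvgD; first exact: cst_continuous.
apply: cvgMl_tmp; apply: cvgB; first exact: cst_continuous.
exact: norm_continuous.
Qed.

Let loop_ge1 (e t : R) : 0 <= e -> -1 <= t <= 1 -> 1 <= 1 + e * (1 - `|t|).
Proof.
by move=> e0 t1; rewrite lerDl mulr_ge0// subr_ge0 ler_norml.
Qed.

Lemma det_loop (A : 'M[R]_n) e t : \det A != 0 -> 0 <= e -> -1 <= t <= 1 ->
  \det (loop A e t) != 0.
Proof.
move=> A0 e0 /(loop_ge1 e0) t1; rewrite /loop detZ mulf_neq0// expf_neq0//.
by rewrite gt_eqF// (lt_le_trans ltr01).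
Qed.

Lemma loop_admissible (A : 'M[R]_n) e : \det A != 0 -> 0 < e ->
  admissible A A (-1) 1 (loop A e).
Proof.
move=> A0 e0; split.
- by lra.
- by rewrite /loop normrN1 subrr mulr0 addr0 scale1r.
- by rewrite /loop normr1 subrr mulr0 addr0 scale1r.
split.
- by move=> t t1; apply: det_loop => //; exact: ltW.
- exact/continuous_subspaceT/loop_continuous.
have An0 : A != 0.
  by apply: contraNneq A0 => ->; rewrite -(prednK n_gt0) det0.
exists [:: 0; 1]; split.
  by split => /=; rewrite ?ltrN10 ?ltr01 ?eqxx.
move=> [|[|//]] _ /=.
- exists (fun=> e *: A); split.
    by apply: C1_on_ext (affine_C1_on _ _ _ _ _); exact: loopNE.
  by move=> t _ /=; rewrite scaler_eq0 negb_or gt_eqF.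
- exists (fun=> (- e) *: A); split.
    by apply: C1_on_ext (affine_C1_on _ _ _ _ _); exact: loopPE.
  by move=> t _ /=; rewrite scaler_eq0 negb_or oppr_eq0 gt_eqF.
Qed.

(** The logarithmic derivative is the scalar matrix with entry e / (1 + e (1 - |t|)) up to sign, at
    most e in modulus, and each half of the loop lasts for time 1. *)
Lemma loop_length_le (A : 'M[R]_n) e : \det A != 0 -> 0 < e ->
  (curve_length mu muc kappa (-1) 1 (loop A e) <=
   (2 * e * inorm (1%:M : 'M[R]_n))%:E)%E.
Proof.
move=> A0 e0; have AU : A \in unitmx by rewrite unitmxE unitfE.
have wle (q t : R) : `|q| = e -> -1 <= t <= 1 ->
    inorm (invmx (loop A e t) *m (q *: A)) <= e * inorm (1%:M : 'M[R]_n).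
  move=> qe t1; have k1 := loop_ge1 (ltW e0) t1;
    move: (det_loop A0 (ltW e0) t1).
  rewrite /loop; set k := 1 + _ in k1 * => dk.
  rewrite invmxZ ?unitmxE ?unitfE//.
  rewrite -scalemxAr -scalemxAl mulVmx// !iso_normZ// qe.
  apply: ler_wpM2l; first exact: ltW.
  rewrite ler_piMl ?sqrtr_ge0//.
  by rewrite ger0_norm ?invr_ge0 ?(le_trans ler01)// invf_le1//
    (lt_le_trans ltr01).
have cL (c d : R) : {within `[c, d], continuous (loop A e)}.
  exact/continuous_subspaceT/loop_continuous.
have C1 : C1_on (-1) 0 (loop A e) (fun=> e *: A).
  by apply: C1_on_ext (affine_C1_on _ _ _ _ _); exact: loopNE.
have C2 : C1_on 0 1 (loop A e) (fun=> (- e) *: A).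
  by apply: C1_on_ext (affine_C1_on _ _ _ _ _); exact: loopPE.
have d1 t : t \in `[-1, 0] -> \det (loop A e t) != 0.
  rewrite in_itv/= => /andP[? ?]; apply: det_loop => //; first exact: ltW.
  by apply/andP; split; lra.
have d2 t : t \in `[0, 1] -> \det (loop A e t) != 0.
  rewrite in_itv/= => /andP[? ?]; apply: det_loop => //; first exact: ltW.
  by apply/andP; split; lra.
have m1 := @piece_length_measurable R n mu muc kappa n_gt0 _ _ _ _ C1 (cL _ _)
  d1.
have m2 := @piece_length_measurable R n mu muc kappa n_gt0 _ _ _ _ C2 (cL _ _)
  d2.
have [-> _] := @curve_lengthD R n mu muc kappa _ _ _ _ (lerN10 R) ler01 m1 m2.
rewrite (_ : (2 * e * _)%:E = (e * inorm (1%:M : 'M[R]_n) * (0 - -1))%:E +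
  (e * inorm (1%:M : 'M[R]_n) * (1 - 0))%:E)%E; last by rewrite -EFinD;
    congr EFin; ring.
apply: leeD.
- apply: (@piece_length_le R n mu muc kappa n_gt0 _ _ _ _ (ltrN10 R) C1
  (cL _ _) d1).
  move=> t; rewrite in_itv/= => /andP[? ?]; apply: wle;
    first by rewrite gtr0_norm.
  by apply/andP; split; lra.
- apply: (@piece_length_le R n mu muc kappa n_gt0 _ _ _ _ ltr01 C2 (cL _ _) d2).
  move=> t; rewrite in_itv/= => /andP[? ?]; apply: wle.
    by rewrite normrN gtr0_norm.
  by apply/andP; split; lra.
Qed.

Lemma dist_geod_refl_le0 (A : 'M[R]_n) : \det A != 0 ->
  (dist_geod mu muc kappa A A <= 0)%E.
Proof.
move=> A0; apply/lee_addgt0Pr => e e0; rewrite add0e.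
pose k := inorm (1%:M : 'M[R]_n).
have k0 : 0 <= k by exact: sqrtr_ge0.
have N0 : 0 < 2 * k + 1 by lra.
have eN0 : 0 < e / (2 * k + 1) by rewrite divr_gt0.
apply: le_trans (_ : _ <= curve_length mu muc kappa (-1) 1 (loop A _))%E _.
  apply: ereal_inf_lbound; exists (-1), 1, (loop A (e / (2 * k + 1))).
  by split; [exact: loop_admissible|reflexivity].
apply: le_trans (loop_length_le A0 eN0) _.
rewrite lee_fin -/k [leLHS](_ : _ = 2 * k * e / (2 * k + 1)); last by ring.
by rewrite ler_pdivrMr//; nra.
Qed.

End ShortLoops.

(** * Passage to the limit *)

Section MinimalVelocity.
Context {R : realType} {n : nat} (mu muc kappa : R).
Hypothesis n_gt0 : (0 < n)%N.
Hypotheses (mu_gt0 : 0 < mu) (muc_gt0 : 0 < muc) (kappa_gt0 : 0 < kappa).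
Local Notation iso := (iso_inner mu muc kappa).
Local Notation inorm := (iso_norm mu muc kappa).
Local Notation c := (1 + muc / mu).

Let endpoint (M : 'M[R]_n) :=
  expmx (M - c *: skew_part M) *m expmx (c *: skew_part M).

(** A constant valid on a whole ball lets the approximate endpoint equation of the bounded initial
    velocities pass to their cluster point. *)
Let endpoint_lipschitz (r : R) : exists2 K, 0 <= K & forall M N,
  snorm M <= r -> snorm N <= r ->
  snorm (endpoint M - endpoint N) <= K * snorm (M - N).
Proof.
have [c' c'0 c'E] : exists2 c', 0 <= c' & c' = `|c| by exists `|c|.
have Lle (M : 'M[R]_n) : snorm (c *: skew_part M) <= c' * snorm M.
  by rewrite snormZ -c'E ler_wpM2l// snorm_skew_part.
have Sle (M : 'M[R]_n) : snorm (M - c *: skew_part M) <= (1 + c') * snorm M.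
  by rewrite (le_trans (snormB _ _))// mulrDl mul1r lerD2l.
(* One bound for all four exponentials: their exponents have norm at most (1 + c') r. *)
pose b := @expmx_bound R n ((1 + c') * r).
have b0 : 0 <= b by exact: expmx_bound_ge0.
exists (b * b * (1 + c') * b + b * (b * b * c')) => [|M N Mr Nr].
  by rewrite !(addr_ge0, mulr_ge0).
have r0 : 0 <= r := le_trans (snorm_ge0 _) Mr.
have Sb (P : 'M[R]_n) : snorm P <= r ->
    @expmx_bound R n (snorm (P - c *: skew_part P)) <= b.
  move=> Pr; apply: (@le_expmx_bound R n _ ((1 + c') * r)).
  apply: le_trans (Sle P) _.
  by rewrite ler_wpM2l// addr_ge0.
have Lb (P : 'M[R]_n) : snorm P <= r ->
  @expmx_bound R n (snorm (c *: skew_part P)) <= b.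
  move=> Pr; apply: (@le_expmx_bound R n _ ((1 + c') * r)).
  apply: le_trans (Lle P) _.
  by apply: ler_pM; rewrite ?snorm_ge0// lerDr.
have split4 (a a' d d' : 'M[R]_n) :
    a *m d - a' *m d' = (a - a') *m d + a' *m (d - d').
  by rewrite mulmxBl mulmxBr addrA subrK.
rewrite /endpoint.
set L := c *: skew_part M; set L' := c *: skew_part N.
set S := M - L; set S' := N - L'.
rewrite split4.
have SS : snorm (S - S') <= (1 + c') * snorm (M - N).
  have -> : S - S' = (M - N) - c *: skew_part (M - N).
    by rewrite skew_partB scalerBr /S /S' !opprB addrACA [RHS]addrACA
      [- L + _]addrC.
  exact: Sle.
have LL : snorm (L - L') <= c' * snorm (M - N).
  have -> : L - L' = c *: skew_part (M - N) by rewrite skew_partB scalerBr.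
  exact: Lle.
have d0 := snorm_ge0 (M - N).
apply: le_trans (snormD _ _) _; rewrite mulrDl; apply: lerD.
  apply: le_trans (snormM _ _) _.
  rewrite -[b * b * (1 + c') * b * _]mulrAC.
  apply: ler_pM; rewrite ?snorm_ge0//; last first.
    exact: le_trans (snorm_expmx_le _) (Lb _ Mr).
  apply: le_trans (snorm_expmx_lipschitz _ _) _; rewrite -[leRHS]mulrA.
  apply: ler_pM; rewrite ?snorm_ge0 ?mulr_ge0 ?expmx_bound_ge0//.
  by apply: ler_pM; rewrite ?expmx_bound_ge0// Sb.
apply: le_trans (snormM _ _) _; rewrite -[leRHS]mulrA.
apply: ler_pM; rewrite ?snorm_ge0//.
  exact: le_trans (snorm_expmx_le _) (Sb _ Nr).
apply: le_trans (snorm_expmx_lipschitz _ _) _; rewrite -[leRHS]mulrA.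
apply: ler_pM; rewrite ?snorm_ge0 ?mulr_ge0 ?expmx_bound_ge0//.
by apply: ler_pM; rewrite ?expmx_bound_ge0// Lb.
Qed.

(** The restriction to e <= 1 makes it possible to bound e^2 by e in the application to (l +
    e)^2. *)
Let le0_linear (x K : R) : 0 <= K ->
  (forall e, 0 < e -> e <= 1 -> x <= K * e) -> x <= 0.
Proof.
move=> K0 xK; rewrite leNgt; apply/negP => x0.
have K10 : 0 < 2 * (K + 1) by lra.
have y0 : 0 < x / (2 * (K + 1)) by rewrite divr_gt0.
have e0 : 0 < Num.min 1 (x / (2 * (K + 1))) by rewrite lt_min ltr01.
have e1 : Num.min 1 (x / (2 * (K + 1))) <= 1 by rewrite ge_min lexx.
have := xK _ e0 e1; apply/negP; rewrite -ltNge.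
apply: (@le_lt_trans _ _ (K * (x / (2 * (K + 1))))).
  by rewrite ler_wpM2l// ge_min lexx orbT.
rewrite mulrA ltr_pdivrMr//; nra.
Qed.

Theorem minimal_velocity_exists (A B : 'M[R]_n) : A \in unitmx ->
  0 < \det (invmx A *m B) ->
  exists2 M : 'M[R]_n, A *m endpoint M = B &
    forall l, 0 <= l -> chain_reach mu muc kappa A B l -> inorm M <= l.
Proof.
move=> AU; set B' := invmx A *m B => detB'.
have [C0 C00 conn] := lipschitz_connected_chain mu muc kappa n_gt0
  (det_gt0_lipschitz_connected detB').
(* Chain number N has N + 1 steps, so none is empty. Minimality gives stationarity, and comparison
   with the chain along the Lipschitz path gives the bound [C0], common to all N. *)
have /choice[g gP] : forall N, exists g : nat -> 'M[R]_n,
    [/\ chain_prod g N.+1 = B',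
        forall g', chain_prod g' N.+1 = B' ->
          chain_cost mu muc kappa g N.+1 <= chain_cost mu muc kappa g' N.+1 &
        good_chain mu muc kappa C0 N.+1 g].
  move=> N; have [g0 g0B g0C] := conn N.+1 isT.
  have [g gB gmin] := minimal_chain_exists n_gt0 mu_gt0 muc_gt0 kappa_gt0 g0B.
  exists g; split => //; split => //.
    by apply: le_trans g0C; rewrite ler_wpM2l// gmin.
  by apply: minimal_chain_stationary => // g'; rewrite gB; exact: gmin.
have gB N : chain_prod (g N) N.+1 = B' by have [] := gP N.
have gmin N g' : chain_prod g' N.+1 = B' ->
    chain_cost mu muc kappa (g N) N.+1 <= chain_cost mu muc kappa g' N.+1.
  by have [_ + _] := gP N; apply.
have ggood N : good_chain mu muc kappa C0 N.+1 (g N) by have [] := gP N.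
pose u N := velocity N.+1 (g N) 0.
have [Cu Cu0 uC] := chain_velocity0_bounded C0 n_gt0 mu_gt0 muc_gt0 kappa_gt0.
have [C1 C10 uE] := chain_endpoint C0 n_gt0 mu_gt0 muc_gt0 kappa_gt0.
have [C2 C20 uN] := chain_energy C0 n_gt0 mu_gt0 muc_gt0 kappa_gt0.
have ub N : snorm (u N) <= Cu by exact: uC (ggood N).
have [|M Mcl] := @bounded_mx_cluster R n u Cu.
  by move=> N; exact: le_trans (norm_le_snorm _ n_gt0) (ub N).
(* The cluster property yields indices beyond any bound; beyond 1 / e the mesh is small as well. *)
have approx e N0 : 0 < e -> exists N,
    [/\ (N0 <= N)%N, snorm (u N - M) <= n%:R * e & N.+1%:R^-1 <= e].
  move=> e0; have [N N1N uM] := Mcl e e0 (maxn N0 (Num.truncn e^-1)).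
  exists N; split.
  - by rewrite (leq_trans _ N1N)// leq_maxl.
  - by rewrite snormE ler_wpM2l// ltW.
  - rewrite -[leRHS]invrK lef_pV2 ?posrE ?invr_gt0 ?ltr0n//.
    rewrite (le_trans (ltW (truncnS_gt _)))// ler_nat ltnS.
    by rewrite (leq_trans _ N1N)// leq_maxr.
pose r := Cu + n%:R.
have Mr : snorm M <= r.
  have [N [_ uM _]] := approx 1 0%N ltr01; rewrite mulr1 in uM.
  have -> : M = u N - (u N - M) by rewrite subKr.
  by rewrite (le_trans (snormB _ _))// lerD.
have ur N : snorm (u N) <= r by rewrite (le_trans (ub N))// lerDl.
have [K K0 lipK] := endpoint_lipschitz r.
exists M.
  suff -> : endpoint M = B' by rewrite /B' mulKVmx.
  apply/eqP; rewrite eq_sym -subr_eq0.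
  suff : `|B' - endpoint M| <= 0 by rewrite normr_le0.
  apply: (@le0_linear _ (C1 + K * n%:R)) => [|e e0 _].
    by rewrite addr_ge0// mulr_ge0.
  have [N [_ uM Ne]] := approx e 0%N e0.
  apply: le_trans (norm_le_snorm _ n_gt0) _.
  rewrite -(subrKA (endpoint (u N))) mulrDl.
  apply: le_trans (snormD _ _) _; apply: lerD.
    have := uE _ _ _ (ggood N) erefl; rewrite gB => /le_trans; apply.
    by rewrite ler_wpM2l.
  apply: le_trans (lipK _ _ (ur N) Mr) _.
  by rewrite -mulrA ler_wpM2l.
move=> l l0 AB.
have [D D0 isoD] := @iso_inner_le R n mu muc kappa n_gt0.
have r0 : 0 <= r := le_trans (snorm_ge0 _) Mr.
rewrite -(@ler_pXn2r _ 2)// ?nnegrE ?sqrtr_ge0// iso_norm_sqr// -subr_le0.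
(* [2 * l + 1] comes from (l + e)^2 <= l^2 + (2 l + 1) e, [C2] from the energy defect, and the last
   term from exchanging M for [u N], at distance at most n e, in both slots of the inner product. *)
apply: (@le0_linear _ (2 * l + 1 + C2 + D * (n%:R * (2 * r)))) => [|e e0 e1].
  have := mulr_ge0 D0 (mulr_ge0 (ler0n R n) r0).
  by rewrite mulrA mulrCA; nra.
have [N0 HN0] := chain_reach_cost n_gt0 mu_gt0 muc_gt0 kappa_gt0 l0 AB e0.
have [N [N0N uM Ne]] := approx e N0 e0.
have [g' g'B g'cost] := HN0 N.+1 (leqW N0N) isT.
have g'B' : chain_prod g' N.+1 = B' by rewrite /B' -g'B mulKmx.
have costN : N.+1%:R * chain_cost mu muc kappa (g N) N.+1 <= (l + e) ^+ 2.
  by apply: le_trans g'cost; rewrite ler_wpM2l// gmin.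
have E := uN _ _ _ (ggood N) erefl.
have C2e : C2 / N.+1%:R <= C2 * e by rewrite ler_wpM2l.
have diff : iso M M - iso (u N) (u N) <=
  D * (n%:R * e * r) + D * (n%:R * e * r).
  have -> : iso M M - iso (u N) (u N) = - iso (u N - M) (u N) - iso (u N - M) M.
    by rewrite !iso_innerBl// (iso_innerC _ _ _ n_gt0 M); ring.
  rewrite -!iso_innerNl//; apply: lerD; (apply: le_trans (ler_norm _) _;
    apply: le_trans (isoD _ _) _; rewrite snormN; apply: ler_wpM2l => //;
    by apply: ler_pM; rewrite ?snorm_ge0).
have le2 : (l + e) ^+ 2 <= l ^+ 2 + (2 * l + 1) * e by nra.
rewrite -/(u N) in E.
have -> : (2 * l + 1 + C2 + D * (n%:R * (2 * r))) * e =
  (2 * l + 1) * e + C2 * e + (D * (n%:R * e * r) + D * (n%:R * e * r)) by ring.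
have chain (x y z w v t s q m : R) : x - y <= t -> y <= z + w -> z <= v ->
    w <= s -> v <= m + q -> x - m <= q + s + t by lra.
exact: chain diff E costN C2e le2.
Qed.

Lemma le_dist_geod (A B : 'M[R]_n) (x : R) :
  (forall l, 0 <= l -> chain_reach mu muc kappa A B l -> x <= l) ->
  (x%:E <= dist_geod mu muc kappa A B)%E.
Proof.
move=> xl; apply: le_ereal_inf_tmp => _ [a [b [Y [[ab Ya Yb YC] ->]]]].
have [YGL cY [s [abs CY]]] := YC.
have CY' i : (i < size s)%N -> exists dY,
    C1_on (nth a (a :: s) i) (nth a (a :: s) i.+1) Y dY.
  by move=> /CY[dY [CdY _]]; exists dY.
have [l [l0 lE _ Yl]] := piecewise_C1_chain_reach n_gt0 mu_gt0 muc_gt0 kappa_gt0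
  abs YGL cY CY'.
by rewrite lE lee_fin; apply: xl => //; rewrite -Ya -Yb.
Qed.

End MinimalVelocity.

Theorem theorem4p7 (R : realType) (n : nat) (mu muc kappa : R)
    (A B : 'M[R]_n) (hn : (1 <= n)%N)
    (hmu : 0 < mu) (hmuc : 0 < muc) (hkappa : 0 < kappa)
    (hA : GLplus A) (hB : GLplus B) :
  let omega := muc / mu in
  exists M : 'M[R]_n,
    let X := fun t : R =>
      A *m expmx (t *: (sym_part M - omega *: skew_part M))
        *m expmx ((t * (1 + omega)) *: skew_part M) in
    [/\ forall t : R, 0 <= t <= 1 -> GLplus (X t),
        piecewise_C1 setT 0 1 X,
        X 0 = A,
        X 1 = B &
        (iso_norm mu muc kappa M)%:E = curve_length mu muc kappa 0 1 X
        /\ curve_length mu muc kappa 0 1 X = dist_geod mu muc kappa A B].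
Proof.
move=> omega.
have detA : \det A != 0 by rewrite gt_eqF.
have AU : A \in unitmx by rewrite unitmxE unitfE.
have detAB : 0 < \det (invmx A *m B).
  by rewrite det_mulmx det_inv mulr_gt0// invr_gt0.
have [M ME Mmin] := minimal_velocity_exists hn hmu hmuc hkappa AU detAB.
pose L := (1 + omega) *: skew_part M; pose S := M - L.
have SLM : S + L = M by rewrite subrK.
have LT : L^T = - L by rewrite linearZ/= trmx_skew_part scalerN.
have SE : sym_part M - omega *: skew_part M = S.
  by rewrite /S /L -[X in _ = X - _]sym_add_skew scalerDl scale1r opprD addrA
    addrK.
have XE : (fun t : R => A *m expmx (t *: (sym_part M - omega *: skew_part M))
    *m expmx ((t * (1 + omega)) *: skew_part M)) = geodesic A S L.
  by apply/funext => t; rewrite SE /geodesic /L scalerA.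
have X0 : geodesic A S L 0 = A by rewrite /geodesic !scale0r expmx0 !mulmx1.
have X1 : geodesic A S L 1 = B by rewrite /geodesic !scale1r -ME mulmxA.
have lenX : curve_length mu muc kappa 0 1 (geodesic A S L) =
    (iso_norm mu muc kappa M)%:E by exact: (geodesic_length _ _ _ hn SLM LT AU).
have inf_le : (dist_geod mu muc kappa A B <= (iso_norm mu muc kappa M)%:E)%E.
  (* If M = 0 the curve is constant, hence not admissible; then B = A, and arbitrarily short loops
     show that the infimum is at most 0. *)
  have [M0|M0] := eqVneq M 0.
    have BA : B = A.
      by rewrite -ME M0 /skew_part trmx0 subrr !scaler0 subrr expmx0 !mulmx1.
    rewrite BA (le_trans (dist_geod_refl_le0 _ _ _ hn detA))//.
    by rewrite lee_fin iso_norm_ge0.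
  apply: ereal_inf_lbound; exists 0, 1, (geodesic A S L).
  split; last exact/esym/lenX.
  split; [exact: ltr01|exact: X0|exact: X1|].
  apply: (geodesic_piecewise_C1 SLM hA) => t.
  exact: geodesic_velocity_neq0.
exists M; cbv zeta; rewrite XE; split; [ | |exact: X0|exact: X1|].
- by move=> t _; exact: det_geodesic_gt0.
- exact: (geodesic_piecewise_C1 SLM hA).
split; first exact/esym/lenX.
by rewrite lenX; apply/eqP; rewrite eq_le inf_le (le_dist_geod hn).
Qed.
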